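(* Let $\mathfrak{e}\subset\mathbb{R}$ be a compact set of positive logarithmic capacity, $x_*$ a point in $\overline{\mathbb{R}}\setminus\mathfrak{e}$, and $w_0(x)=1/|P_m(x)|$ where $P_m$ is a real polynomial of degree $m$ with all zeros (in $\mathbb{C}$) outside of $\mathfrak{e}$. Let $n_0=2(m+1)-\deg(T_{m+1,w_0,x_*})$. Then, for all $n\ge n_0$, $$W_n(\mathfrak{e},w_0,x_* )\ge\frac{2\,S(\mathfrak{e},w_0,x_* )}{1+\exp[-2(n-m)g_{\mathfrak{e}}(x_*,\infty)]}.$$
   Context: $\overline{\mathbb{R}}=\mathbb{R}\cup\{\infty\}$. $P_m$ has real coefficients but not necessarily real zeros. $\|\cdot\|_{\mathfrak{e}}$ is the sup norm over $\mathfrak{e}$, $\mathrm{C}(\mathfrak{e})$ is logarithmic capacity, and $g_{\mathfrak{e}}(z,z_0)$ is the Green function of $\overline{\mathbb{C}}\setminus\mathfrak{e}$ with logarithmic pole at $z_0$; for $x_*=\infty$ we use $g_{\mathfrak{e}}(\infty,\infty)=+\infty$ and $\exp(-\infty)=0$. Extremal polynomials: for finite $x_*$, $T_{n,w,x_*}$ is the unique minimizer of $\|wP\|_{\mathfrak{e}}$ among polynomials $P$ of degree at most $n$ with $P(x_* )=1$; for $x_*=\infty$, it is the unique minimizer among monic polynomials of degree $n$. Put $t_n(\mathfrak{e},w,x_* )=\|wT_{n,w,x_*}\|_{\mathfrak{e}}$. Since $\deg(T_{n,w,x_*})\in\{n-1,n\}$, one has $n_0\in\{m+1,m+2\}$.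 Widom factors: $W_n(\mathfrak{e},w,x_* )=t_n(\mathfrak{e},w,x_* )\,e^{n g_{\mathfrak{e}}(x_*,\infty)}$ for finite $x_*$, and $W_n(\mathfrak{e},w,\infty)=t_n(\mathfrak{e},w,\infty)/\mathrm{C}(\mathfrak{e})^n$. Szegő factor: $S(\mathfrak{e},w,x_* )=\exp\left[\int\log w(z)\,d\omega_{\mathfrak{e}}(z,x_* )\right]$, where $\omega_{\mathfrak{e}}(\cdot,x_* )$ is the harmonic measure of $\overline{\mathbb{C}}\setminus\mathfrak{e}$ at $x_*$. *)

(* Defs.v *)
From HB Require Import structures.
From mathcomp Require Import all_boot all_order all_algebra.
From mathcomp Require Import complex.
From mathcomp Require Import all_classical all_reals all_analysis.

Set Implicit Arguments.
Unset Strict Implicit.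
Unset Printing Implicit Defensive.

Import Order.TTheory GRing.Theory Num.Theory.
Import numFieldTopology.Exports numFieldNormedType.Exports.

Local Open Scope classical_set_scope.
Local Open Scope ring_scope.

(* For potential theory the complex plane is R * R, the pair (x, y) standing
   for x + iy, and the Riemann sphere is its one-point compactification:
   [Some p] is a finite point, [None] is infinity.  Likewise [option R] is the
   extended real line with a single point at infinity. *)
Definition sphere (R : realType) : topologicalType :=
  one_point_compactification (R * R)%type.

Definition real_line (R : realType) (x : option R) : sphere R :=
  omap (fun a => (a, 0)) x.

Definition pnorm (R : realType) (p : R * R) : R :=
  Num.sqrt (p.1 ^+ 2 + p.2 ^+ 2).

(* Complement of e in the sphere. *)
Definition dom (R : realType) (e : set R) : set (sphere R) :=
  ~` [set real_line (Some x) | x in e].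

(** Logarithmic capacity *)

(* I(mu) = \int \int log (1 / |x - y|) dmu(y) dmu(x); the kernel is +oo on the
   diagonal because lne 0 = -oo. *)
Definition log_energy (R : realType) (mu : probability (measurableTypeR R) R) :
    \bar R :=
  (\int[mu]_x \int[mu]_y (- lne (`|(x : R) - (y : R)|%R)%:E))%E.

Definition compactly_supported_in (R : realType) (E : set R)
    (mu : probability (measurableTypeR R) R) : Prop :=
  exists K : set R, [/\ compact K, K `<=` E & mu K = 1%E].

(* C(E) = exp (- inf I(mu)), over the probability measures mu with compact
   support contained in E. *)
Definition capacity (R : realType) (E : set R) : \bar R :=
  expeR (- ereal_inf [set log_energy mu | mu in compactly_supported_in E])%E.

(** Green function with pole at infinity *)

(* C^2 with vanishing Laplacian on the open set U of the plane. *)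
Definition harmonic_on (R : realType) (U : set (R * R)) (f : R * R -> R) :
    Prop :=
  forall p, U p ->
    [/\ forall v, derivable f p v,
        forall v w, derivable ('D_v f) p w,
        forall v w, {for p, continuous ('D_w ('D_v f))}
      & 'D_(1, 0) ('D_(1, 0) f) p + 'D_(0, 1) ('D_(0, 1) f) p = 0].

(* [g z] is g_e(z, infinity).  The last clause says that the boundary values
   of g are 0 on e outside of a set of zero capacity.  For e compact of positive
   capacity such a g exists and is unique off e (its values on e are junk). *)
Record is_green (R : realType) (e : set R) (g : sphere R -> \bar R) : Prop := {
  green_fin : forall p, dom e (Some p) -> g (Some p) \is a fin_num;
  green_ge0 : forall p, dom e (Some p) -> (0 <= g (Some p))%E;
  green_harmonic : harmonic_on [set p | dom e (Some p)]
                               (fun p => fine (g (Some p)));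
  green_bounded : forall r : R, exists M : R,
    forall p, dom e (Some p) -> pnorm p <= r -> (g (Some p) <= M%:E)%E;
  green_pole : g None = +oo%E;
  green_log : exists r M : R, forall p, dom e (Some p) -> r < pnorm p ->
    `|fine (g (Some p)) - ln (pnorm p)| <= M;
  green_boundary :
    capacity [set x | e x /\
      ~ (g z @[z --> within (dom e) (nbhs (real_line (Some x)))] --> 0%E)]
    = 0%E }.

(** Harmonic measure *)

(* The point of parameter t on the circle of radius r around z; around
   infinity this is read in the chart z |-> 1/z. *)
Definition circle_point (R : realType) (z : sphere R) (r t : R) : sphere R :=
  if z is Some p then Some (p.1 + r * cos t, p.2 + r * sin t)
  else Some (r^-1 * cos t, - (r^-1 * sin t)).

Definition circle_mean (R : realType) (u : sphere R -> \bar R) (z : sphere R)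
    (r : R) : \bar R :=
  (((2 * pi)^-1)%:E *
   \int[lebesgue_measure]_(t in `[0%R, (2 * pi)%R]) u (circle_point z r t))%E.

(* u : D -> [-oo, +oo[ is upper semicontinuous and satisfies the local submean
   inequality on the open set D of the sphere. *)
Definition subharmonic_on (R : realType) (D : set (sphere R))
    (u : sphere R -> \bar R) : Prop :=
  forall z, D z ->
    [/\ (u z < +oo)%E,
        (limf_esup u (nbhs z) <= u z)%E
      & exists2 rho : R, 0 < rho &
          forall r, 0 < r < rho -> (u z <= circle_mean u z r)%E].

(* Perron solution at z of the Dirichlet problem with boundary data phi on the
   complement of e in the sphere. *)
Definition perron (R : realType) (e : set R) (phi : R -> R) (z : sphere R) :
    \bar R :=
  ereal_sup [set u z | u in [set u : sphere R -> \bar R |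
    subharmonic_on (dom e) u /\
    forall x, e x ->
      (limf_esup u (within (dom e) (nbhs (real_line (Some x))))
        <= (phi x)%:E)%E]].

(* omega is the harmonic measure of the complement of e at z: a Borel
   probability measure on the boundary e which represents the Perron solutions
   of all continuous boundary data.  It exists and is unique when e is compact
   of positive capacity. *)
Definition is_harmonic_measure (R : realType) (e : set R) (z : sphere R)
    (omega : probability (measurableTypeR R) R) : Prop :=
  omega e = 1%E /\
  forall phi : R -> R, {within e, continuous phi} ->
    (\int[omega]_(x in e) (phi x)%:E)%E = perron e phi z.

Definition szego_factor (R : realType) (e : set R) (w : R -> R)
    (omega : probability (measurableTypeR R) R) : R :=
  expR (\int[omega]_(x in e) ln (w x)).

(** Extremal polynomials and Widom factors *)

Definition wnorm (R : realType) (e : set R) (w : R -> R) (Q : {poly R[i]}) :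
    R :=
  sup [set complex.Re `|real_complex R (w x) * Q.[real_complex R x]|
      | x in e].

Definition admissible (R : realType) (x : option R) (n : nat)
    (Q : {poly R[i]}) : Prop :=
  if x is Some a then (size Q <= n.+1)%N /\ Q.[real_complex R a] = 1
  else Q \is monic /\ size Q = n.+1.

Definition is_extremal (R : realType) (e : set R) (w : R -> R) (x : option R)
    (n : nat) (T : {poly R[i]}) : Prop :=
  admissible x n T /\
  forall Q, admissible x n Q -> wnorm e w T <= wnorm e w Q.

(* [t] stands for t_n(e, w, x) and [g] for the Green function of e. *)
Definition widom_factor (R : realType) (e : set R) (g : sphere R -> \bar R)
    (x : option R) (n : nat) (t : R) : R :=
  if x is Some a then t * expR (n%:R * fine (g (real_line (Some a))))
  else t / fine (capacity e) ^+ n.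

(* Main.v *)
Require Import Defs.
From HB Require Import structures.
From mathcomp Require Import all_boot all_order all_algebra.
From mathcomp Require Import complex.
From mathcomp Require Import ring lra.
From mathcomp Require Import all_classical all_reals all_analysis.
From mathcomp Require Import measurable_realfun lebesgue_measure.

(* Let [t] be the weighted norm of [T n] and [q] the coefficientwise real part
   of [T n], so that [|q| <= t |P|] on [e].  The polynomials [D_N] with
   [D_0 = 2], [D_1 = 2 q], [D_{N+2} = 2 q D_{N+1} - t^2 P^2 D_N] are, up to
   scaling, Chebyshev polynomials of [q / (t |P|)], hence [|D_N| <= 2 (t |P|)^N]
   on [e].  A weighted Bernstein-Walsh inequality then gives
   [|D_N| <= 2 A^N] at [xs], where [A] is the Widom factor divided by the Szego
   factor.  At infinity [D_N] has leading coefficient [2^N], and [N -> oo] yields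
   [2 <= A].  At a finite point [q = 1], so [D_N = l^N + l'^N] with [l + l' = 2]
   and [l l' = (t P)^2], and [N -> oo] yields [l <= A]; combined with the
   Bernstein-Walsh bound for [P] itself this is the claim.

   The Bernstein-Walsh inequality is obtained by exhibiting, for small
   [kappa, eps], the function [ln (max |D| kappa) - (k + eps) g] as a competitor
   in the Perron family.  Since [g >= 0], the boundary values of [g] are
   irrelevant.  At infinity [g] is replaced by [V] minus the potential of a near
   minimizer of the energy, restricted to the set where its potential is almost
   at most [V]; this difference is nonnegative off [e] because the potential is
   convex on the gaps of [e], so that no regularity of [e] is needed. *)

Set Implicit Arguments.
Unset Strict Implicit.
Unset Printing Implicit Defensive.

Import Order.TTheory GRing.Theory Num.Theory.
Import numFieldTopology.Exports numFieldNormedType.Exports.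

Local Open Scope classical_set_scope.
Local Open Scope ring_scope.

(** The two cases differ because [green_log] fixes [g] near infinity only up to a bounded error. At
    a finite point this suffices: the surplus [eps * g] drives the competitor to -oo at infinity,
    and it is read elsewhere. At infinity the competitor is read exactly where that error sits, and
    its constant must be tied to C(e); hence a function whose constant [V] comes from the energy
    that defines [capacity]. A near minimizer takes the place of the equilibrium measure, and its
    loss [eps] tends to 0 at the very end.

    The bound [n0 <= n] enters as [m < n]: then [t^2 P^2] has degree below [2 n], so [D_N] has
    degree at most [N n], and for [N > 0] its leading term comes from [(2 q)^N] alone.

    The denominator arises by eliminating [y = t |P|] at a finite [xs]. For [y <= 1],
    [1 + sqrt (1 - y^2) <= A] and [y <= A exp (-(n - m) g)] give
    [1 - A^2 exp (-2 (n - m) g) <= (A - 1)^2], that is [2 <= A (1 + exp (-2 (n - m) g))]. *)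

Lemma continuous_integrable_itv (R : realType) (f : R -> R) (a b : R) :
  continuous f ->
  (@lebesgue_measure R).-integrable `[a, b] (EFin \o f).
Proof.
move=> cf; apply: continuous_compact_integrable; first exact: segment_compact.
exact: continuous_subspaceT.
Qed.

(** Vanishing is asked at interior points only, since the polar Laplace equation says nothing about
    the radial derivative at radius 0. *)
Lemma derive0_const (R : realType) (f : R -> R) (a b : R) : a <= b ->
  (forall x, a <= x <= b -> derivable f x 1) ->
  (forall x, a < x < b -> 'D_1 f x = 0) -> f b = f a.
Proof.
rewrite le_eqVlt => /predU1P[->//|ab] df f0.
have cf : {within `[a, b], continuous f}.
  by apply: derivable_within_continuous => x; rewrite in_itv/=; exact: df.
have df0 x : x \in `]a, b[%R -> is_derive x 1 f 0.
  rewrite in_itv/= => /andP[ax xb]; split; first by apply: df; rewrite !ltW.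
  by rewrite f0// ax.
have [x xab] := MVT ab df0 cf.
by rewrite mul0r => /eqP; rewrite subr_eq0 => /eqP.
Qed.

(** * Mean values of harmonic functions *)

(* [B] stands for [dG / dt]; [laplace] is the Laplace equation in polar
   coordinates, multiplied by [r ^ 2].  It makes [r * mean Gr r] constant, hence
   zero. *)
Section polar_mean.
Context {R : realType}.
Variables (rho M : R) (G Gr Grr B Bt : R -> R -> R).
Hypothesis dG : forall r t : R, `|r| < rho -> is_derive r 1 (G^~ t) (Gr r t).
Hypothesis dGr : forall r t : R, `|r| < rho -> is_derive r 1 (Gr^~ t) (Grr r t).
Hypothesis dB : forall r t : R, `|r| < rho -> is_derive t 1 (B r) (Bt r t).
Hypothesis laplace : forall r t : R, `|r| < rho ->
  r * (Gr r t + r * Grr r t) + Bt r t = 0.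
Hypothesis Bper : forall r : R, `|r| < rho -> B r (2 * pi) = B r 0.
Hypothesis cG : forall r : R, `|r| < rho -> continuous (G r).
Hypothesis cGr : forall r : R, `|r| < rho -> continuous (Gr r).
Hypothesis cGrr : forall r : R, `|r| < rho -> continuous (Grr r).
Hypothesis bGr : forall r t : R, `|r| < rho -> `|Gr r t| <= M.
Hypothesis bGrr : forall r t : R, `|r| < rho -> `|Grr r t| <= M.

Local Notation mean F :=
  (fun r : R => \int[lebesgue_measure]_(t in `[0, 2 * pi]) F r t).

(** Differentiation under the integral sign, dominated by the constant [M]. Negative radii are
    allowed so that radius 0 is an interior point with a two-sided derivative. *)
Let mean_derive (F Fr : R -> R -> R) (r : R) : `|r| < rho ->
  (forall r t : R, `|r| < rho -> is_derive r 1 (F^~ t) (Fr r t)) ->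
  (forall r : R, `|r| < rho -> continuous (F r)) ->
  (forall r t : R, `|r| < rho -> `|Fr r t| <= M) ->
  derivable (mean F) r 1 /\ 'D_1 (mean F) r = mean Fr r.
Proof.
move=> rrho dF cF bF.
have mI : measurable (`[0, 2 * pi] : set R) by exact: measurable_itv.
have I r' : `]- rho, rho[%classic r' -> `|r'| < rho.
  by rewrite /= in_itv/= ltr_norml.
have Ir : `]- rho, rho[%classic r by rewrite /= in_itv/= -ltr_norml.
have H1 : forall x, `]- rho, rho[%classic x ->
  lebesgue_measure.-integrable `[0, 2 * pi] (EFin \o F x).
  by move=> x /I xr; apply: continuous_integrable_itv; exact: cF.
have H2 : forall x y, `]- rho, rho[%classic x -> `[0, 2 * pi]%classic y ->
    derivable (F ^~ y) x 1.
  by move=> x y /I xr _; have [] := dF x y xr.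
have M0 : 0 <= M by rewrite (le_trans _ (bF r 0 rrho)).
have H3 : lebesgue_measure.-integrable `[0, 2 * pi] (EFin \o (fun _ : R => M)).
  by apply: continuous_integrable_itv; exact: cst_continuous.
have H4 : forall x y, `]- rho, rho[%classic x -> `[0, 2 * pi]%classic y ->
    `|partial1of2 F x y| <= M.
  move=> x y /I xr _; rewrite partial1of2E.
  by have [_ ->] := dF x y xr; exact: bF.
split.
  exact: (@derivable_under_integral _ _ _ lebesgue_measure F _ mI r _ _ Ir H1 H2
    (fun=> M) (fun=> M0) H3 H4).
rewrite -derive1E.
rewrite (@differentiation_under_integral _ _ _ lebesgue_measure F _ mI r _ _ Ir H1 H2
    (fun=> M) (fun=> M0) H3 H4).
apply: eq_Rintegral => t _; rewrite partial1of2E.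
by have [_ ->] := dF r t rrho.
Qed.

Let mean_Gr0 (r : R) : 0 < r -> r < rho -> mean Gr r = 0.
Proof.
move=> r0 rrho.
have small (x : R) : 0 <= x <= r -> `|x| < rho.
  by move=> /andP[x0 xr]; rewrite ger0_norm// (le_lt_trans xr).
have dmGr (x : R) : 0 <= x <= r -> derivable (mean Gr) x 1 /\
    'D_1 (mean Gr) x = mean Grr x.
  by move=> /small xr; apply: mean_derive.
have : r * mean Gr r = 0 * mean Gr 0.
  apply: (@derive0_const _ (fun x => x * mean Gr x)); first exact: ltW.
    move=> x /dmGr[dx _].
    by apply: derivableM => //; exact: derivable_id.
  move=> x /andP[x0 xr].
  have xin : 0 <= x <= r by rewrite !ltW.
  have [dx Dx] := dmGr x xin.
  have -> : (fun x => x * mean Gr x) = id * mean Gr by [].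
  rewrite (@deriveM _ _ id)//.
  rewrite Dx derive_id /= /GRing.scale/= mulr1.
  (* Multiplied by [x], the derivative of [x * mean Gr x] becomes the integral of [- Bt x] by
     [laplace], which is 0 because [B x] takes the same value at both ends of a full turn. *)
  apply: (mulfI (lt0r_neq0 x0)); rewrite mulr0 mulrDr -RintegralZl//; last first.
    exact/continuous_integrable_itv/cGrr/small.
  have cx : continuous (fun t => x * Grr x t).
    by move=> t; apply: cvgM; [exact: cvg_cst|exact/cGrr/small].
  rewrite addrC -mulrDr -RintegralD//; last 2 first.
    exact/continuous_integrable_itv/cGr/small.
    exact/continuous_integrable_itv.
  have cx' : continuous (fun t => Gr x t + x * Grr x t).
    by move=> t; apply: cvgD; [exact/cGr/small|exact/cx].
  rewrite -RintegralZl//; last exact/continuous_integrable_itv.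
  have BtE : Bt x = (fun t => - (x * (Gr x t + x * Grr x t))).
    apply/funext => t; apply/eqP; rewrite -addr_eq0 addrC.
    by apply/eqP/laplace/small.
  have cBt : continuous (Bt x).
    by rewrite BtE => t; apply: cvgN; apply: cvgM; [exact: cvg_cst|exact/cx'].
  have dBx t : derivable (B x) t 1 by have [] := dB t (small x xin).
  have cB : continuous (B x).
    by move=> t; apply: differentiable_continuous; exact/derivable1_diffP.
  have pi0 : 0 < 2 * pi :> R by rewrite mulr_gt0// pi_gt0.
  have LR : derivable_oo_LRcontinuous (B x) 0 (2 * pi).
    split=> //; first exact: cvg_at_right_filter (cB _).
    exact: cvg_at_left_filter (cB _).
  have BB : {in `]0, 2 * pi[, (derive1 (B x)) =1 Bt x}.
    by move=> t _; rewrite derive1E; have [_ ->] := dB t (small x xin).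
  have := continuous_FTC2 pi0 (continuous_subspaceT cBt) LR BB.
  rewrite Bper ?subee//; last exact: small.
  move=> intB.
  rewrite (_ : (fun _ => _) = fun t => - Bt x t); last first.
    by apply/funext => t; rewrite BtE opprK.
  have -> : \int[lebesgue_measure]_(t in `[0, 2 * pi]) (- Bt x t) =
      (-1) * \int[lebesgue_measure]_(t in `[0, 2 * pi]) (Bt x t).
    rewrite -RintegralZl//; last exact/continuous_integrable_itv.
    by apply: eq_Rintegral => t _; rewrite mulN1r.
  by rewrite /Rintegral intB /= mulr0.
by rewrite mul0r => /eqP; rewrite mulf_eq0 (gt_eqF r0) => /eqP.
Qed.

Lemma polar_mean (r : R) : 0 <= r -> r < rho -> mean G r = mean G 0.
Proof.
move=> r0 rrho.
have dmG (x : R) : 0 <= x <= r -> derivable (mean G) x 1 /\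
    'D_1 (mean G) x = mean Gr x.
  move=> /andP[x0 xr]; apply: mean_derive => //.
  by rewrite ger0_norm// (le_lt_trans xr).
apply: (@derive0_const _ (mean G)) => // x; first by move=> /dmG[].
move=> /andP[x0 xr]; have [_ ->] := dmG x ltac:(by rewrite !ltW).
exact/mean_Gr0/(lt_trans xr).
Qed.

End polar_mean.

Section real_derivatives.
Context {R : realType}.
Implicit Types (f g : R -> R) (x : R).

Lemma is_derive_add f g x (df dg : R) :
  is_derive x 1 f df -> is_derive x 1 g dg ->
  is_derive x 1 (fun y => f y + g y) (df + dg).
Proof. by move=> Hf Hg; apply: (@is_deriveD _ _ _ f g x 1 df dg). Qed.

Lemma is_derive_mul f g x (df dg : R) :
  is_derive x 1 f df -> is_derive x 1 g dg ->
  is_derive x 1 (fun y => f y * g y) (f x * dg + g x * df).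
Proof. by move=> Hf Hg; apply: (@is_deriveM _ _ f g x 1 df dg). Qed.

Lemma is_derive_chain f g x (df dg : R) :
  is_derive x 1 f df -> is_derive (f x) 1 g dg ->
  is_derive x 1 (fun y => g (f y)) (dg * df).
Proof.
move=> [f1 <-] [g1 <-]; split; last first.
  by have := derive1_comp f1 g1; rewrite !derive1E.
move/derivable1_diffP : f1 => f1; move/derivable1_diffP : g1 => g1.
by apply/derivable1_diffP; exact: differentiable_comp.
Qed.

Lemma is_derive_div f g x (df dg : R) : g x != 0 ->
  is_derive x 1 f df -> is_derive x 1 g dg ->
  is_derive x 1 (fun y => f y / g y) ((df * g x - f x * dg) / g x ^+ 2).
Proof.
move=> gx0 Hf [dgx Dgx].
have Hg : is_derive x 1 (fun y => (g y)^-1) (- (g x) ^- 2 * dg).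
  by split; [exact: derivableV|rewrite deriveV// Dgx].
apply: is_derive_eq (is_derive_mul Hf Hg) _.
by field.
Qed.

End real_derivatives.

(** The integrand is ln |1 + (a - ib) e^{it}|^2. Scaling a - ib by [r] gives a function harmonic on
    a disc of radius larger than 1, so the mean at [r = 1] equals the mean at [r = 0], where the
    integrand is [ln 1]. *)
Lemma circle_mean_ln (R : realType) (a b : R) : a ^+ 2 + b ^+ 2 < 1 ->
  \int[lebesgue_measure]_(t in `[0, 2 * pi])
    ln (1 + 2 * (a * cos t + b * sin t) + (a ^+ 2 + b ^+ 2)) = 0.
Proof.
set q := a ^+ 2 + b ^+ 2 => q1.
have q0 : 0 <= q by rewrite addr_ge0 ?sqr_ge0.
pose s : R := Num.sqrt q.
have s0 : 0 <= s by exact: sqrtr_ge0.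
have s2 : s ^+ 2 = q by rewrite sqr_sqrtr.
have s1 : s < 1 by rewrite -(ltr_pXn2r (n := 2)) ?nnegrE// s2 expr1n.
(* A radius larger than 1 with [rho * s < 1], a choice that also covers [s = 0]. *)
pose rho : R := 2 / (1 + s).
have rho1 : 1 < rho by rewrite /rho ltr_pdivlMr; lra.
pose k : R := rho * s.
have k0 : 0 <= k by rewrite mulr_ge0// ltW// (lt_trans _ rho1).
have k1 : k < 1 by rewrite /k /rho mulrAC ltr_pdivrMr; lra.
(* [X] and [- Y] are the real and imaginary parts of (a - ib) e^{it}, and [Y] is the derivative of
   [X]. *)
pose X (t : R) : R := a * cos t + b * sin t.
pose Y (t : R) : R := b * cos t - a * sin t.
have XY (t : R) : X t ^+ 2 + Y t ^+ 2 = q.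
  have := cos2Dsin2 t.
  rewrite (_ : X t ^+ 2 + Y t ^+ 2 = q * (cos t ^+ 2 + sin t ^+ 2)).
    by move=> ->; rewrite mulr1.
  by rewrite /X /Y /q; ring.
have Xs (t : R) : `|X t| <= s.
  rewrite -(ler_pXn2r (n := 2)) ?nnegrE// real_normK ?num_real// s2 -(XY t).
  by rewrite lerDl sqr_ge0.
pose N (r t : R) : R := 1 + 2 * r * X t + r ^+ 2 * q.
pose d : R := (1 - k) ^+ 2.
have d0 : 0 < d by rewrite exprn_gt0// subr_gt0.
have Nd (r t : R) : `|r| < rho -> d <= N r t.
  move=> rr; have rX : `|r * X t| <= k.
    by rewrite normrM ler_pM// ltW.
  have -> : N r t = (1 + r * X t) ^+ 2 + (r * Y t) ^+ 2.
    by rewrite /N -(XY t); ring.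
  rewrite -[leLHS]addr0 lerD ?sqr_ge0//.
  move: rX; rewrite ler_norml => /andP[rX _].
  have k01 : 0 <= 1 - k by rewrite subr_ge0 ltW.
  have rX1 : 1 - k <= 1 + r * X t by rewrite lerD2l.
  by rewrite ler_pXn2r// nnegrE (le_trans k01).
have N0 (r t : R) : `|r| < rho -> 0 < N r t by move=> rr; rewrite (lt_le_trans d0)// Nd.
pose L (r t : R) : R := 2 * X t + 2 * r * q.
pose G (r t : R) : R := ln (N r t).
pose Gr (r t : R) : R := L r t / N r t.
pose Grr (r t : R) : R := (2 * q * N r t - L r t * L r t) / N r t ^+ 2.
pose B (r t : R) : R := 2 * r * Y t / N r t.
pose Bt (r t : R) : R := (- 2 * r * X t * N r t - (2 * r * Y t) * (2 * r * Y t)) / N r t ^+ 2.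
have dN (r t : R) : is_derive r 1 (N ^~ t) (L r t).
  by rewrite /N; apply: is_derive_eq; rewrite /GRing.scale/= /L; ring.
have dL (r t : R) : is_derive r 1 (L ^~ t) (2 * q).
  by rewrite /L; apply: is_derive_eq; rewrite /GRing.scale/=; ring.
have dX (t : R) : is_derive t 1 X (Y t).
  by rewrite /X; apply: is_derive_eq; rewrite /GRing.scale/= /Y; ring.
have dY (t : R) : is_derive t 1 Y (- X t).
  by rewrite /Y; apply: is_derive_eq; rewrite /GRing.scale/= /X; ring.
have dNt (r t : R) : is_derive t 1 (N r) (2 * r * Y t).
  by rewrite /N; apply: is_derive_eq; rewrite /GRing.scale/= /Y; ring.
have cont (f df : R -> R) : (forall t : R, is_derive t 1 f (df t)) -> continuous f.
  move=> h t; apply: differentiable_continuous; apply/derivable1_diffP.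
  by have [] := h t.
have cX : continuous X by exact: cont dX.
have cN (r : R) : continuous (N r) by exact: cont (dNt r).
have cL (r : R) : continuous (L r).
  move=> t; apply: cvgD; last exact: cvg_cst.
  by apply: cvgM; [exact: cvg_cst|exact: cX].
have cG (r : R) : `|r| < rho -> continuous (G r).
  move=> rr t; apply: continuous_comp; first exact: cN.
  by apply: continuous_ln; exact: N0.
have NV (r t : R) : `|r| < rho -> `|(N r t)^-1| <= d^-1.
  by move=> rr; rewrite gtr0_norm ?invr_gt0 ?N0// lef_pV2 ?posrE ?N0// Nd.
pose c : R := 2 * s + 2 * rho * q.
have Lc (r t : R) : `|r| < rho -> `|L r t| <= c.
  move=> rr; rewrite /L /c (le_trans (ler_normD _ _))// lerD//.
    by rewrite normrM ger0_norm// ler_pM2l.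
  by rewrite normrM (ger0_norm q0) ler_wpM2r// normrM ger0_norm// ler_pM2l// ltW.
pose M : R := c / d + (2 * q / d + (c / d) ^+ 2).
have c0 : 0 <= c by rewrite (le_trans _ (Lc 0 0 _)) ?normr0// (lt_trans _ rho1).
have M2 : 0 <= 2 * q / d + (c / d) ^+ 2.
  apply: addr_ge0; last exact: sqr_ge0.
  by apply: divr_ge0; [exact: mulr_ge0|exact: ltW].
have GrB (r t : R) : `|r| < rho -> `|Gr r t| <= c / d.
  by move=> rr; rewrite /Gr normrM ler_pM// ?Lc// NV.
have -> : (fun t => ln (1 + 2 * (a * cos t + b * sin t) + q)) = G 1.
  by apply/funext => t; rewrite /G /N /X mulr1 expr1n mul1r.
transitivity (\int[lebesgue_measure]_(t in `[0, 2 * pi]) G 0 t); last first.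
  rewrite (_ : G 0 = cst 0) ?Rintegral_cst ?mul0r//.
  by apply/funext => t; rewrite /G /N mulr0 mul0r expr0n mul0r !addr0 ln1.
have dG : forall r t : R, `|r| < rho -> is_derive r 1 (G^~ t) (Gr r t).
  move=> r t rr.
  by have := is_derive_chain (dN r t) (is_derive1_ln (N0 r t rr)); rewrite mulrC.
have dGr : forall r t : R, `|r| < rho -> is_derive r 1 (Gr^~ t) (Grr r t).
  move=> r t rr; rewrite /Grr.
  by apply: is_derive_div; rewrite ?gt_eqF ?N0.
have dB : forall r t : R, `|r| < rho -> is_derive t 1 (B r) (Bt r t).
  move=> r t rr.
  have dn := is_derive_mul (is_derive_cst (2 * r : R) t 1) (dY t).
  have Nn0 : N r t != 0 by rewrite gt_eqF ?N0.
  have /is_derive_eq := is_derive_div Nn0 dn (dNt r t); apply.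
  by rewrite /Bt /cst/=; congr (_ / _); ring.
have laplace : forall r t : R, `|r| < rho ->
    r * (Gr r t + r * Grr r t) + Bt r t = 0.
  move=> r t rr; rewrite /Gr /Grr /Bt.
  have := N0 r t rr => /lt0r_neq0 Nn0.
  have -> : L r t = 2 * X t + 2 * r * q by [].
  have NE : N r t = 1 + 2 * r * X t + r ^+ 2 * q by [].
  have -> : r * ((2 * X t + 2 * r * q) / N r t + r * ((2 * q * N r t -
      (2 * X t + 2 * r * q) * (2 * X t + 2 * r * q)) / N r t ^+ 2)) +
      (- 2 * r * X t * N r t - 2 * r * Y t * (2 * r * Y t)) / N r t ^+ 2 =
      4 * r ^+ 2 * (q * N r t - ((X t + r * q) ^+ 2 + Y t ^+ 2)) / N r t ^+ 2.
    by field.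
  rewrite NE (_ : Y t ^+ 2 = q - X t ^+ 2); last by rewrite -(XY t); ring.
  by rewrite (_ : _ - _ = 0) ?mulr0 ?mul0r//; ring.
have Bper : forall r : R, `|r| < rho -> B r (2 * pi) = B r 0.
  move=> r rr; rewrite /B /Y.
  have pi2 : 2 * pi = pi *+ 2 :> R by rewrite mulr_natl.
  have -> : N r (2 * pi) = N r 0.
    by rewrite /N /X pi2 cos2pi sin2pi cos0 sin0.
  by rewrite pi2 cos2pi sin2pi cos0 sin0.
have cGr : forall r : R, `|r| < rho -> continuous (Gr r).
  move=> r rr t; apply: cvgM; first exact: cL.
  by apply: cvgV; [rewrite gt_eqF ?N0|exact: cN].
have cGrr : forall r : R, `|r| < rho -> continuous (Grr r).
  move=> r rr t; apply: cvgM; last first.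
    apply: cvgV; first by rewrite expf_neq0// gt_eqF ?N0.
    by apply: cvgM; exact: cN.
  apply: cvgB; first by apply: cvgM; [exact: cvg_cst|exact: cN].
  by apply: cvgM; exact: cL.
have bGr : forall r t : R, `|r| < rho -> `|Gr r t| <= M.
  by move=> r t rr; rewrite (le_trans (GrB r t rr))// lerDl.
have bGrr : forall r t : R, `|r| < rho -> `|Grr r t| <= M.
  move=> r t rr.
  have -> : Grr r t = 2 * q / N r t - Gr r t ^+ 2.
    rewrite /Grr /Gr; field.
    by rewrite gt_eqF ?N0.
  rewrite (le_trans (ler_normB _ _))//.
  rewrite -[leLHS]add0r lerD ?divr_ge0// ?(ltW d0)//.
  rewrite lerD//.
    by rewrite normrM ger0_norm ?mulr_ge0// ler_wpM2l ?mulr_ge0// NV.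
  by rewrite normrX ler_pXn2r ?nnegrE ?GrB// divr_ge0// ltW.
exact: (polar_mean dG dGr dB laplace Bper cG cGr cGrr bGr bGrr).
Qed.

(** * Differentiability in the plane from partial derivatives *)

Lemma littleo_differentiable (K : numFieldType) (V W : normedModType K)
    (f : V -> W) (df : {linear V -> W}) (p : V) : continuous df ->
  (forall eps, 0 < eps -> \forall h \near (0 : V),
     `|f (h + p) - f p - df h| <= eps * `|h|) ->
  differentiable f p.
Proof.
move=> cdf H.
apply/diffP => /=.
(* The differential ['d f p] is obtained by choice among continuous linear maps with a little-o
   remainder, so it is enough to exhibit [df] as one of them. *)
apply: (@getPex _ (fun (df : {linear V -> W}) => continuous df /\
  forall y, f y = f (lim (nbhs p)) + df (y - lim (nbhs p))
                  +o_(y \near p) (y - lim (nbhs p)))).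
exists df; split=> //; rewrite lim_id//.
suff : f = (fun y => f p + df (y - p)) +o_ p (fun y => y - p).
  by rewrite funeqE.
apply/eqaddoP => eps eps0; rewrite [\forall x \near _, _ <= _](near_shift 0) subr0.
near=> h; rewrite /= !fctE/= addrK opprD addrA.
by near: h; exact: H.
Unshelve. all: by end_near. Qed.

Section plane_calculus.
Context {R : realType}.
Implicit Types (f : R * R -> R) (p q : R * R).

(** The hypotheses range over the symmetric interval around [a], so that the sign of the increment
    [b - a] does not matter to the caller. *)
Lemma mvt_near_affine (phi dphi : R -> R) (a b c eps : R) :
  (forall s : R, `|s - a| <= `|b - a| -> is_derive s 1 phi (dphi s)) ->
  (forall s : R, `|s - a| <= `|b - a| -> `|dphi s - c| <= eps) ->
  `|phi b - phi a - c * (b - a)| <= eps * `|b - a|.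
Proof.
move=> dphiE dphic.
have aux (u v : R) : u <= v ->
    (forall s : R, u <= s <= v -> is_derive s 1 phi (dphi s) /\ `|dphi s - c| <= eps) ->
    `|phi v - phi u - c * (v - u)| <= eps * `|v - u|.
  move=> uv H; have dphi' (s : R) : s \in `]u, v[%R -> is_derive s 1 phi (dphi s).
    by rewrite in_itv/= => /andP[us sv]; have /H[] : u <= s <= v by rewrite (ltW us) ltW.
  have cphi : {within `[u, v], continuous phi}.
    apply: derivable_within_continuous => s; rewrite in_itv/= => suv.
    by have [[]] := H s suv.
  have [s suv ->] := MVT_segment uv dphi' cphi.
  rewrite -mulrBl normrM ler_wpM2r//.
  by move: suv; rewrite in_itv/= => /H[].
have [ab|ba] := leP a b.
  apply: aux => // s /andP[as_ sb].
  suff h : `|s - a| <= `|b - a| by split; [exact: dphiE|exact: dphic].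
  by rewrite !ger0_norm ?subr_ge0// lerD2r.
have -> : phi b - phi a - c * (b - a) = - (phi a - phi b - c * (a - b)) by ring.
rewrite normrN (distrC b).
apply: aux; first exact: ltW.
move=> s /andP[bs sa].
suff h : `|s - a| <= `|b - a| by split; [exact: dphiE|exact: dphic].
by rewrite !ler0_norm ?subr_le0// ?lerN2 ?lerD2r// ltW.
Qed.

Definition linear_form (a b : R) (h : R * R) : R := h.1 * a + h.2 * b.

Lemma linear_form_is_linear a b : linear (linear_form a b).
Proof.
move=> k [u1 u2] [v1 v2]; rewrite /linear_form /= /GRing.scale/=. ring.
Qed.

HB.instance Definition _ a b := GRing.isLinear.Build R (R * R)%type R *:%R
  (linear_form a b) (linear_form_is_linear a b).

Lemma is_derive_slice1 f (x y d : R) : is_derive (x, y) (1, 0) f d ->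
  is_derive x 1 (fun s => f (s, y)) d.
Proof.
have E : (fun h : R => h^-1 *: ((f \o shift (x, y)) (h *: (1, 0)) - f (x, y))) =
    (fun h : R => h^-1 *: (((fun s => f (s, y)) \o shift x) (h *: 1) - f (x, y))).
  apply/funext => h; congr (_ *: (f _ - _)); rewrite /= /shift/=.
  by congr (_, _); rewrite -[LHS]/(h * 0 + y) mulr0 add0r.
by move=> [H1 H2]; split; [move: H1|move: H2]; rewrite /derivable /derive E.
Qed.

Lemma is_derive_slice2 f (x y d : R) : is_derive (x, y) (0, 1) f d ->
  is_derive y 1 (fun s => f (x, s)) d.
Proof.
have E : (fun h : R => h^-1 *: ((f \o shift (x, y)) (h *: (0, 1)) - f (x, y))) =
    (fun h : R => h^-1 *: (((fun s => f (x, s)) \o shift y) (h *: 1) - f (x, y))).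
  apply/funext => h; congr (_ *: (f _ - _)); rewrite /= /shift/=.
  by congr (_, _); rewrite -[LHS]/(h * 0 + x) mulr0 add0r.
by move=> [H1 H2]; split; [move: H1|move: H2]; rewrite /derivable /derive E.
Qed.

Lemma linear_form_continuous a b : continuous (linear_form a b).
Proof.
move=> h; apply: cvgD.
  by apply: cvgM; [exact: cvg_fst|exact: cvg_cst].
by apply: cvgM; [exact: cvg_snd|exact: cvg_cst].
Qed.

(** The increment from [p] to [h + p] is split into a vertical and a horizontal move, and the mean
    value theorem is applied to each. The result turns the directional derivatives of [harmonic_on]
    into a differential, which the chain rule along circles requires. *)
Lemma C1_differentiable f (fx fy : R * R -> R) (U : set (R * R)) p :
  open U -> U p ->
  (forall q, U q -> is_derive q (1, 0) f (fx q)) ->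
  (forall q, U q -> is_derive q (0, 1) f (fy q)) ->
  {for p, continuous fx} -> {for p, continuous fy} ->
  differentiable f p.
Proof.
move=> oU Up dfx dfy cfx cfy.
apply: (@littleo_differentiable _ _ _ f (linear_form (fx p) (fy p))).
  exact: linear_form_continuous.
move=> eps eps0.
have e20 : 0 < eps / 2 by rewrite divr_gt0.
move/cvgrPdist_le : cfx => /(_ _ e20) nx.
move/cvgrPdist_le : cfy => /(_ _ e20) ny.
have nU : nbhs p U by exact: open_nbhs_nbhs.
have [d d0 dP] : exists2 d : R, 0 < d & ball p d `<=`
    [set q | [/\ U q, `|fx p - fx q| <= eps / 2 & `|fy p - fy q| <= eps / 2]].
  have /nbhs_ballP[d0' /= d00 H] : nbhs p
    [set q | [/\ U q, `|fx p - fx q| <= eps / 2 & `|fy p - fy q| <= eps / 2]].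
    by near=> q; split; near: q.
  by exists d0'.
near=> h.
have hd : `|h| < d by near: h; exact: (@nbhs0_lt R (R * R)%type d d0).
have inb (s t : R) : `|s - p.1| <= `|h.1| -> `|t - p.2| <= `|h.2| -> ball p d (s, t).
  move=> s1 t1; split; rewrite -ball_normE/= distrC.
    by rewrite (le_lt_trans s1)// (le_lt_trans _ hd)// prod_normE le_max lexx.
  by rewrite (le_lt_trans t1)// (le_lt_trans _ hd)// prod_normE le_max lexx orbT.
have h1 : `|h.1| <= `|h| by rewrite prod_normE le_max lexx.
have h2 : `|h.2| <= `|h| by rewrite prod_normE le_max lexx orbT.
have E1 : `|f (h.1 + p.1, h.2 + p.2) - f (p.1, h.2 + p.2) - fx p * (h.1 + p.1 - p.1)|
    <= eps / 2 * `|h.1 + p.1 - p.1|.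
  apply: (@mvt_near_affine (fun s => f (s, h.2 + p.2)) (fun s => fx (s, h.2 + p.2))).
    move=> s; rewrite addrK => sh; apply: is_derive_slice1; apply: dfx.
    by have [] := dP _ (inb s (h.2 + p.2) sh _); rewrite // addrK.
  move=> s; rewrite addrK => sh; rewrite distrC.
  by have [] := dP _ (inb s (h.2 + p.2) sh _); rewrite // addrK.
have E2 : `|f (p.1, h.2 + p.2) - f (p.1, p.2) - fy p * (h.2 + p.2 - p.2)|
    <= eps / 2 * `|h.2 + p.2 - p.2|.
  apply: (@mvt_near_affine (fun s => f (p.1, s)) (fun s => fy (p.1, s))).
    move=> s; rewrite addrK => sh; apply: is_derive_slice2; apply: dfy.
    by have [] := dP _ (inb p.1 s _ sh); rewrite // subrr normr0.
  move=> s; rewrite addrK => sh; rewrite distrC.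
  by have [] := dP _ (inb p.1 s _ sh); rewrite // subrr normr0.
rewrite !addrK in E1 E2.
have -> : f (h + p) - f p - linear_form (fx p) (fy p) h =
   (f (h.1 + p.1, h.2 + p.2) - f (p.1, h.2 + p.2) - fx p * h.1) +
   (f (p.1, h.2 + p.2) - f (p.1, p.2) - fy p * h.2).
  have -> : f (h + p) = f (h.1 + p.1, h.2 + p.2) by [].
  have -> : f p = f (p.1, p.2) by rewrite -surjective_pairing.
  by rewrite /linear_form; ring.
rewrite (le_trans (ler_normD _ _))// [eps in leRHS]splitr mulrDl lerD//.
  by rewrite (le_trans E1)// ler_pM2l.
by rewrite (le_trans E2)// ler_pM2l.
Unshelve. all: by end_near. Qed.

End plane_calculus.

Lemma pnorm_ge0 (R : realType) (p : R * R) : 0 <= pnorm p.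
Proof. exact: sqrtr_ge0. Qed.

Lemma sqr_pnorm (R : realType) (p : R * R) : pnorm p ^+ 2 = p.1 ^+ 2 + p.2 ^+ 2.
Proof. by rewrite sqr_sqrtr// addr_ge0// sqr_ge0. Qed.

Lemma norm1_le_pnorm (R : realType) (p : R * R) : `|p.1| <= pnorm p.
Proof.
rewrite -(ler_pXn2r (n := 2)) ?nnegrE ?pnorm_ge0// real_normK ?num_real//.
by rewrite sqr_pnorm lerDl sqr_ge0.
Qed.

Lemma norm2_le_pnorm (R : realType) (p : R * R) : `|p.2| <= pnorm p.
Proof.
rewrite -(ler_pXn2r (n := 2)) ?nnegrE ?pnorm_ge0// real_normK ?num_real//.
by rewrite sqr_pnorm lerDr sqr_ge0.
Qed.

Definition circle_at (R : realType) (p : R * R) (r t : R) : R * R :=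
  (p.1 + r * cos t, p.2 + r * sin t).

Section harmonic_mean.
Context {R : realType}.
Implicit Types (f : R * R -> R) (p q : R * R).

Lemma circle_at_dist p r t : pnorm (circle_at p r t - p) = `|r|.
Proof.
rewrite /pnorm /= -[X in X ^+ 2 + _]/(p.1 + r * cos t - p.1).
rewrite -[X in _ + X ^+ 2]/(p.2 + r * sin t - p.2).
rewrite -sqrtr_sqr; congr Num.sqrt.
rewrite -[RHS]mulr1 -(cos2Dsin2 t); ring.
Qed.

Lemma is_derive_curve f (a b : R -> R) (t da db : R) :
  differentiable f (a t, b t) -> is_derive t 1 a da -> is_derive t 1 b db ->
  is_derive t 1 (fun u => f (a u, b u))
    (da * 'D_(1, 0) f (a t, b t) + db * 'D_(0, 1) f (a t, b t)).
Proof.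
move=> df [a1 aE] [b1 bE].
move/derivable1_diffP : (a1) => a2; move/derivable1_diffP : (b1) => b2.
have dab : differentiable (fun u : R => (a u, b u)) t.
  exact: differentiable_pair.
have dfab : differentiable (f \o (fun u : R => (a u, b u))) t.
  exact: differentiable_comp.
split; first exact/derivable1_diffP.
rewrite (deriveE _ dfab) diff_comp//= diff_pair//= -!deriveE// aE bE.
have -> : (da, db) = da *: ((1, 0) : (R * R)%type) + db *: ((0, 1) : (R * R)%type).
  rewrite -[RHS]/(da * 1 + db * 0, da * 0 + db * 1).
  by rewrite !mulr1 !mulr0 addr0 add0r.
by rewrite deriveE// linearD !linearZ /= -!deriveE.
Qed.

Let grad (U : set (R * R)) (h hx hy : R * R -> R) := forall q, U q ->
  [/\ differentiable h q, 'D_(1, 0) h q = hx q & 'D_(0, 1) h q = hy q].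

(** On a small disc all first and second derivatives are bounded, so [f] written in polar
    coordinates around [p] meets the hypotheses of [polar_mean]. *)
Let C2_circle_mean (U : set (R * R)) (f fx fy fxx fxy fyx fyy : R * R -> R) p :
  open U -> U p -> grad U f fx fy -> grad U fx fxx fxy -> grad U fy fyx fyy ->
  (forall q, U q -> [/\ {for q, continuous fxx}, {for q, continuous fxy},
     {for q, continuous fyx} & {for q, continuous fyy}]) ->
  (forall q, U q -> fxx q + fyy q = 0) ->
  exists2 rho, 0 < rho & forall r, 0 <= r < rho ->
    [/\ forall t, U (circle_at p r t),
        continuous (fun t => f (circle_at p r t)) &
        \int[lebesgue_measure]_(t in `[0, 2 * pi]) f (circle_at p r t) =
        2 * pi * f p].
Proof.
move=> oU Up gf gfx gfy cf lap.
have cdiff (h hx hy : R * R -> R) : grad U h hx hy ->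
    forall q, U q -> {for q, continuous h}.
  by move=> gh q /gh[dh _ _]; exact: differentiable_continuous.
have bnd (h : R * R -> R) : {for p, continuous h} ->
    nbhs p [set q | `|h q| <= `|h p| + 1].
  move=> ch; move/cvgrPdist_le : ch => /(_ 1 ltr01).
  apply: filterS => q hpq; rewrite /= -lerBlDl.
  by rewrite (le_trans _ hpq)// distrC lerB_dist.
have [cxx cxy cyx cyy] := cf p Up.
have [rho /= rho0 rhoP] : exists2 rho : R, 0 < rho & ball p rho `<=` [set q |
    [/\ U q, `|fx q| <= `|fx p| + 1 & `|fy q| <= `|fy p| + 1] /\
    [/\ `|fxx q| <= `|fxx p| + 1, `|fxy q| <= `|fxy p| + 1,
     `|fyx q| <= `|fyx p| + 1 & `|fyy q| <= `|fyy p| + 1]].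
  have /nbhs_ballP[rho rho0 H] : nbhs p [set q |
      [/\ U q, `|fx q| <= `|fx p| + 1 & `|fy q| <= `|fy p| + 1] /\
      [/\ `|fxx q| <= `|fxx p| + 1, `|fxy q| <= `|fxy p| + 1,
       `|fyx q| <= `|fyx p| + 1 & `|fyy q| <= `|fyy p| + 1]].
    have nU : nbhs p U by exact: open_nbhs_nbhs.
    have nx := bnd fx (cdiff _ _ _ gfx p Up).
    have ny := bnd fy (cdiff _ _ _ gfy p Up).
    have nxx := bnd fxx cxx.
    have nxy := bnd fxy cxy.
    have nyx := bnd fyx cyx.
    have nyy := bnd fyy cyy.
    have FF : Filter (nbhs p) by exact: nbhs_filter.
    have I (A B : set (R * R)) := @filterI _ _ FF A B.
    have H := I _ _ (I _ _ nU (I _ _ nx ny)) (I _ _ (I _ _ nxx nxy) (I _ _ nyx nyy)).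
    apply: (@filterS _ _ FF _ _ _ H) => q [[u [x y]] [[xx xy] [yx yy]]].
    exact: conj (And3 u x y) (And4 xx xy yx yy).
  by exists rho.
exists rho => //.
pose z (r t : R) := circle_at p r t.
have zP (r t : R) : `|r| < rho -> ball p rho (z r t).
  rewrite -(circle_at_dist p r t) => zr.
  split; rewrite -ball_normE /= distrC (le_lt_trans _ zr)//.
    exact: (norm1_le_pnorm (z r t - p)).
  exact: (norm2_le_pnorm (z r t - p)).
have zU (r t : R) : `|r| < rho -> U (z r t) by move=> /(zP _ t) /rhoP[[]].
have dzr (h hx hy : R * R -> R) (r t : R) : grad U h hx hy -> `|r| < rho ->
    is_derive r 1 (fun r => h (z r t))
      (cos t * hx (z r t) + sin t * hy (z r t)).
  move=> gh /(zU _ t)/gh[dh <- <-].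
  apply: (@is_derive_curve h (fun r => p.1 + r * cos t)
    (fun r => p.2 + r * sin t)) => //.
  - have /is_derive_eq := is_derive_add (is_derive_cst p.1 r 1)
      (is_derive_mul (is_derive_id r 1) (is_derive_cst (cos t) r 1)).
    by apply; rewrite /cst/=; ring.
  - have /is_derive_eq := is_derive_add (is_derive_cst p.2 r 1)
      (is_derive_mul (is_derive_id r 1) (is_derive_cst (sin t) r 1)).
    by apply; rewrite /cst/=; ring.
have dzt (h hx hy : R * R -> R) (r t : R) : grad U h hx hy -> `|r| < rho ->
    is_derive t 1 (fun t => h (z r t))
      (- (r * sin t) * hx (z r t) + r * cos t * hy (z r t)).
  move=> gh /(zU _ t)/gh[dh <- <-].
  apply: (@is_derive_curve h (fun t => p.1 + r * cos t)
    (fun t => p.2 + r * sin t)) => //.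
  - have /is_derive_eq := is_derive_add (is_derive_cst p.1 t 1)
      (is_derive_mul (is_derive_cst r t 1) (is_derive_cos t)).
    by apply; rewrite /cst/=; ring.
  - have /is_derive_eq := is_derive_add (is_derive_cst p.2 t 1)
      (is_derive_mul (is_derive_cst r t 1) (is_derive_sin t)).
    by apply; rewrite /cst/=; ring.
have cz (r : R) : continuous (z r).
  move=> t.
  have c1 : p.1 + r * cos u @[u --> t] --> p.1 + r * cos t.
    apply: cvgD; first exact: cvg_cst.
    by apply: cvgM; [exact: cvg_cst|exact: continuous_cos].
  have c2 : p.2 + r * sin u @[u --> t] --> p.2 + r * sin t.
    apply: cvgD; first exact: cvg_cst.
    by apply: cvgM; [exact: cvg_cst|exact: continuous_sin].
  exact: cvg_pair c1 c2.
have chz (h : R * R -> R) (r : R) : `|r| < rho ->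
    (forall q, U q -> {for q, continuous h}) -> continuous (fun t => h (z r t)).
  move=> rr ch t; apply: continuous_comp; first exact: cz.
  exact/ch/zU.
have cD (g h : R -> R) : continuous g -> continuous h ->
  continuous (fun t => g t + h t) by move=> cg ch t; apply: cvgD; [exact: cg|exact: ch].
have cM (g h : R -> R) : continuous g -> continuous h ->
  continuous (fun t => g t * h t) by move=> cg ch t; apply: cvgM; [exact: cg|exact: ch].
have ccos : continuous (@cos R) by exact: continuous_cos.
have csin : continuous (@sin R) by exact: continuous_sin.
pose G (r t : R) : R := f (z r t).
pose Gr (r t : R) : R := cos t * fx (z r t) + sin t * fy (z r t).
pose Grr (r t : R) : R := cos t * (cos t * fxx (z r t) + sin t * fxy (z r t))
  + sin t * (cos t * fyx (z r t) + sin t * fyy (z r t)).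
pose B (r t : R) : R := - (r * sin t) * fx (z r t) + r * cos t * fy (z r t).
pose Bt (r t : R) : R :=
  - (r * sin t) * (- (r * sin t) * fxx (z r t) + r * cos t * fxy (z r t))
  - r * cos t * fx (z r t)
  + (r * cos t * (- (r * sin t) * fyx (z r t) + r * cos t * fyy (z r t))
  - r * sin t * fy (z r t)).
pose M : R := (`|fx p| + 1 + (`|fy p| + 1)) + ((`|fxx p| + 1 + (`|fxy p| + 1)) +
  (`|fyx p| + 1 + (`|fyy p| + 1))).
have cs1 (u v x y : R) (t : R) : `|u| <= x -> `|v| <= y ->
    `|cos t * u + sin t * v| <= x + y.
  move=> ux vy; rewrite (le_trans (ler_normD _ _))// !normrM lerD//.
    by rewrite -[leRHS]mul1r ler_pM// ler_norml cos_geN1 cos_le1.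
  by rewrite -[leRHS]mul1r ler_pM// ler_norml sin_geN1 sin_le1.
have dG : forall r t : R, `|r| < rho -> is_derive r 1 (G^~ t) (Gr r t).
  by move=> r t rr; exact: dzr gf rr.
have dGr : forall r t : R, `|r| < rho -> is_derive r 1 (Gr^~ t) (Grr r t).
  move=> r t rr.
  have := is_derive_add (is_derive_mul (is_derive_cst (cos t) r 1) (dzr _ _ _ r t gfx rr))
    (is_derive_mul (is_derive_cst (sin t) r 1) (dzr _ _ _ r t gfy rr)).
  by move/is_derive_eq; apply; rewrite /cst /Grr; ring.
have dB : forall r t : R, `|r| < rho -> is_derive t 1 (B r) (Bt r t).
  move=> r t rr.
  have ds : is_derive t 1 (fun t => - (r * sin t)) (- (r * cos t)).
    have /is_derive_eq := is_derive_mul (is_derive_cst (- r) t 1) (is_derive_sin t).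
    rewrite (_ : (fun y : R => _) = (fun t : R => - (r * sin t))).
      by apply; rewrite /cst/=; ring.
    by apply/funext => u; rewrite /cst mulNr.
  have dc : is_derive t 1 (fun t => r * cos t) (- (r * sin t)).
    have /is_derive_eq := is_derive_mul (is_derive_cst r t 1) (is_derive_cos t).
    by apply; rewrite /cst/=; ring.
  have := is_derive_add (is_derive_mul ds (dzt _ _ _ r t gfx rr))
    (is_derive_mul dc (dzt _ _ _ r t gfy rr)).
  by move/is_derive_eq; apply; rewrite /Bt; ring.
have laplace : forall r t : R, `|r| < rho ->
    r * (Gr r t + r * Grr r t) + Bt r t = 0.
  move=> r t rr; have E : fyy (z r t) = - fxx (z r t).
    by apply/eqP; rewrite -addr_eq0 addrC; apply/eqP/lap/zU.
  rewrite /Gr /Grr /Bt E.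
  (* The terms in [fxy] cancel among themselves, as do those in [fyx], and so do the first-order
     terms. *)
  transitivity (r ^+ 2 * fxx (z r t) * ((cos t ^+ 2 + sin t ^+ 2) - (cos t ^+ 2 + sin t ^+ 2))).
    by ring.
  by rewrite subrr mulr0.
have Bper : forall r : R, `|r| < rho -> B r (2 * pi) = B r 0.
  move=> r rr; have pi2 : 2 * pi = pi *+ 2 :> R by rewrite mulr_natl.
  by rewrite /B /z /circle_at pi2 cos2pi sin2pi cos0 sin0.
have cG : forall r : R, `|r| < rho -> continuous (G r).
  by move=> r rr; exact: chz rr (cdiff _ _ _ gf).
have cGr : forall r : R, `|r| < rho -> continuous (Gr r).
  move=> r rr; exact: cD (cM _ _ ccos (chz _ r rr (cdiff _ _ _ gfx)))
    (cM _ _ csin (chz _ r rr (cdiff _ _ _ gfy))).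
have cGrr : forall r : R, `|r| < rho -> continuous (Grr r).
  move=> r rr.
  have hxx : continuous (fun t => fxx (z r t)) by apply: chz => // q /cf[].
  have hxy : continuous (fun t => fxy (z r t)) by apply: chz => // q /cf[].
  have hyx : continuous (fun t => fyx (z r t)) by apply: chz => // q /cf[].
  have hyy : continuous (fun t => fyy (z r t)) by apply: chz => // q /cf[].
  have cx := cD _ _ (cM _ _ ccos hxx) (cM _ _ csin hxy).
  have cy := cD _ _ (cM _ _ ccos hyx) (cM _ _ csin hyy).
  exact: cD (cM _ _ ccos cx) (cM _ _ csin cy).
have bGr : forall r t : R, `|r| < rho -> `|Gr r t| <= M.
  move=> r t rr; have [[_ bx by_] _] := rhoP _ (zP r t rr).
  rewrite (le_trans (cs1 _ _ _ _ t bx by_))// /M lerDl.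
  by rewrite !addr_ge0.
have bGrr : forall r t : R, `|r| < rho -> `|Grr r t| <= M.
  move=> r t rr; have [_ [bxx bxy byx byy]] := rhoP _ (zP r t rr).
  have H1 := cs1 _ _ _ _ t bxx bxy; have H2 := cs1 _ _ _ _ t byx byy.
  rewrite (le_trans (cs1 _ _ _ _ t H1 H2))// /M lerDr.
  by rewrite !addr_ge0.
move=> r /andP[r0 rr]; have rr' : `|r| < rho by rewrite ger0_norm.
split; [by move=> t; exact: zU|exact: cG|].
have -> := polar_mean dG dGr dB laplace Bper cG cGr cGrr bGr bGrr r0 rr.
have -> : G 0 = cst (f p).
  by apply/funext => t; rewrite /G /z /circle_at !mul0r !addr0 -surjective_pairing.
have pi0 : 0 <= 2 * pi :> R by rewrite mulr_ge0// pi_ge0.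
rewrite Rintegral_cst// /= lebesgue_measure_itv/= lte_fin.
rewrite lt_neqAle pi0 andbT eq_sym mulf_eq0 !pnatr_eq0/= gt_eqF ?pi_gt0//=.
by rewrite subr0 mulrC.
Qed.

(** The C^1 criterion is used from the top down: continuous second derivatives make the first
    derivatives differentiable, hence continuous, and this makes [f] differentiable. *)
Lemma harmonic_differentiable (U : set (R * R)) f :
  open U -> harmonic_on U f -> forall q, U q ->
  [/\ differentiable f q, differentiable ('D_(1, 0) f) q &
     differentiable ('D_(0, 1) f) q].
Proof.
move=> oU hf.
pose fx : R * R -> R := 'D_(1, 0) f; pose fy : R * R -> R := 'D_(0, 1) f.
pose fxx : R * R -> R := 'D_(1, 0) fx; pose fxy : R * R -> R := 'D_(0, 1) fx.
pose fyx : R * R -> R := 'D_(1, 0) fy; pose fyy : R * R -> R := 'D_(0, 1) fy.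
have dfx (q0 : R * R) : U q0 -> differentiable fx q0.
  move=> Uq; have [_ _ cf _] := hf q0 Uq.
  apply: (@C1_differentiable R fx fxx fxy U q0) => //.
  - by move=> q' /hf[_ d2 _ _]; apply: DeriveDef; [exact: d2|].
  - by move=> q' /hf[_ d2 _ _]; apply: DeriveDef; [exact: d2|].
  - exact: cf.
  - exact: cf.
have dfy (q0 : R * R) : U q0 -> differentiable fy q0.
  move=> Uq; have [_ _ cf _] := hf q0 Uq.
  apply: (@C1_differentiable R fy fyx fyy U q0) => //.
  - by move=> q' /hf[_ d2 _ _]; apply: DeriveDef; [exact: d2|].
  - by move=> q' /hf[_ d2 _ _]; apply: DeriveDef; [exact: d2|].
  - exact: cf.
  - exact: cf.
have df (q0 : R * R) : U q0 -> differentiable f q0.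
  move=> Uq; apply: (@C1_differentiable R f fx fy U q0) => //.
  - by move=> q' /hf[d1 _ _ _]; apply: DeriveDef; [exact: d1|].
  - by move=> q' /hf[d1 _ _ _]; apply: DeriveDef; [exact: d1|].
  - exact/differentiable_continuous/dfx.
  - exact/differentiable_continuous/dfy.
move=> q Uq; exact: And3 (df q Uq) (dfx q Uq) (dfy q Uq).
Qed.

Lemma harmonic_circle_mean (U : set (R * R)) f p :
  open U -> harmonic_on U f -> U p ->
  exists2 rho, 0 < rho & forall r, 0 <= r < rho ->
    [/\ forall t, U (circle_at p r t),
        continuous (fun t => f (circle_at p r t)) &
        \int[lebesgue_measure]_(t in `[0, 2 * pi]) f (circle_at p r t) =
        2 * pi * f p].
Proof.
move=> oU hf Up.
pose fx : R * R -> R := 'D_(1, 0) f; pose fy : R * R -> R := 'D_(0, 1) f.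
pose fxx : R * R -> R := 'D_(1, 0) fx; pose fxy : R * R -> R := 'D_(0, 1) fx.
pose fyx : R * R -> R := 'D_(1, 0) fy; pose fyy : R * R -> R := 'D_(0, 1) fy.
have dU := harmonic_differentiable oU hf.
apply: (@C2_circle_mean U f fx fy fxx fxy fyx fyy p oU Up).
- by move=> q /dU[].
- by move=> q /dU[].
- by move=> q /dU[].
- by move=> q /hf[_ _ cf _]; split; exact: cf.
- by move=> q /hf[].
Qed.

End harmonic_mean.

(** * The Perron family on the sphere *)

Section sphere_facts.
Context {R : realType}.
Implicit Types (e : set R) (p q : R * R).

Definition plane_dom e : set (R * R) := [set p | dom e (Some p)].

Lemma plane_domE e p : plane_dom e p <-> ~ (e p.1 /\ p.2 = 0).
Proof.
case: p => p1 p2; split=> [H [/= ep p0]|H]; first by apply: H; exists p1 => //; rewrite p0.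
by move=> [x ex] [xp p0]; apply: H; rewrite /= -xp -p0.
Qed.

Lemma plane_dom_open e : compact e -> open (plane_dom e).
Proof.
move=> ce; rewrite -closedC.
have -> : ~` plane_dom e = [set (x, 0) | x in e].
  apply/seteqP; split=> [p /= /contrapT[x ex [xp]]|_ [x ex <-] /plane_domE H].
    by exists x => //; rewrite xp.
  by apply: H.
apply: compact_closed.
  exact: norm_hausdorff.
apply: continuous_compact => //; apply: continuous_subspaceT => x.
have c1 : y @[y --> x] --> x by exact: cvg_id.
have c2 : (fun=> 0 : R) y @[y --> x] --> (0 : R) by exact: cvg_cst.
exact: cvg_pair c1 c2.
Qed.

(** A neighbourhood of infinity is the complement of a closed compact set. The square of half-side
    [M] serves, because it contains the disc of radius [M]. *)
Lemma nbhs_sphere_infty (A : set (sphere R)) (M : R) :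
  A None -> (forall p, M < pnorm p -> A (Some p)) ->
  nbhs (None : sphere R) A.
Proof.
move=> A0 AM.
have cK : compact (`[- M, M]%classic `*` `[- M, M]%classic : set (R * R)).
  by apply: compact_setX; exact: segment_compact.
exists (`[- M, M]%classic `*` `[- M, M]%classic).
  by split=> //; apply: compact_closed => //; exact: norm_hausdorff.
move=> _ [[p /= Kp <-]|-> //].
apply: AM; rewrite ltNge; apply/negP => pM; apply: Kp.
by split; rewrite /= in_itv/= -ler_norml (le_trans _ pM)//
  ?norm1_le_pnorm ?norm2_le_pnorm.
Qed.

Lemma limf_esup_le_fin (T : choiceType) (X : filteredType T) (F : set_system X) (f : X -> \bar R)
  (l : R) : Filter F ->
  (forall eps, 0 < eps -> F [set x | (f x <= (l + eps)%:E)%E]) ->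
  (limf_esup f F <= l%:E)%E.
Proof.
move=> FF H; apply/lee_addgt0Pr => eps /H FH.
apply: (@le_trans _ _ (ereal_sup (f @` [set x | (f x <= (l + eps)%:E)%E]))).
  by apply: ereal_inf_lbound; exists [set x | (f x <= (l + eps)%:E)%E].
by apply: ge_ereal_sup => _ [x xl <-].
Qed.

Lemma limf_esup_le_ninfty (T : choiceType) (X : filteredType T) (F : set_system X) (f : X -> \bar R) :
  Filter F -> (forall M : R, F [set x | (f x <= M%:E)%E]) ->
  limf_esup f F = -oo%E.
Proof.
move=> FF H; apply: eq_ninfty => M.
apply: (@le_trans _ _ (ereal_sup (f @` [set x | (f x <= M%:E)%E]))).
  by apply: ereal_inf_lbound; exists [set x | (f x <= M%:E)%E].
by apply: ge_ereal_sup => _ [x xl <-].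
Qed.

Lemma circle_mean_fin (u : sphere R -> \bar R) (z : sphere R) (r : R)
    (h : R -> R) : continuous h ->
  (forall t, u (circle_point z r t) = (h t)%:E) ->
  circle_mean u z r =
    ((2 * pi)^-1 * \int[lebesgue_measure]_(t in `[0, 2 * pi]) h t)%:E.
Proof.
move=> ch uh; rewrite /circle_mean; under eq_integral do rewrite uh.
rewrite EFinM; congr (_ * _)%E.
rewrite /Rintegral fineK//.
by apply: integrable_fin_num => //; exact: continuous_integrable_itv.
Qed.

(** The majorant [H] is continuous across [e], so it controls the upper limit of [h] at points of
    [e], where [h] itself may have no limit. In the applications [h] is [H] minus a nonnegative
    function. *)
Lemma perron_ge e (phi : R -> R) (h H : R * R -> R) (vinf : \bar R) :
  let u : sphere R -> \bar R := fun z => if z is Some p then (h p)%:E else vinf in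
  (forall p, plane_dom e p -> {for p, continuous h}) ->
  (forall p, plane_dom e p -> exists2 rho, 0 < rho & forall r, 0 < r < rho ->
     continuous (fun t => h (circle_at p r t)) /\
     2 * pi * h p <=
       \int[lebesgue_measure]_(t in `[0, 2 * pi]) h (circle_at p r t)) ->
  continuous H -> (forall p, plane_dom e p -> h p <= H p) ->
  (forall x, e x -> H (x, 0) <= phi x) ->
  (vinf < +oo)%E -> (limf_esup u (nbhs (None : sphere R)) <= vinf)%E ->
  (exists2 rho : R, 0 < rho &
     forall r, 0 < r < rho -> (vinf <= circle_mean u None r)%E) ->
  forall z, (u z <= perron e phi z)%E.
Proof.
move=> u ch sh cH hH Hphi vy usci smi z.
apply: ereal_sup_ubound; exists u => //; split.
  move=> [p|] dp; last by split.
  split; first exact: ltry.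
    apply: limf_esup_le_fin => eps eps0.
    have : nbhs p [set q | h q <= h p + eps].
      have := ch p dp => /cvgrPdist_le /(_ _ eps0); apply: filterS => q /=.
      by rewrite distrC ler_norml lerBlDl => /andP[].
    by apply: (@filterS _ _ (nbhs_filter p)) => q /=; rewrite lee_fin.
  have [rho rho0 rhoP] := sh p dp; exists rho => // r /rhoP[cr hr].
  rewrite (@circle_mean_fin u (Some p) r (fun t => h (circle_at p r t)))//.
  rewrite lee_fin ler_pdivlMl//; last by rewrite mulr_gt0// pi_gt0.
move=> x ex; apply: limf_esup_le_fin => eps eps0.
have : nbhs (x, 0) [set q | H q <= H (x, 0) + eps].
  have := cH (x, 0) => /cvgrPdist_le /(_ _ eps0); apply: filterS => q /=.
  by rewrite distrC ler_norml lerBlDl => /andP[].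
apply: (@filterS _ _ (nbhs_filter (x, 0))) => q /= Hq dq.
by rewrite /= lee_fin (le_trans (hH _ dq))// (le_trans Hq)// lerD2r Hphi.
Qed.

End sphere_facts.

(** * Logarithm of the modulus of a polynomial *)

Section log_modulus.
Context {R : realType}.
Implicit Types (p q a : R * R) (s : seq (R * R)).

Lemma ln_pnorm p : 0 < p.1 ^+ 2 + p.2 ^+ 2 ->
  ln (pnorm p) = 2^-1 * ln (p.1 ^+ 2 + p.2 ^+ 2).
Proof.
move=> p0; rewrite -sqr_pnorm lnXn; last by rewrite sqrtr_gt0.
by rewrite -[ln _ *+ 2]mulr_natl mulKf ?pnatr_eq0.
Qed.

Lemma pnorm_gt0 p : (0 < pnorm p) = (0 < p.1 ^+ 2 + p.2 ^+ 2).
Proof. by rewrite sqrtr_gt0. Qed.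

Lemma pnormD p q : pnorm (p + q) <= pnorm p + pnorm q.
Proof.
rewrite -(ler_pXn2r (n := 2)) ?nnegrE ?addr_ge0 ?pnorm_ge0//.
have -> : (pnorm p + pnorm q) ^+ 2 = p.1 ^+ 2 + p.2 ^+ 2 + (q.1 ^+ 2 + q.2 ^+ 2) +
    2 * (pnorm p * pnorm q) by rewrite -!sqr_pnorm; ring.
rewrite sqr_pnorm.
have -> : (p + q).1 ^+ 2 + (p + q).2 ^+ 2 = p.1 ^+ 2 + p.2 ^+ 2 +
    (q.1 ^+ 2 + q.2 ^+ 2) + 2 * (p.1 * q.1 + p.2 * q.2).
  by rewrite -[(p + q).1]/(p.1 + q.1) -[(p + q).2]/(p.2 + q.2); ring.
rewrite lerD2l ler_pM2l// (le_trans (ler_norm _))//.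
rewrite -(ler_pXn2r (n := 2)) ?nnegrE ?mulr_ge0 ?pnorm_ge0//.
rewrite real_normK ?num_real// exprMn !sqr_pnorm -subr_ge0.
have -> : (p.1 ^+ 2 + p.2 ^+ 2) * (q.1 ^+ 2 + q.2 ^+ 2) -
   (p.1 * q.1 + p.2 * q.2) ^+ 2 = (p.1 * q.2 - p.2 * q.1) ^+ 2 by ring.
exact: sqr_ge0.
Qed.

Lemma pnormN p : pnorm (- p) = pnorm p.
Proof. by rewrite /pnorm -[(- p).1]/(- p.1) -[(- p).2]/(- p.2) !sqrrN. Qed.

Lemma pnormB p q : pnorm p - pnorm q <= pnorm (p - q).
Proof. by rewrite lerBlDr -{1}(subrK q p) pnormD. Qed.

Lemma pnorm_continuous : continuous (@pnorm R).
Proof.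
move=> p; apply: continuous_comp; last exact: sqrt_continuous.
apply: cvgD; apply: cvgM; try exact: cvg_fst; exact: cvg_snd.
Qed.

Lemma circle_atB p a (r t : R) : circle_at p r t - a = circle_at (p - a) r t.
Proof.
rewrite /circle_at.
rewrite -[(p - a).1]/(p.1 - a.1) -[(p - a).2]/(p.2 - a.2).
rewrite -[LHS]/(p.1 + r * cos t - a.1, p.2 + r * sin t - a.2).
by congr (_, _); ring.
Qed.

Lemma circle_at_continuous p (r : R) : continuous (circle_at p r).
Proof.
move=> t.
have c1 : p.1 + r * cos u @[u --> t] --> p.1 + r * cos t.
  apply: cvgD; first exact: cvg_cst.
  by apply: cvgM; [exact: cvg_cst|exact: continuous_cos].
have c2 : p.2 + r * sin u @[u --> t] --> p.2 + r * sin t.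
  apply: cvgD; first exact: cvg_cst.
  by apply: cvgM; [exact: cvg_cst|exact: continuous_sin].
exact: cvg_pair c1 c2.
Qed.

Lemma circle_at_neq0 p (r t : R) : 0 <= r < pnorm p -> 0 < pnorm (circle_at p r t).
Proof.
move=> /andP[r0 rp].
have := pnormB p (p - circle_at p r t).
rewrite subKr -(pnormN (p - _)) opprB circle_at_dist ger0_norm//.
by apply: lt_le_trans; rewrite subr_gt0.
Qed.

Lemma ln_circle_continuous p a (r : R) : 0 <= r < pnorm (p - a) ->
  continuous (fun t => ln (pnorm (circle_at p r t - a))).
Proof.
move=> rp t; under eq_fun do rewrite circle_atB.
apply: continuous_comp; last exact/continuous_ln/circle_at_neq0.
apply: continuous_comp; [exact: circle_at_continuous|exact: pnorm_continuous].
Qed.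

Lemma Rintegral_itv_cst (c : R) :
  \int[lebesgue_measure]_(t in `[0, 2 * pi]) (fun=> c) t = 2 * pi * c.
Proof.
have pi0 : 0 <= 2 * pi :> R by rewrite mulr_ge0// pi_ge0.
rewrite Rintegral_cst// /= lebesgue_measure_itv/= lte_fin.
rewrite lt_neqAle pi0 andbT eq_sym mulf_eq0 !pnatr_eq0/= gt_eqF ?pi_gt0//=.
by rewrite subr0 mulrC.
Qed.

(** A circle that leaves the singularity outside and one that encloses it both reduce to
    [circle_mean_ln] once the dominant length [c] is factored out: the distance from the centre to
    the singularity in the first case, the radius in the second. *)
Lemma mean_ln_scaled (h : R -> R) (c a b : R) : 0 < c -> a ^+ 2 + b ^+ 2 < 1 ->
  (forall t, h t = ln c + 2^-1 * ln (1 + 2 * (a * cos t + b * sin t) + (a ^+ 2 + b ^+ 2))) ->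
  continuous h ->
  \int[lebesgue_measure]_(t in `[0, 2 * pi]) h t = 2 * pi * ln c.
Proof.
move=> c0 ab hE ch.
pose g := fun t => ln (1 + 2 * (a * cos t + b * sin t) + (a ^+ 2 + b ^+ 2)).
have gE : g = (fun t => 2 * (h t - ln c)).
  by apply/funext => t; rewrite hE addrC addKr /g mulrA mulfV// mul1r.
have cg : continuous g.
  rewrite gE => t; apply: cvgM; first exact: cvg_cst.
  by apply: cvgB; [exact: ch|exact: cvg_cst].
have -> : h = (fun t => ln c + 2^-1 * g t) by apply/funext.
rewrite RintegralD//; last 2 first.
- by apply: continuous_integrable_itv => t; exact: cvg_cst.
- apply: continuous_integrable_itv => t; apply: cvgM; [exact: cvg_cst|exact: cg].
rewrite RintegralZl//; last exact: continuous_integrable_itv.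
by rewrite circle_mean_ln// mulr0 addr0 Rintegral_itv_cst.
Qed.

Lemma circle_mean_ln_in p a (r : R) : 0 <= r < pnorm (p - a) ->
  \int[lebesgue_measure]_(t in `[0, 2 * pi]) ln (pnorm (circle_at p r t - a)) =
  2 * pi * ln (pnorm (p - a)).
Proof.
move=> /[dup] rp /andP[r0 rpa].
have q0 : 0 < pnorm (p - a) by exact: le_lt_trans rpa.
set N := pnorm (p - a) in q0 rpa *.
have N2 : N ^+ 2 = (p - a).1 ^+ 2 + (p - a).2 ^+ 2 by rewrite sqr_pnorm.
(* In complex notation x - iy = r / (p - a), so the point of the circle minus [a] is (p - a)(1 + (x
   - iy) e^{it}). *)
pose x := r * (p - a).1 / N ^+ 2; pose y := r * (p - a).2 / N ^+ 2.
have N20 : N ^+ 2 != 0 by rewrite expf_neq0// gt_eqF.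
have xy : x ^+ 2 + y ^+ 2 = r ^+ 2 / N ^+ 2.
  transitivity (r ^+ 2 * ((p - a).1 ^+ 2 + (p - a).2 ^+ 2) / (N ^+ 2 * N ^+ 2)).
    by rewrite /x /y; field; rewrite gt_eqF.
  by rewrite -N2 -mulrA invfM (mulrA (N ^+ 2)) mulfV// mul1r.
apply: (@mean_ln_scaled _ N x y) => //.
- by rewrite xy -expr_div_n exprn_ilt1// ?divr_ge0// ?ltW// ltr_pdivrMr// mul1r.
- move=> t; rewrite circle_atB; have := @circle_at_neq0 _ r t rp.
  rewrite pnorm_gt0 => c0; rewrite ln_pnorm// xy.
  have E : (circle_at (p - a) r t).1 ^+ 2 + (circle_at (p - a) r t).2 ^+ 2 =
      N ^+ 2 * (1 + 2 * (x * cos t + y * sin t) + r ^+ 2 / N ^+ 2).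
    rewrite /circle_at/=.
    transitivity ((p - a).1 ^+ 2 + (p - a).2 ^+ 2 +
      2 * r * ((p - a).1 * cos t + (p - a).2 * sin t) +
      r ^+ 2 * (cos t ^+ 2 + sin t ^+ 2)); first by ring.
    by rewrite cos2Dsin2 -N2 /x /y; field; rewrite gt_eqF.
  rewrite E in c0 *; rewrite lnM ?posrE ?exprn_gt0//; last first.
    by rewrite -(pmulr_rgt0 _ (exprn_gt0 2 q0)).
  by rewrite lnXn// mulrDr -[ln _ *+ 2]mulr_natl mulKf ?pnatr_eq0.
- exact: ln_circle_continuous.
Qed.

(** The point 1 / (r e^{it}), that is, the case [None] of [circle_point] as a point of the plane. *)
Definition circle_infty (r t : R) : R * R := (r^-1 * cos t, - (r^-1 * sin t)).

Lemma circle_infty_continuous (r : R) : continuous (circle_infty r).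
Proof.
move=> t.
have c1 : r^-1 * cos u @[u --> t] --> r^-1 * cos t.
  by apply: cvgM; [exact: cvg_cst|exact: continuous_cos].
have c2 : - (r^-1 * sin u) @[u --> t] --> - (r^-1 * sin t).
  by apply: cvgN; apply: cvgM; [exact: cvg_cst|exact: continuous_sin].
exact: cvg_pair c1 c2.
Qed.

Lemma pnorm_circle_infty (r t : R) : 0 < r -> pnorm (circle_infty r t) = r^-1.
Proof.
move=> r0; rewrite /pnorm /= sqrrN !exprMn -mulrDr cos2Dsin2 mulr1.
by rewrite sqrtr_sqr ger0_norm// invr_ge0 ltW.
Qed.

Lemma circle_infty_neq a (r t : R) : 0 < r -> r * pnorm a < 1 ->
  0 < pnorm (circle_infty r t - a).
Proof.
move=> r0 ra; apply: lt_le_trans (pnormB _ _).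
by rewrite pnorm_circle_infty// subr_gt0 -[ltRHS]div1r ltr_pdivlMr// mulrC.
Qed.

Lemma ln_circle_infty_continuous a (r : R) : 0 < r -> r * pnorm a < 1 ->
  continuous (fun t => ln (pnorm (circle_infty r t - a))).
Proof.
move=> r0 ra t; apply: continuous_comp; last exact/continuous_ln/circle_infty_neq.
apply: continuous_comp; last exact: pnorm_continuous.
by apply: cvgB; [exact: circle_infty_continuous|exact: cvg_cst].
Qed.

Lemma circle_mean_ln_out a (r : R) : 0 < r -> r * pnorm a < 1 ->
  \int[lebesgue_measure]_(t in `[0, 2 * pi]) ln (pnorm (circle_infty r t - a)) =
  2 * pi * ln r^-1.
Proof.
move=> r0 ra.
(* Here x - iy = - r a, from e^{-it} / r - a = (e^{-it} / r)(1 - r a e^{it}). *)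
pose x := - (r * a.1); pose y := r * a.2.
have xy : x ^+ 2 + y ^+ 2 = (r * pnorm a) ^+ 2.
  by rewrite [RHS]exprMn sqr_pnorm /x /y; ring.
apply: (@mean_ln_scaled _ r^-1 x y) => //.
- by rewrite invr_gt0.
- by rewrite xy exprn_ilt1// mulr_ge0 ?pnorm_ge0// ltW.
- move=> t; have := @circle_infty_neq a r t r0 ra.
  rewrite pnorm_gt0 => c0; rewrite ln_pnorm//.
  have E : (circle_infty r t - a).1 ^+ 2 + (circle_infty r t - a).2 ^+ 2 =
      r^-1 ^+ 2 * (1 + 2 * (x * cos t + y * sin t) + (x ^+ 2 + y ^+ 2)).
    rewrite -[(circle_infty r t - a).1]/(r^-1 * cos t - a.1).
    rewrite -[(circle_infty r t - a).2]/(- (r^-1 * sin t) - a.2).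
    transitivity (r^-1 ^+ 2 * (cos t ^+ 2 + sin t ^+ 2) -
      2 * r^-1 * (a.1 * cos t - a.2 * sin t) + (a.1 ^+ 2 + a.2 ^+ 2)).
      by ring.
    by rewrite cos2Dsin2 /x /y; field; rewrite gt_eqF.
  rewrite E in c0 *; rewrite lnM ?posrE ?exprn_gt0 ?invr_gt0//; last first.
    by rewrite -(pmulr_rgt0 _ (exprn_gt0 2 (_ : 0 < r^-1)))// invr_gt0.
  by rewrite lnXn ?invr_gt0// mulrDr -[ln _ *+ 2]mulr_natl mulKf ?pnatr_eq0.
- exact: ln_circle_infty_continuous.
Qed.

End log_modulus.

Local Open Scope complex_scope.

Section poly_modulus.
Context {R : realType}.
Implicit Types (p q a : R * R) (s : seq (R * R)).

(* [s] lists the complex roots as points of the plane, and [L] is the modulus of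
   the leading coefficient. *)
Definition modulus (L : R) s p : R := L * \prod_(a <- s) pnorm (p - a).

(** The factorization over [R[i]] extends |D| from the real line to the plane as a product of
    distances; from here on the argument deals with these distances instead of complex values. *)
Lemma poly_modulus (D : {poly R}) : D != 0 ->
  exists2 s, size s = (size D).-1 &
    forall x, `|D.[x]| = modulus `|lead_coef D| s (x, 0).
Proof.
move=> D0; pose DC := map_poly (real_complex R) D.
have [r DE] := closed_field_poly_normal DC.
have lD : lead_coef DC = (lead_coef D)%:C by rewrite lead_coef_map.
have lD0 : lead_coef DC != 0.
  by rewrite lD; apply: contra D0 => /eqP[/eqP]; rewrite lead_coef_eq0.
exists [seq (complex.Re z, complex.Im z) | z <- r].
  have : size DC = size D by rewrite size_map_poly.
  by rewrite DE size_scale// size_prod_XsubC size_map => <-.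
move=> x; apply: (@complexI R).
have nE (y : R) : `|y%:C| = `|y|%:C.
  by rewrite normc_def/= expr0n/= addr0 sqrtr_sqr.
rewrite -nE -horner_map/= -/DC [in LHS]DE hornerZ normrM lD nE /modulus.
rewrite [in RHS]rmorphM/=; congr (_ * _).
rewrite horner_prod normr_prod rmorph_prod/= big_map; apply: eq_bigr => z _.
rewrite hornerXsubC normc_def; congr (_%:C).
by rewrite /pnorm; case: z => a b /=.
Qed.

Lemma modulus_continuous L s : continuous (modulus L s).
Proof.
move=> p; apply: cvgM; first exact: cvg_cst.
elim: s => [|a s IH].
  by under eq_fun do rewrite big_nil; rewrite big_nil; exact: cvg_cst.
under eq_fun do rewrite big_cons.
rewrite big_cons; apply: cvgM => //.
apply: continuous_comp; last exact: pnorm_continuous.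
by apply: cvgB; [exact: cvg_id|exact: cvg_cst].
Qed.

Lemma ln_modulus L s p : 0 < L -> (forall a, a \in s -> 0 < pnorm (p - a)) ->
  0 < modulus L s p /\
  ln (modulus L s p) = ln L + \sum_(a <- s) ln (pnorm (p - a)).
Proof.
move=> L0 sp; suff [pr0 prE] : 0 < \prod_(a <- s) pnorm (p - a) /\
    ln (\prod_(a <- s) pnorm (p - a)) = \sum_(a <- s) ln (pnorm (p - a)).
  by rewrite mulr_gt0// lnM// prE.
elim: s sp => [|a s IH] sp; first by rewrite !big_nil ltr01 ln1.
have pa : 0 < pnorm (p - a) by rewrite sp// mem_head.
have [h1 h2] := IH (fun b bs => sp b (mem_behead (s := a :: s) bs)).
by rewrite !big_cons mulr_gt0// lnM// h2.
Qed.

Lemma mean_sum (h : R * R -> R -> R) (v : R * R -> R) s :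
  (forall a, a \in s -> continuous (h a)) ->
  (forall a, a \in s ->
    \int[lebesgue_measure]_(t in `[0, 2 * pi]) h a t = 2 * pi * v a) ->
  continuous (fun t => \sum_(a <- s) h a t) /\
  \int[lebesgue_measure]_(t in `[0, 2 * pi]) (\sum_(a <- s) h a t) =
    2 * pi * \sum_(a <- s) v a.
Proof.
elim: s => [|a s IH] ch mh.
  under eq_fun do rewrite big_nil; rewrite big_nil.
  by split; [exact: cst_continuous|rewrite Rintegral_itv_cst].
have [c1 c2] := IH (fun b bs => ch b (mem_behead (s := a :: s) bs))
  (fun b bs => mh b (mem_behead (s := a :: s) bs)).
have c0 : continuous (h a) by apply: ch; rewrite mem_head.
rewrite big_cons; under eq_fun do rewrite big_cons.
split; first by move=> t; apply: cvgD; [exact: c0|exact: c1].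
rewrite RintegralD//; try exact: continuous_integrable_itv.
by rewrite c2 (mh a (mem_head _ _)) -mulrDr.
Qed.

Lemma ler_mean (g h : R -> R) : continuous g -> continuous h ->
  (forall t, g t <= h t) ->
  \int[lebesgue_measure]_(t in `[0, 2 * pi]) g t <=
  \int[lebesgue_measure]_(t in `[0, 2 * pi]) h t.
Proof.
by move=> cg ch gh; apply: le_Rintegral => //; exact: continuous_integrable_itv.
Qed.

(** Truncation at the level [k > 0] removes the singularities at the roots: the function becomes
    continuous on the whole plane, and it stays subharmonic as the maximum of the logarithm and a
    constant. *)
Definition log_modulus (L k : R) s p : R := ln (Num.max (modulus L s p) k).

Lemma log_modulus_continuous L k s : 0 < k -> continuous (log_modulus L k s).
Proof.
move=> k0 p; apply: (@continuous_comp _ _ _ (fun q => Num.max (modulus L s q) k)).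
  by apply: continuous_max; [exact: modulus_continuous|exact: cvg_cst].
by apply: continuous_ln; rewrite lt_max k0 orbT.
Qed.

Let sum_ln_le L k s p : 0 < L -> 0 < k ->
  (forall a, a \in s -> 0 < pnorm (p - a)) ->
  ln L + \sum_(a <- s) ln (pnorm (p - a)) <= log_modulus L k s p.
Proof.
move=> L0 k0 /(ln_modulus L0)[m0 <-].
by rewrite ler_ln ?posrE// ?lt_max ?m0// le_max lexx.
Qed.

Let mean_cst_sum (h : R * R -> R -> R) (v : R * R -> R) s (c : R) :
  (forall a, a \in s -> continuous (h a)) ->
  (forall a, a \in s ->
    \int[lebesgue_measure]_(t in `[0, 2 * pi]) h a t = 2 * pi * v a) ->
  continuous (fun t => c + \sum_(a <- s) h a t) /\
  \int[lebesgue_measure]_(t in `[0, 2 * pi]) (c + \sum_(a <- s) h a t) =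
    2 * pi * (c + \sum_(a <- s) v a).
Proof.
move=> ch mh; have [c1 c2] := mean_sum ch mh.
have cc : continuous (fun _ : R => c) by exact: cst_continuous.
split; first by move=> t; apply: cvgD; [exact: cc|exact: c1].
rewrite RintegralD//; try exact: continuous_integrable_itv.
by rewrite c2 Rintegral_itv_cst -mulrDr.
Qed.

Lemma log_modulus_circle_continuous L k s p (r : R) : 0 < k ->
  continuous (fun t => log_modulus L k s (circle_at p r t)).
Proof.
move=> k0 t; apply: continuous_comp; first exact: circle_at_continuous.
exact: log_modulus_continuous.
Qed.

(** Where the truncation is active, the value is the minimum of the function. Elsewhere [p] is not a
    root, and on circles that reach no root the sum of logarithms has equality in the mean and lies
    below the truncated function. *)
Lemma log_modulus_submean L k s p : 0 < L -> 0 < k ->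
  exists2 rho, 0 < rho & forall r, 0 < r < rho ->
    2 * pi * log_modulus L k s p <=
    \int[lebesgue_measure]_(t in `[0, 2 * pi])
      log_modulus L k s (circle_at p r t).
Proof.
move=> L0 k0; have [Mk|kM] := leP (modulus L s p) k.
  exists 1 => // r _; rewrite /log_modulus max_r// -Rintegral_itv_cst.
  apply: ler_mean => [||t]; first exact: cst_continuous.
    exact: log_modulus_circle_continuous.
  by rewrite ler_ln ?posrE ?lt_max ?k0 ?orbT// le_max lexx orbT.
have sp a : a \in s -> 0 < pnorm (p - a).
  move=> as_; rewrite lt_neqAle pnorm_ge0 andbT eq_sym; apply/eqP => pa.
  move: (lt_trans k0 kM); rewrite /modulus.
  suff -> : \prod_(a <- s) pnorm (p - a) = 0 by rewrite mulr0 ltxx.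
  by rewrite (big_rem a)//= pa mul0r.
have [rho rho0 rhoP] : exists2 rho : R, 0 < rho &
    forall a, a \in s -> rho <= pnorm (p - a).
  elim: s sp {kM} => [|b s IH] sp; first by exists 1.
  have [rho rho0 rhoP] := IH (fun b' bs => sp b' (mem_behead (s := b :: s) bs)).
  exists (Num.min rho (pnorm (p - b))); first by rewrite lt_min rho0 sp ?mem_head.
  move=> a; rewrite inE => /predU1P[->|/rhoP h]; rewrite ge_min ?lexx ?orbT//.
  by rewrite h.
exists rho => // r /andP[r0 rr].
have hr a : a \in s -> 0 <= r < pnorm (p - a).
  by move=> /rhoP h; rewrite ltW//= (lt_le_trans rr).
have [c1 c2] := @mean_cst_sum (fun a t => ln (pnorm (circle_at p r t - a)))
  (fun a => ln (pnorm (p - a))) s (ln L)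
  (fun a as_ => ln_circle_continuous (hr a as_))
  (fun a as_ => circle_mean_ln_in (hr a as_)).
rewrite /log_modulus max_l; last exact: ltW.
have [_ ->] := ln_modulus L0 sp.
rewrite -c2; apply: ler_mean => // [|t].
  exact: log_modulus_circle_continuous.
apply: sum_ln_le => // a /hr h.
by rewrite circle_atB circle_at_neq0.
Qed.

(** Once the circle encloses all roots, each of them contributes exactly the logarithm of the
    radius. These terms later cancel against the same terms in the mean of the Green-type
    function. *)
Lemma log_modulus_submean_infty L k s : 0 < L -> 0 < k ->
  exists2 rho, 0 < rho & forall r, 0 < r < rho ->
    continuous (fun t => log_modulus L k s (circle_infty r t)) /\
    2 * pi * (ln L + (size s)%:R * ln r^-1) <=
    \int[lebesgue_measure]_(t in `[0, 2 * pi])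
      log_modulus L k s (circle_infty r t).
Proof.
move=> L0 k0.
have [rho rho0 rhoP] : exists2 rho : R, 0 < rho &
    forall a, a \in s -> rho * pnorm a <= 1.
  elim: s => [|b s [rho rho0 rhoP]]; first by exists 1.
  exists (Num.min rho (1 + pnorm b)^-1).
    by rewrite lt_min rho0 invr_gt0 ltr_wpDr// pnorm_ge0.
  move=> a; rewrite inE => /predU1P[->|/rhoP h]; last first.
    by rewrite (le_trans _ h)// ler_wpM2r ?pnorm_ge0// ge_min lexx.
  have b1 : 0 < 1 + pnorm b by rewrite ltr_wpDr// pnorm_ge0.
  apply: (@le_trans _ _ ((1 + pnorm b)^-1 * pnorm b)).
    by rewrite ler_wpM2r ?pnorm_ge0// ge_min lexx orbT.
  by rewrite mulrC ler_pdivrMr// mul1r lerDr.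
exists rho => // r /andP[r0 rr].
have hr a : a \in s -> r * pnorm a < 1.
  move=> /rhoP h; have [->|a0] := eqVneq (pnorm a) 0; first by rewrite mulr0.
  by rewrite (lt_le_trans _ h)// ltr_pM2r// lt_neqAle eq_sym a0 pnorm_ge0.
have [c1 c2] := @mean_cst_sum (fun a t => ln (pnorm (circle_infty r t - a)))
  (fun a => ln r^-1) s (ln L)
  (fun a as_ => ln_circle_infty_continuous r0 (hr a as_))
  (fun a as_ => circle_mean_ln_out r0 (hr a as_)).
have cl : continuous (fun t => log_modulus L k s (circle_infty r t)).
  move=> t; apply: continuous_comp; first exact: circle_infty_continuous.
  exact: log_modulus_continuous.
split => //.
have -> : (size s)%:R * ln r^-1 = \sum_(a <- s) ln r^-1.
  by rewrite big_const_seq count_predT iter_addr_0 mulr_natl.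
rewrite -c2; apply: ler_mean => // t.
by apply: sum_ln_le => // a /hr h; rewrite circle_infty_neq.
Qed.

(** For [k <= L] and [1 <= pnorm p] the truncation level is itself below the bound for the
    product. *)
Lemma log_modulus_growth L k s : 0 < L -> 0 < k -> k <= L ->
  exists2 A : R, 0 <= A & forall p, 1 <= pnorm p ->
    log_modulus L k s p <= ln L + (size s)%:R * ln (pnorm p + A).
Proof.
move=> L0 k0 kL.
have [A A0 sA] : exists2 A : R, 0 <= A & forall a, a \in s -> pnorm a <= A.
  elim: s => [|b s [A A0 AP]]; first by exists 0.
  exists (Num.max A (pnorm b)); first by rewrite le_max A0.
  move=> a; rewrite inE => /predU1P[->|/AP h]; rewrite le_max ?lexx ?orbT//.
  by rewrite h.
exists A => // p p1; have pA1 : 1 <= pnorm p + A by rewrite ler_wpDr.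
have pA0 : 0 < pnorm p + A by rewrite (lt_le_trans _ pA1).
have M : modulus L s p <= L * (pnorm p + A) ^+ size s.
  rewrite ler_pM2l//; elim: s sA => [|b s IH] sA; first by rewrite big_nil.
  rewrite big_cons exprS ler_pM ?pnorm_ge0//.
  - by elim/big_ind : _ => //[x y x0 y0|i _]; rewrite ?mulr_ge0// pnorm_ge0.
  - by rewrite (le_trans (pnormD _ _))// lerD2l pnormN sA// mem_head.
  - by apply: IH => a as_; rewrite sA// inE as_ orbT.
rewrite mulr_natl -lnXn// -lnM ?posrE ?exprn_gt0//.
rewrite ler_ln ?posrE ?mulr_gt0 ?exprn_gt0 ?lt_max ?k0 ?orbT// ge_max M/=.
by rewrite (le_trans kL)// ler_peMr ?(ltW L0)// exprn_ege1.
Qed.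

End poly_modulus.

(** * Weighted Bernstein-Walsh inequalities *)

Section bernstein_walsh.
Context {R : realType}.
Implicit Types (e : set R) (phi : R -> R) (D : {poly R}).

(** The form of harmonicity that the competitor needs. The Green function has it by
    [harmonic_circle_mean], the potential of a measure by exchanging two integrals. *)
Definition mean_value_on (U : set (R * R)) (G : R * R -> R) := forall p, U p ->
  {for p, continuous G} /\
  exists2 rho, 0 < rho & forall r, 0 < r < rho ->
    continuous (fun t => G (circle_at p r t)) /\
    \int[lebesgue_measure]_(t in `[0, 2 * pi]) G (circle_at p r t) =
    2 * pi * G p.

Lemma log_modulus_perron e phi (L k c : R) s (G : R * R -> R) (vinf : \bar R) :
  let u : sphere R -> \bar R := fun z =>
    if z is Some p then (log_modulus L k s p - c * G p)%:E else vinf in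
  compact e -> 0 < L -> 0 < k -> 0 <= c ->
  (forall p, plane_dom e p -> 0 <= G p) -> mean_value_on (plane_dom e) G ->
  (forall x, e x -> log_modulus L k s (x, 0) <= phi x) ->
  (vinf < +oo)%E -> (limf_esup u (nbhs (None : sphere R)) <= vinf)%E ->
  (exists2 rho : R, 0 < rho &
     forall r, 0 < r < rho -> (vinf <= circle_mean u None r)%E) ->
  forall z, (u z <= perron e phi z)%E.
Proof.
move=> u ce L0 k0 c0 G0 mG Dphi.
apply: (@perron_ge R e phi (fun p => log_modulus L k s p - c * G p)
  (log_modulus L k s)) => //.
- move=> p /mG[cG _]; apply: cvgB; first exact: log_modulus_continuous.
  by apply: cvgM; [exact: cvg_cst|exact: cG].
- move=> p dp; have [_ [rho rho0 rhoP]] := mG p dp.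
  have [rho' rho'0 rho'P] := @log_modulus_submean R L k s p L0 k0.
  exists (Num.min rho rho'); first by rewrite lt_min rho0.
  move=> r /andP[r0]; rewrite lt_min => /andP[rr rr'].
  have [cG GE] := rhoP r ltac:(by rewrite r0).
  have ub := rho'P r ltac:(by rewrite r0).
  have cl := @log_modulus_circle_continuous R L k s p r k0.
  have ccG : continuous (fun t => c * G (circle_at p r t)).
    by move=> t; apply: cvgM; [exact: cvg_cst|exact: cG].
  split; first by move=> t; apply: cvgB; [exact: cl|exact: ccG].
  rewrite RintegralB//; try exact: continuous_integrable_itv.
  rewrite RintegralZl//; last exact: continuous_integrable_itv.
  by rewrite GE mulrBr (mulrCA c) lerD2r.
- exact: log_modulus_continuous.
- by move=> p /G0 Gp; rewrite gerBl mulr_ge0.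
Qed.

Lemma log_modulus_le e phi D (L k : R) s : 0 < k ->
  (forall x, `|D.[x]| = modulus L s (x, 0)) ->
  (forall x, e x -> `|D.[x]| <= expR (phi x)) ->
  (forall x, e x -> k <= expR (phi x)) ->
  forall x, e x -> log_modulus L k s (x, 0) <= phi x.
Proof.
move=> k0 DE Dphi kphi x ex; rewrite -[leRHS]expRK.
by rewrite ler_ln ?posrE ?expR_gt0 ?lt_max ?k0 ?orbT// ge_max -DE Dphi ?kphi.
Qed.

(** Supplies the truncation level: below [L] for the growth bound, below [expR phi] on [e] for the
    boundary inequality. *)
Lemma expR_lower_bound e phi (L : R) : 0 < L -> compact e ->
  {within e, continuous phi} ->
  exists k : R, [/\ 0 < k, k <= L & forall x, e x -> k <= expR (phi x)].
Proof.
move=> L0 ce cphi; have [-> |/set0P[x0 ex0]] := eqVneq e set0.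
  by exists L.
have [y ey yP] := @compact_EVT_min _ _ phi e (ex_intro _ x0 ex0) ce cphi.
exists (Num.min L (expR (phi y))); split.
- by rewrite lt_min L0 expR_gt0.
- by rewrite ge_min lexx.
- by move=> x ex; rewrite ge_min ler_expR yP ?orbT// inE.
Qed.

(** Near infinity the logarithm of the polynomial is at most [k ln |p|] plus a constant, while
    [(k + eps) g] is at least [(k + eps) ln |p|] minus a constant. The competitor thus tends to -oo
    and may take that value at infinity; [eps] is removed at the end. *)
Lemma bernstein_walsh e g omega phi D (k : nat) (a J : R) :
  compact e -> is_green e g -> ~ e a ->
  is_harmonic_measure e (real_line (Some a)) omega ->
  {within e, continuous phi} ->
  (\int[omega]_(x in e) (phi x)%:E)%E = J%:E ->
  (size D <= k.+1)%N -> (forall x, e x -> `|D.[x]| <= expR (phi x)) ->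
  `|D.[a]| <= expR (J + k%:R * fine (g (Some (a, 0)))).
Proof.
move=> ce gg ea [_ omegaP] cphi JE sD Dphi.
have [->|D0] := eqVneq D 0; first by rewrite horner0 normr0 expR_ge0.
have [->|Da0] := eqVneq D.[a] 0; first by rewrite normr0 expR_ge0.
have [s ss DE] := poly_modulus D0.
pose L : R := `|lead_coef D|; rewrite -/L in DE.
have L0 : 0 < L by rewrite normr_gt0 lead_coef_eq0.
have [kap [kap0 kapL kapphi]] := expR_lower_bound L0 ce cphi.
have sk : (size s <= k)%N by rewrite ss -subn1 leq_subLR add1n.
pose G (p : R * R) : R := fine (g (Some p)).
have oU := plane_dom_open ce.
have G0 p : plane_dom e p -> 0 <= G p by move=> dp; rewrite fine_ge0// (green_ge0 gg).
have mG : mean_value_on (plane_dom e) G.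
  move=> p dp; have hG := green_harmonic gg; split; last first.
    have [rho rho0 rhoP] := harmonic_circle_mean oU hG dp.
    exists rho => // r /andP[r0 rr].
    by have [] := rhoP r ltac:(by rewrite ltW).
  by have [dG _ _] := harmonic_differentiable oU hG dp; exact: differentiable_continuous.
have dom_a : plane_dom e (a, 0) by apply/plane_domE => -[].
rewrite -[leLHS]lnK ?posrE ?normr_gt0// ler_expR.
have main (eps : R) : 0 < eps -> ln `|D.[a]| <= J + (k%:R + eps) * G (a, 0).
  move=> eps0.
  have [M0 [M1 Mlog]] := green_log gg.
  have [A A0 AP] := @log_modulus_growth R L kap s L0 kap0 kapL.
  have keps : 0 <= k%:R + eps by rewrite addr_ge0// ltW.
  have := @log_modulus_perron e phi L kap (k%:R + eps) s G -oo%E ce L0 kap0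
    keps G0 mG (log_modulus_le kap0 DE Dphi kapphi) (isT : (-oo < +oo :> \bar R)%E).
  have oo : limf_esup (fun z : sphere R => if z is Some p
      then (log_modulus L kap s p - (k%:R + eps) * G p)%:E else -oo%E)
      (nbhs (None : sphere R)) = -oo%E.
    apply: limf_esup_le_ninfty => M.
    pose C := ln L + k%:R * ln (1 + A) + (k%:R + eps) * M1.
    have [B eB] : exists B : R, forall x, e x -> `|x| <= B.
      have [B [_ eB]] := compact_bounded ce.
      by exists (B + 1) => x ex; apply: (eB (B + 1)) => //; rewrite ltrDl.
    (* The four thresholds: 1 for the growth bound, [M0] for the asymptotics of [g], [B] to stay off
       [e], and the last one for [C - eps * ln |p| <= M]. *)
    apply: (@nbhs_sphere_infty _ _ (Num.max 1 (Num.max M0 (Num.max B (expR ((C - M) / eps)))))).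
      by rewrite /= leNye.
    move=> p; rewrite !gt_max => /and4P[p1 pM0 pB pC] /=; rewrite lee_fin.
    have dp : plane_dom e p.
      apply/plane_domE => -[/eB ep p2]; move: pB; rewrite ltNge => /negP; apply.
      by rewrite /pnorm p2 expr0n/= addr0 sqrtr_sqr.
    have pn0 : 0 < pnorm p by rewrite (lt_trans _ p1).
    have l0 : 0 <= ln (pnorm p) by rewrite ln_ge0// ltW.
    have A1 : 0 <= ln (1 + A) by rewrite ln_ge0// lerDl.
    have lA : ln (pnorm p + A) <= ln (pnorm p) + ln (1 + A).
      rewrite -lnM ?posrE// ?ltr_pwDl// ler_ln ?posrE ?mulr_gt0 ?ltr_pwDl//.
      by rewrite mulrDr mulr1 lerD2l ler_peMl// ltW.
    have lmE : log_modulus L kap s p <= ln L + k%:R * (ln (pnorm p) + ln (1 + A)).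
      rewrite (le_trans (AP p (ltW p1)))// lerD2l ler_pM//.
      - by rewrite ln_ge0// ler_wpDr// ltW.
      - by rewrite ler_nat.
    have GE : ln (pnorm p) - M1 <= G p.
      have := Mlog p dp pM0; rewrite ler_norml -/(G p) => /andP[h _].
      by move: h; rewrite lerBrDr addrC.
    have keG : (k%:R + eps) * (ln (pnorm p) - M1) <= (k%:R + eps) * G p.
      by rewrite ler_wpM2l.
    have CM : (C - M) / eps <= ln (pnorm p).
      by rewrite -[leLHS]expRK ler_ln ?posrE ?expR_gt0// ltW.
    rewrite ler_pdivrMr// in CM.
    apply: le_trans (lerB lmE keG) _; rewrite -subr_ge0.
    rewrite -subr_ge0 /C in CM; apply: le_trans CM _.
    by rewrite le_eqVlt; apply/orP; left; apply/eqP; ring.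
  rewrite oo => /(_ (lexx _)).
  have mi : exists2 rho : R, 0 < rho & forall r, 0 < r < rho -> (-oo <= circle_mean
      (fun z : sphere R => if z is Some p
      then (log_modulus L kap s p - (k%:R + eps) * G p)%:E else -oo) None r)%E.
    by exists 1 => // r _; rewrite leNye.
  move=> /(_ mi (Some (a, 0))); rewrite -omegaP// JE lee_fin => h.
  rewrite -lerBlDr; apply: le_trans h; rewrite lerD2r.
  by rewrite DE /log_modulus ler_ln ?posrE ?lt_max ?kap0 ?orbT -?DE ?normr_gt0// le_max lexx.
apply/ler_addgt0Pr => eps eps0.
have Ga0 : 0 <= G (a, 0) by exact: G0.
have Ga1 : 0 < G (a, 0) + 1 by rewrite ltr_wpDl.
have := main (eps / (G (a, 0) + 1)) (divr_gt0 eps0 Ga1).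
move/le_trans; apply; rewrite mulrDl addrA lerD2l.
by rewrite mulrAC ler_pdivrMr// ler_pM2l// lerDl.
Qed.

End bernstein_walsh.

Lemma limf_esup_pole (R : realType) (h : R * R -> R) (l : \bar R) (c : R)
    (A B : R) : (l = c%:E)%E ->
  (forall p, B < pnorm p -> h p <= c + A / (pnorm p - B)) -> 0 <= A ->
  (limf_esup (fun z : sphere R => if z is Some p then (h p)%:E else l)
     (nbhs (None : sphere R)) <= c%:E)%E.
Proof.
move=> -> hB A0; apply: limf_esup_le_fin => eps eps0.
apply: (@nbhs_sphere_infty _ _ (B + 1 + A / eps)).
  by rewrite /= lee_fin lerDl ltW.
move=> p pB; rewrite /= lee_fin.
have A1 : 0 <= A / eps by rewrite divr_ge0// ltW.
have pB' : B + A / eps < pnorm p.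
  by rewrite (lt_trans _ pB)// addrAC ltrDl.
have pB0 : B < pnorm p by rewrite (le_lt_trans _ pB')// lerDl.
rewrite (le_trans (hB p pB0))// lerD2l ler_pdivrMr ?subr_gt0// mulrC.
by rewrite -ler_pdivrMr// lerBrDl ltW.
Qed.

(** [D] has degree exactly [k], so the logarithmic growth of ln |D| and of [k * G] cancels and the
    competitor has the finite value [ln L - k * V] at infinity. There it is compared with the Perron
    solution [J]. *)
Lemma bernstein_walsh_infty (R : realType) (e : set R) omega (phi : R -> R)
    (D : {poly R}) (k : nat) (J V r0 : R) (G : R * R -> R) :
  compact e -> is_harmonic_measure e (real_line None) omega ->
  {within e, continuous phi} ->
  (\int[omega]_(x in e) (phi x)%:E)%E = J%:E ->
  size D = k.+1 -> (forall x, e x -> `|D.[x]| <= expR (phi x)) ->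
  (forall p, plane_dom e p -> 0 <= G p) -> mean_value_on (plane_dom e) G ->
  0 <= r0 -> (forall p, r0 < pnorm p -> ln (pnorm p - r0) + V <= G p) ->
  (exists2 rho, 0 < rho & forall r, 0 < r < rho ->
    continuous (fun t => G (circle_infty r t)) /\
    \int[lebesgue_measure]_(t in `[0, 2 * pi]) G (circle_infty r t) =
      2 * pi * (ln r^-1 + V)) ->
  `|lead_coef D| <= expR (J + k%:R * V).
Proof.
move=> ce [_ omegaP] cphi JE sD Dphi G0 mG r00 GV [rho1 /= rho10 rho1P].
have D0 : D != 0 by rewrite -size_poly_eq0 sD.
have [s ss DE] := poly_modulus D0.
pose L : R := `|lead_coef D|; rewrite -/L in DE *.
have L0 : 0 < L by rewrite normr_gt0 lead_coef_eq0.
have sk : size s = k by rewrite ss sD.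
have [kap [kap0 kapL kapphi]] := expR_lower_bound L0 ce cphi.
have [A A0 AP] := @log_modulus_growth R L kap s L0 kap0 kapL.
rewrite -[leLHS]lnK ?posrE// ler_expR -lerBlDr.
have := @log_modulus_perron R e phi L kap k%:R s G (ln L - k%:R * V)%:E ce L0
  kap0 (ler0n _ _) G0 mG (log_modulus_le kap0 DE Dphi kapphi) (ltry _).
have us : (limf_esup (fun z : sphere R => if z is Some p
      then (log_modulus L kap s p - k%:R * G p)%:E else (ln L - k%:R * V)%:E)
      (nbhs (None : sphere R)) <= (ln L - k%:R * V)%:E)%E.
  apply: (@limf_esup_pole R _ _ _ (k%:R * (A + (r0 + 1))) (r0 + 1)) => //; last first.
    by rewrite mulr_ge0// !addr_ge0.
  move=> p pr0; have p1 : 1 <= pnorm p by rewrite ltW// (le_lt_trans _ pr0)// lerDr.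
  have pr : 0 < pnorm p - (r0 + 1) by rewrite subr_gt0.
  have pr1 : r0 < pnorm p by rewrite (lt_trans _ pr0)// ltrDl.
  rewrite (le_trans (lerB (AP p p1) (ler_wpM2l (ler0n _ k) (GV p pr1))))// sk.
  (* The two logarithms differ by O(1/|p|), from ln (1 + x) <= x. The denominator uses [r0 + 1]
     because the growth bound asks for [1 <= pnorm p]. *)
  have key : ln (pnorm p + A) <=
      ln (pnorm p - r0) + (A + (r0 + 1)) / (pnorm p - (r0 + 1)).
    have y0 : 0 < pnorm p - r0 by rewrite subr_gt0.
    have x0 : 0 < pnorm p + A by rewrite ltr_wpDr// (lt_le_trans _ p1).
    rewrite -lerBlDl -ln_div ?posrE//.
    have -> : (pnorm p + A) / (pnorm p - r0) = 1 + (A + r0) / (pnorm p - r0).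
      by field; rewrite gt_eqF.
    apply: (@le_trans _ _ ((A + r0) / (pnorm p - r0))).
      apply: le_ln1Dx; rewrite (@lt_le_trans _ _ 0)//.
      by apply: divr_ge0; [exact: addr_ge0|exact: ltW].
    rewrite ler_pM ?addr_ge0 ?invr_ge0 ?(ltW y0)//.
      by rewrite lerD2l lerDl.
    by rewrite lef_pV2 ?posrE// lerD2l lerN2 lerDl.
  have := ler_wpM2l (ler0n R k) key; rewrite -subr_ge0 => key'.
  rewrite -subr_ge0; apply: le_trans key' _.
  by rewrite le_eqVlt; apply/orP; left; apply/eqP; rewrite -!mulrA; ring.
move=> /(_ us) perr.
have mi : exists2 rho : R, 0 < rho & forall r, 0 < r < rho ->
    ((ln L - k%:R * V)%:E <= circle_mean (fun z : sphere R => if z is Some p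
      then (log_modulus L kap s p - k%:R * G p)%:E
      else (ln L - k%:R * V)%:E) None r)%E.
  have [rho2 rho20 rho2P] := @log_modulus_submean_infty R L kap s L0 kap0.
  exists (Num.min rho1 rho2); first by rewrite lt_min rho10.
  move=> r /andP[rr0]; rewrite lt_min => /andP[rr1 rr2].
  have [cG GE] := rho1P r ltac:(by rewrite rr0).
  have [cl lE] := rho2P r ltac:(by rewrite rr0).
  have ccG : continuous (fun t => k%:R * G (circle_infty r t)).
    by move=> t; apply: cvgM; [exact: cvg_cst|exact: cG].
  have cc : continuous (fun t =>
      log_modulus L kap s (circle_infty r t) - k%:R * G (circle_infty r t)).
    by move=> t; apply: cvgB; [exact: cl|exact: ccG].
  rewrite (@circle_mean_fin R _ None r _ cc)//.
  rewrite lee_fin ler_pdivlMl; last by rewrite mulr_gt0// pi_gt0.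
  rewrite RintegralB//; try exact: continuous_integrable_itv.
  rewrite RintegralZl//; last exact: continuous_integrable_itv.
  rewrite GE; apply: le_trans (lerB lE (lexx _)); rewrite sk.
  by rewrite le_eqVlt; apply/orP; left; apply/eqP; ring.
by have := perr mi None; rewrite -omegaP// JE lee_fin.
Qed.

(** * Near minimizers of the logarithmic energy *)

Section weighted_probability.
Local Open Scope ereal_scope.
Context {R : realType} d {T : measurableType d} (mu : probability T R)
  (B : set T) (mB : measurable B).

Lemma ge0_integral_mrestr (f : T -> \bar R) :
  (forall x, 0 <= f x) -> measurable_fun setT f ->
  \int[mrestr mu mB]_x f x = \int[mu]_(x in B) f x.
Proof.
move=> f0 mf; have n0 : mrestr mu mB (~` B) = 0.
  by rewrite /mrestr/= setICl measure0.
rewrite (ge0_negligible_integral (measurableC mB) measurableT mf _ n0)//.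
rewrite setTD setCK; apply: eq_measure_integral => A mA AB.
by rewrite /mrestr /=; congr (mu _); exact: setIidl.
Qed.

(** The density is [a] off [B] and [a + b] on [B]. Both a partial lowering of mass off [B] and, with
    [a = 0], conditioning on [B] have this form. *)
Lemma weighted_probability (a b : R) : (0 <= a)%R -> (0 <= b)%R ->
  a%:E + b%:E * mu B = 1 ->
  exists nu : probability T R,
    (forall A, measurable A -> nu A = a%:E * mu A + b%:E * mu (A `&` B)) /\
    forall f : T -> \bar R, (forall x, 0 <= f x) -> measurable_fun setT f ->
      \int[nu]_x f x = a%:E * \int[mu]_x f x + b%:E * \int[mu]_(x in B) f x.
Proof.
move=> a0 b0 ab.
pose m : {measure set T -> \bar R} := measure_add (mscale (NngNum a0) mu) (mscale (NngNum b0) (mrestr mu mB)).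
have mE A : m A = a%:E * mu A + b%:E * mu (A `&` B).
  by rewrite -[LHS]/(measure_add _ _ A) measure_addE /mscale/=.
have mT : m setT = 1 by rewrite mE probability_setT mule1 setTI.
(* The total mass is already 1; normalizing changes nothing and provides the structure of a
   probability. *)
exists (mnormalize m mu : probability T R).
have nE A : mnormalize m mu A = m A.
  by rewrite /mnormalize mT onee_eq0/= invr1 mule1.
split=> [A mA|f f0 mf]; first by rewrite -[LHS]/(mnormalize m mu A) nE mE.
transitivity (\int[m]_x f x).
  by apply: eq_measure_integral => A mA _; exact: nE.
rewrite /m ge0_integral_measure_add//.
rewrite !ge0_integral_mscale//.
by rewrite ge0_integral_mrestr.
Qed.

End weighted_probability.

Section integral_shift.
Local Open Scope ereal_scope.
Context {R : realType} d {T : measurableType d} (mu : probability T R).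

Lemma integral_sub_cst (f : T -> \bar R) (c : R) : (0 <= c)%R ->
  (forall x, 0 <= f x) -> measurable_fun setT f ->
  \int[mu]_x (f x - c%:E) = \int[mu]_x f x - c%:E.
Proof.
move=> c0 f0 mf.
have intc : mu.-integrable setT (fun=> c%:E) by exact: finite_measure_integrable_cst.
have cE : \int[mu]_x (cst c%:E) x = c%:E.
  by rewrite integral_cst// -[RHS]mule1; congr (_ * _); exact: probability_setT.
have [foo|] := ltP (\int[mu]_x f x) +oo.
  have fi : mu.-integrable setT f.
    apply/integrableP; split => //.
    by under eq_integral do rewrite gee0_abs//.
  by have := integralB measurableT fi intc; rewrite cE.
rewrite leye_eq => /eqP foo; rewrite foo /=.
have mg : measurable_fun setT (fun x => f x - c%:E).
  exact: emeasurable_funB.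
have neg : \int[mu]_x ((fun x => f x - c%:E)^\- x) <= c%:E.
  rewrite -[leRHS]cE; apply: ge0_le_integral => //.
    exact: measurable_funeneg.
  move=> x _; rewrite funenegE ge_max lee_fin c0 andbT.
  by rewrite fin_num_oppeB// -[leRHS]add0e leeD2r// leeNl oppe0.
have pos : \int[mu]_x ((fun x => f x - c%:E)^\+ x) = +oo.
  apply/eqP; rewrite -leye_eq.
  have : +oo <= \int[mu]_x ((fun x => f x - c%:E)^\+ x) + c%:E.
    rewrite -[X in _ + X]cE -ge0_integralD//; last exact: measurable_funepos.
    rewrite -[X in X <= _]foo; apply: ge0_le_integral => //.
      by apply: emeasurable_funD; [exact: measurable_funepos|exact: measurable_cst].
    by move=> x _; rewrite funeposE -leeBlDr// le_max lexx.
  by case: (\int[mu]_x _) => [r| |].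
rewrite integralE pos addye//.
by rewrite -ltNye lteNr/= (le_lt_trans neg)// ltry.
Qed.

End integral_shift.

(** * Shifted logarithmic kernel, energies and potentials *)

Section log_energy.
Local Open Scope ereal_scope.
Context {R : realType}.
Local Notation T := (measurableTypeR R).
Implicit Types (mu nu : probability T R) (e : set R) (c : R).

(* For [x], [y] at distance at most [expR c], this is the energy kernel
   [- lne `|x - y|] shifted by [c]; it is nonnegative everywhere. *)
Definition log_kernel c (z : T * T) : \bar R :=
  if z.1 == z.2 :> R then +oo
  else (Num.max 0 (c - ln `|(z.1 : R) - (z.2 : R)|))%:E.

Definition log_potential c mu (x : T) : \bar R := \int[mu]_y log_kernel c (x, y).

Lemma log_kernel_ge0 c z : 0 <= log_kernel c z.
Proof. by rewrite /log_kernel; case: ifP => // _; rewrite lee_fin le_max lexx. Qed.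

Lemma log_kernelC c (x y : R) : log_kernel c (x, y) = log_kernel c (y, x).
Proof. by rewrite /log_kernel/= eq_sym distrC. Qed.

Lemma measurable_log_kernel c : measurable_fun setT (log_kernel c).
Proof.
apply: measurable_fun_ifT => //.
  by apply: measurable_fun_eqr; [exact: measurable_fst|exact: measurable_snd].
apply/measurable_EFinP; apply: measurable_maxr; first exact: measurable_cst.
apply: measurable_funB; first exact: measurable_cst.
apply: measurableT_comp; first exact: measurable_ln.
apply: measurableT_comp; first exact: normr_measurable.
by apply: measurable_funB; [exact: measurable_fst|exact: measurable_snd].
Qed.

Lemma log_potential_ge0 c mu x : 0 <= log_potential c mu x.
Proof. by apply: integral_ge0 => y _; exact: log_kernel_ge0. Qed.

Lemma measurable_log_potential c mu : measurable_fun setT (log_potential c mu).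
Proof.
apply: (@measurable_fun_fubini_tonelli_F _ _ T T R mu (log_kernel c)).
  exact: measurable_log_kernel.
exact: log_kernel_ge0.
Qed.

Lemma measurable_log_kernel1 c (x : T) :
  measurable_fun setT (fun y : T => log_kernel c (x, y)).
Proof.
apply: measurableT_comp; [exact: measurable_log_kernel|exact: pair1_measurable].
Qed.

Lemma lneB_log_kernel c (x y : R) : (`|x - y| <= expR c)%R ->
  - lne (`|x - y|%R)%:E = log_kernel c (x, y) - c%:E.
Proof.
rewrite /log_kernel/=; have [->|xy] := eqVneq x y.
  by rewrite subrr normr0 /= lexx.
have xy0 : (0 < `|x - y|)%R by rewrite normr_gt0 subr_eq0.
move=> h; rewrite leNgt xy0 /=.
rewrite max_r; first by rewrite -EFinB addrAC subrr add0r.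
by rewrite subr_ge0 -ler_expR lnK.
Qed.

(** [mu] lives on [e], whose diameter is at most [expR c], so the shifted kernel differs from the
    energy kernel by exactly [c] almost everywhere in each variable. Energies thereby become
    integrals of nonnegative functions. *)
Lemma log_energyE e c mu : measurable e -> mu e = 1 -> (0 <= c)%R ->
  (forall x y, e x -> e y -> `|x - y| <= expR c)%R ->
  log_energy mu = \int[mu]_x log_potential c mu x - c%:E.
Proof.
move=> me mue c0 ec.
have ae_e (P : R -> Prop) : (forall x, e x -> P x) -> {ae mu, forall x, setT x -> P x}.
  move=> H; exists (~` e); split; first exact: measurableC.
    by rewrite probability_setC// mue subee.
  by move=> x /= /not_implyP[_ nP] ex; apply: nP; exact: H.
pose N (z : T * T) : \bar R := - lne (`|(z.1 : R) - (z.2 : R)|%R)%:E.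
have mN : measurable_fun setT N.
  apply: (eq_measurable_fun (fun z : T * T => if z.1 == z.2 :> R then +oo
      else (- ln `|(z.1 : R) - (z.2 : R)|)%:E)).
    move=> [x y] _; rewrite /N/=; have [->|xy] := eqVneq x y.
      by rewrite subrr normr0 /= lexx.
    by rewrite leNgt normr_gt0 subr_eq0 xy.
  apply: measurable_fun_ifT => //.
    by apply: measurable_fun_eqr; [exact: measurable_fst|exact: measurable_snd].
  apply/measurable_EFinP; apply: measurableT_comp => //.
  apply: measurableT_comp; first exact: measurable_ln.
  apply: measurableT_comp; first exact: normr_measurable.
  by apply: measurable_funB; [exact: measurable_fst|exact: measurable_snd].
have mN1 (x : T) : measurable_fun setT (fun y : T => N (x, y)).
  by apply: measurableT_comp mN _; exact: pair1_measurable.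
(* Off [e] the kernel [N] may be negative, so Tonelli is applied to its positive and negative parts
   separately. *)
have mIN : measurable_fun setT (fun x : T => \int[mu]_y N (x, y)).
  rewrite (_ : (fun x => _) = (fun x => \int[mu]_y (N^\+ (x, y)) -
      \int[mu]_y (N^\- (x, y)))); last first.
    apply/funext => x; rewrite integralE; congr (_ - _).
      by apply: eq_integral => y _; rewrite !funeposE.
    by apply: eq_integral => y _; rewrite !funenegE.
  apply: emeasurable_funB.
    by apply: (@measurable_fun_fubini_tonelli_F _ _ T T R mu N^\+) => //;
      exact: measurable_funepos.
  by apply: (@measurable_fun_fubini_tonelli_F _ _ T T R mu N^\-) => //;
    exact: measurable_funeneg.
have inner x : e x -> \int[mu]_y N (x, y) = log_potential c mu x - c%:E.
  move=> ex; rewrite /log_potential -integral_sub_cst//; last 2 first.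
  - by move=> y; exact: log_kernel_ge0.
  - exact: measurable_log_kernel1.
  apply: ae_eq_integral => //.
    by apply: emeasurable_funB => //; exact: measurable_log_kernel1.
  by apply: ae_e => y ey; rewrite /N/= (@lneB_log_kernel c)// ec.
rewrite -integral_sub_cst//; last 2 first.
- by move=> x; exact: log_potential_ge0.
- exact: measurable_log_potential.
apply: ae_eq_integral => //.
  by apply: emeasurable_funB => //; exact: measurable_log_potential.
by apply: ae_e => x /inner.
Qed.

Lemma log_kernel_cvg c (x y : R) (u : nat -> R) : u n @[n --> \oo] --> x ->
  log_kernel c (u n, y) @[n --> \oo] --> log_kernel c (x, y).
Proof.
move=> ux; have [xy|xy] := eqVneq x y.
  rewrite [X in _ --> X]/log_kernel/= xy eqxx; apply/cvgeyPge => A.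
  have e0 : (0 < expR (c - A))%R by exact: expR_gt0.
  move/cvgrPdist_lt : ux => /(_ _ e0); apply: filterS => n un.
  rewrite /log_kernel/=; case: ifPn => [_|uny]; first exact: leey.
  rewrite lee_fin le_max; apply/orP; right.
  rewrite lerBrDr addrC -lerBrDr -ler_expR lnK; last first.
    by rewrite posrE normr_gt0 subr_eq0.
  by rewrite distrC -xy ltW.
have xy0 : (0 < `|x - y|)%R by rewrite normr_gt0 subr_eq0.
have uy : (u n - y)%R @[n --> \oo] --> (x - y)%R.
  by apply: cvgB => //; exact: cvg_cst.
have nuy : (`|u n - y|)%R @[n --> \oo] --> (`|x - y|)%R by exact: cvg_norm.
have lnu : ln (`|u n - y|)%R @[n --> \oo] --> ln (`|x - y|)%R.
  by apply: continuous_cvg nuy; exact: continuous_ln.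
rewrite [X in _ --> X]/log_kernel/= (negbTE xy).
have near_ne : \forall n \near \oo, (Num.max 0 (c - ln `|u n - y|))%:E = log_kernel c (u n, y).
  move/cvgrPdist_lt : nuy => /(_ _ xy0); apply: filterS => n.
  rewrite /log_kernel/=; case: eqVneq => // ->.
  by rewrite subrr normr0 subr0 normr_id ltxx.
have cmax : {for (c - ln `|x - y|)%R, continuous (fun v : R => Num.max 0%R v)}.
  by apply: continuous_max; [exact: cvg_cst|exact: cvg_id].
have cln : (c - ln `|u n - y|)%R @[n --> \oo] --> (c - ln `|x - y|)%R.
  by apply: cvgB => //; exact: cvg_cst.
have cv : Num.max 0%R (c - ln `|u n - y|)%R @[n --> \oo] -->
    Num.max 0%R (c - ln `|x - y|)%R.
  exact: (cvg_comp _ _ cln cmax).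
apply: cvg_trans (near_eq_cvg near_ne) _.
by apply: cvg_EFin; [exact: nearW|exact: cv].
Qed.

(** Lower semicontinuity: the kernel is continuous into the extended reals, diagonal included, so
    Fatou applies along a sequence tending to [x]. It makes the set to which the near minimizer is
    restricted closed. *)
Lemma log_potential_closed c mu (C : \bar R) :
  closed [set x | log_potential c mu x <= C].
Proof.
move=> x clx.
have /choice[u uP] : forall n : nat, exists y : R,
    log_potential c mu y <= C /\ (`|x - y| < n.+1%:R^-1)%R.
  move=> n; have := clx (ball x n.+1%:R^-1).
  have /[swap]/[apply] : nbhs x (ball x n.+1%:R^-1).
    by apply: nbhsx_ballx; rewrite invr_gt0.
  by move=> [y [yC xy]]; exists y; split => //; move: xy; rewrite -ball_normE.
have ux : u n @[n --> \oo] --> x.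
  apply/cvgrPdist_lt => eps eps0.
  have := @cvg_harmonic R => /cvgrPdist_lt /(_ _ eps0); apply: filterS => n.
  rewrite sub0r normrN /harmonic/= ger0_norm ?invr_ge0// => h.
  by have [_ /lt_trans] := uP n; apply.
have := @fatou _ _ _ mu setT measurableT (fun n y => log_kernel c (u n, y)).
move=> /(_ (fun n => measurable_log_kernel1 c (u n))).
move=> /(_ (fun n y _ => log_kernel_ge0 c (u n, y))) fat.
have E : \int[mu]_y limn_einf (fun n => log_kernel c (u n, y)) = log_potential c mu x.
  by apply: eq_integral => y _; have [-> _] := cvg_limn_einf_sup (@log_kernel_cvg c x y u ux).
rewrite /= -E; apply: le_trans fat _.
rewrite limn_einf_lim; apply: lime_le; first exact: is_cvg_einfs.
apply: nearW => n; apply: le_trans (_ : log_potential c mu (u n) <= C); last by have [] := uP n.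
by apply: ereal_inf_lbound; exists n => /=.
Qed.

End log_energy.

(* Lowering the density of the near-minimizer by the factor [1 - s] on the set
   where its potential exceeds [W + eps] saves energy of first order in [s];
   hence that set has small mass [eta]. *)
Lemma near_minimizer_mass (R : realType) (W eps delta s E E1 EA eta : R) :
  0 <= W -> 0 < eps -> s = eps / (2 * (W + eps)) ->
  delta = s * eps ^+ 2 / (W + 2 * eps) ->
  E <= W + delta -> E1 + EA = E -> (W + eps) * eta <= EA -> 0 <= eta ->
  W * (1 - s * eta) ^+ 2 <= (1 - s) ^+ 2 * E + 2 * s * (1 - s) * E1 + s ^+ 2 * E ->
  eta * (W + 2 * eps) <= eps.
Proof.
move=> W0 eps0 sE dE EW EE EAW eta0 H.
have We : 0 < W + eps by rewrite ltr_wpDl.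
have W2e : 0 < W + 2 * eps by rewrite ltr_wpDl// mulr_gt0.
have s0 : 0 < s by rewrite sE divr_gt0// mulr_gt0.
have sW : s * (W + eps) = eps / 2 by rewrite sE; field; rewrite gt_eqF.
have s1 : s <= 1 / 2.
  by rewrite sE ler_pdivrMr ?mulr_gt0//; lra.
have d0 : delta * (W + 2 * eps) = s * eps ^+ 2.
  by rewrite dE; field; rewrite gt_eqF.
have H1 : W * (1 - 2 * (s * eta)) <= W * (1 - s * eta) ^+ 2.
  rewrite ler_wpM2l// -subr_ge0.
  have -> : (1 - s * eta) ^+ 2 - (1 - 2 * (s * eta)) = (s * eta) ^+ 2 by ring.
  exact: sqr_ge0.
have H2 : (1 - s) ^+ 2 * E + 2 * s * (1 - s) * E1 + s ^+ 2 * E =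
    E - 2 * s * (1 - s) * EA by rewrite -EE; ring.
have H3 : 2 * s * (1 - s) * ((W + eps) * eta) <= 2 * s * (1 - s) * EA.
  by rewrite ler_wpM2l// mulr_ge0 ?mulr_ge0 ?(ltW s0)//; lra.
have H4 : 2 * s * (1 - s) * ((W + eps) * eta) - 2 * W * (s * eta) = s * eta * eps.
  transitivity (2 * s * eta * (W + eps - s * (W + eps) - W)); first by ring.
  by rewrite sW; field.
have H5 : s * eta * eps <= delta by lra.
have H6 : s * eta * eps * (W + 2 * eps) <= s * eps ^+ 2.
  by rewrite -d0 ler_wpM2r// ltW.
rewrite -(ler_pM2l (mulr_gt0 s0 eps0)).
have -> : s * eps * eps = s * eps ^+ 2 by ring.
by apply: le_trans H6; rewrite le_eqVlt; apply/orP; left; apply/eqP; ring.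
Qed.

Section near_equilibrium.
Local Open Scope ereal_scope.
Context {R : realType}.
Local Notation T := (measurableTypeR R).
Variables (e : set R) (c W : R).
Hypothesis ce : compact e.
Hypothesis W0 : (0 <= W)%R.
Hypothesis WE : forall nu : probability T R, nu e = 1 ->
  W%:E <= \int[nu]_x log_potential c nu x.
Hypothesis nearW_ : forall delta : R, (0 < delta)%R ->
  exists2 mu : probability T R, mu e = 1 &
    \int[mu]_x log_potential c mu x <= (W + delta)%:E.

Let me : measurable (e : set T).
Proof. by apply: closed_measurable; apply: compact_closed ce; exact: norm_hausdorff. Qed.

Section restricted_energy.
Variables (mu : probability T R) (B : set T).
Hypothesis mB : measurable B.
Let UB (x : T) : \bar R := \int[mu]_(y in B) log_kernel c (x, y).

Let UB_ge0 x : 0 <= UB x.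
Proof. by apply: integral_ge0 => y _; exact: log_kernel_ge0. Qed.

Let KB (z : T * T) : \bar R := log_kernel c z * (\1_B z.2)%:E.

Let KB_ge0 z : 0 <= KB z.
Proof. by rewrite mule_ge0 ?log_kernel_ge0// lee_fin indicE. Qed.

Let mKB : measurable_fun setT KB.
Proof.
apply: emeasurable_funM; first exact: measurable_log_kernel.
apply/measurable_EFinP; apply: measurableT_comp; last exact: measurable_snd.
exact: measurable_indic.
Qed.

Let UBE x : UB x = \int[mu]_y KB (x, y).
Proof.
rewrite /UB integral_mkcond; apply: eq_integral => y _.
by rewrite /KB patchE indicE/=; case: ifP; rewrite (mule1, mule0).
Qed.

Let mUB : measurable_fun setT UB.
Proof.
rewrite (_ : UB = fun x => \int[mu]_y KB (x, y)); last exact/funext.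
exact: (@measurable_fun_fubini_tonelli_F _ _ T T R mu KB mKB KB_ge0).
Qed.

(** Tonelli and the symmetry of the kernel: the mutual energy of [mu] and its restriction to [B] can
    be computed from either side. *)
Let UB_int : \int[mu]_x UB x = \int[mu]_(x in B) log_potential c mu x.
Proof.
under eq_integral do rewrite UBE.
rewrite (@fubini_tonelli _ _ T T R mu mu KB mKB KB_ge0).
rewrite [RHS]integral_mkcond; apply: eq_integral => y _.
rewrite patchE /KB /= indicE; case: ifP => _ /=.
  by rewrite /log_potential; apply: eq_integral => x _; rewrite mule1 log_kernelC.
by under eq_integral do rewrite mule0; rewrite integral0.
Qed.

Let UB_le x : UB x <= log_potential c mu x.
Proof.
rewrite UBE; apply: ge0_le_integral => //.
- by apply: measurableT_comp; [exact: mKB|exact: pair1_measurable].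
- exact: measurable_log_kernel1.
- move=> y _; rewrite /KB indicE/=; case: (_ \in _); rewrite (mule1, mule0)//.
  exact: log_kernel_ge0.
Qed.

Let mU := measurable_log_potential c mu.
Let U0 := log_potential_ge0 c mu.

(** The energy is a quadratic form, expanded at [a mu + b mu|_B]; in the last term the energy of
    [mu|_B] is replaced by the larger energy of [mu]. *)
Lemma weighted_energy (a b : R) : (0 <= a)%R -> (0 <= b)%R ->
  a%:E + b%:E * mu B = 1 ->
  exists nu : probability T R, [/\
    forall A, measurable A -> nu A = a%:E * mu A + b%:E * mu (A `&` B),
    forall x, log_potential c nu x <= (a + b)%:E * log_potential c mu x &
    \int[nu]_x log_potential c nu x <=
      (a ^+ 2)%:E * \int[mu]_x log_potential c mu x +
      (2 * a * b)%:E * \int[mu]_(x in B) log_potential c mu x +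
      (b ^+ 2)%:E * \int[mu]_x log_potential c mu x].
Proof.
move=> a0 b0 ab.
have [nu [nuE nuI]] := weighted_probability mB a0 b0 ab.
have pE x : log_potential c nu x = a%:E * log_potential c mu x + b%:E * UB x.
  rewrite /log_potential nuI//; first by move=> y; exact: log_kernel_ge0.
  exact: measurable_log_kernel1.
have mP : measurable_fun setT (fun x : T => a%:E * log_potential c mu x + b%:E * UB x).
  by apply: emeasurable_funD; exact: measurable_funeM.
exists nu; split; first exact: nuE.
  move=> x; rewrite pE EFinD ge0_muleDl; [|by rewrite lee_fin|by rewrite lee_fin].
  by apply: leeD2l; apply: lee_wpmul2l; [rewrite lee_fin|exact: UB_le].
set E := \int[mu]_x log_potential c mu x.
set E1 := \int[mu]_(x in B) log_potential c mu x.
have E0 : 0 <= E by apply: integral_ge0.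
have E10 : 0 <= E1 by apply: integral_ge0.
have E1E : E1 <= E.
  apply: ge0_subset_integral; [exact: mB|exact: measurableT|exact: mU| |exact: subsetT].
  by move=> x _; exact: U0.
have aU0 x : 0 <= a%:E * log_potential c mu x by apply: mule_ge0; [rewrite lee_fin|exact: U0].
have bUB0 x : 0 <= b%:E * UB x by apply: mule_ge0; [rewrite lee_fin|exact: UB_ge0].
have maU : measurable_fun setT (fun x : T => a%:E * log_potential c mu x).
  exact: measurable_funeM mU.
have mbUB : measurable_fun setT (fun x : T => b%:E * UB x) by exact: measurable_funeM mUB.
have TS (f : T -> \bar R) : measurable_fun setT f -> measurable_fun B f.
  exact: measurable_funTS.
have PT : \int[mu]_x (a%:E * log_potential c mu x + b%:E * UB x) = a%:E * E + b%:E * E1.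
  rewrite (ge0_integralD _ measurableT (fun x _ => aU0 x) maU (fun x _ => bUB0 x) mbUB).
  rewrite (ge0_integralZl_EFin _ measurableT (fun x _ => U0 x) mU a0).
  rewrite (ge0_integralZl_EFin _ measurableT (fun x _ => UB_ge0 x) mUB b0).
  by rewrite UB_int.
have PB : \int[mu]_(x in B) (a%:E * log_potential c mu x + b%:E * UB x) <=
    a%:E * E1 + b%:E * E.
  rewrite (ge0_integralD _ mB (fun x _ => aU0 x) (TS _ maU) (fun x _ => bUB0 x) (TS _ mbUB)).
  rewrite (ge0_integralZl_EFin _ mB (fun x _ => U0 x) (TS _ mU) a0).
  rewrite (ge0_integralZl_EFin _ mB (fun x _ => UB_ge0 x) (TS _ mUB) b0).
  apply: leeD2l; apply: lee_wpmul2l; first by rewrite lee_fin.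
  apply: le_trans E1E; rewrite /E1 -UB_int.
  apply: ge0_subset_integral; [exact: mB|exact: measurableT|exact: mUB| |exact: subsetT].
  by move=> x _; exact: UB_ge0.
under eq_integral do rewrite pE.
rewrite (nuI _ (fun x => adde_ge0 (aU0 x) (bUB0 x)) mP).
rewrite PT; apply: (@le_trans _ _ (a%:E * (a%:E * E + b%:E * E1) +
    b%:E * (a%:E * E1 + b%:E * E))).
  by apply: leeD2l; apply: lee_wpmul2l; [rewrite lee_fin|exact: PB].
clearbody E E1.
rewrite !ge0_muleDr ?mule_ge0 ?lee_fin// !muleA -!EFinM.
rewrite -addeA (addeA ((a * b)%:E * E1)) -ge0_muleDl ?lee_fin ?mulr_ge0//.
rewrite -EFinD -!expr2 (mulrC b a) -mulr2n -(mulr_natl (a * b)) !mulrA.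
by rewrite addeA.
Qed.

End restricted_energy.

(** Two reweightings of a near minimizer [mu] are used. Lowering the density off [B] by the factor
    [1 - s] gives a test measure, and comparing its energy with [W] bounds the mass [eta] off [B].
    Conditioning [mu] on [B] then multiplies the potential by at most [1 / (1 - eta)], and
    [eta (W + 2 eps) <= eps] turns [(W + eps) / (1 - eta)] into at most [W + 2 eps]. *)
Lemma near_equilibrium (eps : R) : (0 < eps)%R ->
  exists (mu : probability T R) (F : set R), [/\ F `<=` e, closed F, mu F = 1 &
    forall x, F x -> log_potential c mu x <= (W + 2 * eps)%:E].
Proof.
move=> eps0.
have We : (0 < W + eps)%R by rewrite ltr_wpDl.
have W2e : (0 < W + 2 * eps)%R by rewrite ltr_wpDl// mulr_gt0.
pose s := (eps / (2 * (W + eps)))%R.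
pose delta := (s * eps ^+ 2 / (W + 2 * eps))%R.
have s0 : (0 < s)%R by rewrite divr_gt0// mulr_gt0.
have s1 : (s <= 1 / 2)%R.
  rewrite ler_pdivrMr; last by rewrite mulr_gt0.
  by rewrite mulrA divrK ?unitfE// mul1r lerDr.
have d0 : (0 < delta)%R by rewrite divr_gt0// mulr_gt0// exprn_gt0.
have [mu mue Emu] := nearW_ d0.
have mU := measurable_log_potential c mu.
have U0 := log_potential_ge0 c mu.
pose B : set T := [set x | log_potential c mu x <= (W + eps)%:E].
have clB : closed (B : set R) by exact: log_potential_closed.
have mB : measurable B.
  by rewrite -[B]setTI; exact: emeasurable_fun_infty_c.
pose eta := fine (mu (~` B)).
have muCB : mu (~` B) = eta%:E by rewrite fineK// fin_num_measure//; exact: measurableC.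
have muB : mu B = (1 - eta)%:E.
  by rewrite -[B]setCK probability_setC ?muCB//; exact: measurableC.
have eta0 : (0 <= eta)%R by rewrite fine_ge0.
have eta1 : (eta <= 1)%R by rewrite -lee_fin -muCB; apply: probability_le1; exact: measurableC.
have z0 : (0 < 1 - s * eta)%R.
  rewrite subr_gt0 (@le_lt_trans _ _ s)//; last by lra.
  by rewrite ler_piMr// ltW.
have [nu [nuA _ nuE]] : exists nu : probability T R, [/\
    forall A, measurable A -> nu A = ((1 - s) / (1 - s * eta))%:E * mu A +
      (s / (1 - s * eta))%:E * mu (A `&` B),
    forall x, log_potential c nu x <= ((1 - s) / (1 - s * eta) + s / (1 - s * eta))%:E * log_potential c mu x &
    \int[nu]_x log_potential c nu x <=
      (((1 - s) / (1 - s * eta)) ^+ 2)%:E * \int[mu]_x log_potential c mu x +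
      (2 * ((1 - s) / (1 - s * eta)) * (s / (1 - s * eta)))%:E *
        \int[mu]_(x in B) log_potential c mu x +
      ((s / (1 - s * eta)) ^+ 2)%:E * \int[mu]_x log_potential c mu x].
  apply: weighted_energy => //.
  - by rewrite divr_ge0// ?(ltW z0)// subr_ge0; lra.
  - by rewrite divr_ge0// ltW.
  - rewrite muB -EFinM -EFinD; congr (_%:E); field.
    by rewrite gt_eqF.
have eB : mu (e `&` B) = mu B.
  rewrite (measureDI mu mB me) setIC -[LHS]add0e; congr (_ + _); apply/esym.
  apply/eqP; rewrite -measure_le0.
  have <- : mu (~` e) = 0 by rewrite probability_setC// mue subee.
  by apply: le_measure; rewrite ?inE; [exact: measurableD|exact: measurableC|move=> x []].
have nue : nu e = 1.
  rewrite nuA// mue eB muB mule1 -EFinM -EFinD; congr (_%:E); field.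
  by rewrite gt_eqF.
have Efin : \int[mu]_x log_potential c mu x \is a fin_num.
  rewrite ge0_fin_numE; last by apply: integral_ge0 => x _; exact: U0.
  by apply: le_lt_trans Emu _; rewrite ltry.
have sub (A : set T) : measurable A ->
    \int[mu]_(x in A) log_potential c mu x \is a fin_num.
  move=> mA; rewrite ge0_fin_numE; last by apply: integral_ge0 => x _; exact: U0.
  apply: (@le_lt_trans _ _ (\int[mu]_x log_potential c mu x)); last first.
    by rewrite ltey_eq Efin.
  apply: ge0_subset_integral; [exact: mA|exact: measurableT|exact: mU| |exact: subsetT].
  by move=> x _; exact: U0.
have mCB : measurable (~` B) by exact: measurableC.
pose E := fine (\int[mu]_x log_potential c mu x).
pose E1 := fine (\int[mu]_(x in B) log_potential c mu x).
pose EA := fine (\int[mu]_(x in ~` B) log_potential c mu x).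
have EE : (E1 + EA = E)%R.
  apply: EFin_inj; rewrite EFinD !fineK ?sub//.
  have := @ge0_integral_setU _ _ _ mu B (~` B) mB mCB (log_potential c mu).
  rewrite setUv => <- //; last by apply/disj_set2P; rewrite setICr.
have EAge : ((W + eps) * eta <= EA)%R.
  rewrite -lee_fin fineK ?sub// EFinM -muCB -integral_cst//.
  apply: ge0_le_integral => //.
  - by move=> x _; rewrite lee_fin ltW.
  - exact: measurable_funTS.
  - by move=> x /= /negP; rewrite -ltNge => /ltW.
have EW : (E <= W + delta)%R by rewrite -lee_fin fineK.
have Hz : (W * (1 - s * eta) ^+ 2 <=
    (1 - s) ^+ 2 * E + 2 * s * (1 - s) * E1 + s ^+ 2 * E)%R.
  have := le_trans (WE nue) nuE.
  have -> : \int[mu]_x log_potential c mu x = E%:E by rewrite fineK.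
  have -> : \int[mu]_(x in B) log_potential c mu x = E1%:E by rewrite fineK ?sub.
  rewrite -!EFinM -!EFinD lee_fin => h.
  have := ler_wpM2r (sqr_ge0 (1 - s * eta)) h; move/le_trans; apply.
  by rewrite le_eqVlt; apply/orP; left; apply/eqP; field; rewrite gt_eqF.
have etaW := near_minimizer_mass W0 eps0 erefl erefl EW EE EAge eta0 Hz.
have eta_lt1 : (eta < 1)%R.
  by rewrite -(ltr_pM2r W2e) mul1r (le_lt_trans etaW)//; lra.
have z10 : (0 < 1 - eta)%R by rewrite subr_gt0.
have b0 : (0 <= (1 - eta)^-1)%R by rewrite invr_ge0 ltW.
have ab : 0%:E + (1 - eta)^-1%:E * mu B = 1.
  by rewrite add0e muB -EFinM mulVf// gt_eqF.
have [nu' [nuA' nuU' _]] := weighted_energy mB (lexx 0%R) b0 ab.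
exists nu', (e `&` B); split.
- by move=> x [].
- by apply: closedI => //; apply: compact_closed ce; exact: norm_hausdorff.
- rewrite nuA'; last exact: measurableI.
  rewrite -setIA setIid eB muB mul0e add0e -EFinM mulVf// gt_eqF//.
- move=> x [ex Bx]; apply: le_trans (nuU' x) _.
  rewrite add0r (@le_trans _ _ ((1 - eta)^-1%:E * (W + eps)%:E))//.
    by apply: lee_wpmul2l; rewrite ?lee_fin.
  rewrite -EFinM lee_fin mulrC ler_pdivrMr// mulrBr mulr1.
  by rewrite lerBrDr mulrC; lra.
Qed.

End near_equilibrium.

(** * The potential off the support *)

Section maximum_principle.
Context {R : realType}.
Local Notation T := (measurableTypeR R).

Lemma log_kernel_ge (c x y l : R) :
  (x != y -> l <= c - ln `|x - y|) -> (l%:E <= log_kernel c (x, y))%E.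
Proof.
move=> h; rewrite /log_kernel/=; case: ifPn => [_|/h]; first exact: leey.
by rewrite lee_fin le_max => ->; rewrite orbT.
Qed.

Lemma ln_le_tangent (u z : R) : 0 < u -> 0 < z -> ln u <= ln z + (u - z) / z.
Proof.
move=> u0 z0; rewrite -lerBlDl -ln_div ?posrE//.
have -> : u / z = 1 + (u - z) / z by field; rewrite gt_eqF.
apply: le_ln1Dx; rewrite mulrBl mulfV ?gt_eqF// ltrBDr addrC subrr.
by rewrite divr_gt0.
Qed.

Lemma ln_concave (t u v : R) : 0 <= t <= 1 -> 0 < u -> 0 < v ->
  (1 - t) * ln u + t * ln v <= ln ((1 - t) * u + t * v).
Proof.
move=> /andP[t0 t1] u0 v0; set z := (1 - t) * u + t * v.
have z0 : 0 < z.
  rewrite /z; have [->|tn0] := eqVneq t 0; first by rewrite subr0 mul1r mul0r addr0.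
  rewrite ltr_wpDl// ?mulr_ge0 ?subr_ge0 ?(ltW u0)// mulr_gt0//.
  by rewrite lt_neqAle eq_sym tn0.
have hu : (1 - t) * ln u <= (1 - t) * (ln z + (u - z) / z).
  by rewrite ler_wpM2l ?subr_ge0// ln_le_tangent.
have hv : t * ln v <= t * (ln z + (v - z) / z).
  by rewrite ler_wpM2l// ln_le_tangent.
apply: le_trans (lerD hu hv) _; rewrite le_eqVlt; apply/orP; left; apply/eqP.
transitivity (ln z + ((1 - t) * u + t * v - z) / z); first by ring.
by rewrite -/z subrr mul0r addr0.
Qed.

(* On a gap [(a, b)] of the support, [- ln `|x - w|] is convex in [x], so its
   value is bounded by those at the two endpoints of the gap. *)
Lemma log_kernel_gap (F : set R) (c : R) (p : R * R) : compact F ->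
  F !=set0 -> plane_dom F p ->
  exists a b t, [/\ F a, F b, 0 <= t <= 1 & forall w, F w ->
    ((c - ln (pnorm (p - (w, 0)%R)))%:E <=
       (1 - t)%:E * log_kernel c (a, w) + t%:E * log_kernel c (b, w))%E].
Proof.
move=> cF F0 dp; pose x := p.1.
have Lle w : x != w -> c - ln (pnorm (p - (w, 0))) <= c - ln `|x - w|.
  move=> xw; rewrite lerD2l lerN2 ler_ln ?posrE ?normr_gt0 ?subr_eq0//.
    exact: (norm1_le_pnorm (p - (w, 0))).
  apply: lt_le_trans (norm1_le_pnorm (p - (w, 0))).
  by rewrite normr_gt0 subr_eq0.
have single a : F a -> (forall w, F w -> a != w ->
    c - ln (pnorm (p - (w, 0))) <= c - ln `|a - w|) ->
    exists a b t, [/\ F a, F b, 0 <= t <= 1 & forall w, F w ->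
    ((c - ln (pnorm (p - (w, 0)%R)))%:E <=
       (1 - t)%:E * log_kernel c (a, w) + t%:E * log_kernel c (b, w))%E].
  move=> Fa H; exists a, a, 0; split => // [|w Fw]; first by rewrite lexx ler01.
  by rewrite subr0 mul1e mul0e adde0; apply: log_kernel_ge => /(H w Fw).
have [Fx|nFx] := pselect (F x); first by apply: single Fx _ => w _; exact: Lle.
have cl : closed F by apply: compact_closed cF; exact: norm_hausdorff.
have ltx w : F w -> x != w by move=> Fw; apply/eqP => xw; apply: nFx; rewrite xw.
have left_max : (exists2 w, F w & w <= x) ->
    exists2 a, F a /\ a < x & forall w, F w -> w <= x -> w <= a.
  move=> [w0 Fw0 w0x].
  have cA : compact (F `&` [set y | y <= x]).
    by apply: (subclosed_compact _ cF); [apply: closedI => //; exact: closed_le|move=> ? []].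
  have cid : {within F `&` [set y | y <= x], continuous (@idfun R)}.
    by apply: continuous_subspaceT => ?; exact: cvg_id.
  have [a] := compact_EVT_max (ex_intro _ w0 (conj Fw0 w0x)) cA cid.
  rewrite inE => -[Fa /= ax] aP; exists a; first by split; rewrite // lt_neqAle eq_sym ltx.
  by move=> w Fw wx; apply: aP; rewrite inE.
have right_min : (exists2 w, F w & x <= w) ->
    exists2 b, F b /\ x < b & forall w, F w -> x <= w -> b <= w.
  move=> [w0 Fw0 w0x].
  have cA : compact (F `&` [set y | x <= y]).
    by apply: (subclosed_compact _ cF); [apply: closedI => //; exact: closed_ge|move=> ? []].
  have cid : {within F `&` [set y | x <= y], continuous (@idfun R)}.
    by apply: continuous_subspaceT => ?; exact: cvg_id.
  have [a] := compact_EVT_min (ex_intro _ w0 (conj Fw0 w0x)) cA cid.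
  rewrite inE => -[Fa /= ax] aP; exists a; first by split; rewrite // lt_neqAle ltx.
  by move=> w Fw wx; apply: aP; rewrite inE.
have closer a w : F w -> a != w -> `|a - w| <= `|x - w| ->
    c - ln (pnorm (p - (w, 0))) <= c - ln `|a - w|.
  move=> Fw aw h; apply: le_trans (Lle w (ltx w Fw)) _.
  rewrite lerD2l lerN2 ler_ln ?posrE ?normr_gt0 ?subr_eq0//.
  exact: ltx.
have [hl|nl] := pselect (exists2 w, F w & w <= x); last first.
  have allr w : F w -> x <= w.
    by move=> Fw; have [//|/ltW wx] := leP x w; exfalso; apply: nl; exists w.
  have [w0 Fw0] := F0; have [b [Fb xb] bP] := right_min (ex_intro2 _ _ w0 Fw0 (allr w0 Fw0)).
  apply: (single b Fb) => w Fw bw; apply: closer => //.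
  have bw' := bP w Fw (allr w Fw); rewrite !ler0_norm ?subr_le0 ?allr//.
  by rewrite lerN2 lerD2r ltW.
have [a [Fa ax] aP] := left_max hl.
have [hr|nr] := pselect (exists2 w, F w & x <= w); last first.
  have alll w : F w -> w <= x.
    by move=> Fw; have [//|/ltW wx] := leP w x; exfalso; apply: nr; exists w.
  apply: (single a Fa) => w Fw aw; apply: closer => //.
  have aw' := aP w Fw (alll w Fw); rewrite !ger0_norm ?subr_ge0 ?alll//.
  by rewrite lerD2r ltW.
have [b [Fb xb] bP] := right_min hr.
have ab : 0 < b - a by rewrite subr_gt0 (lt_trans ax).
pose t := (x - a) / (b - a).
have t0 : 0 < t by rewrite divr_gt0// subr_gt0.
have t1 : t < 1 by rewrite ltr_pdivrMr// mul1r ltrD2r.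
have xE : x = (1 - t) * a + t * b by rewrite /t; field; rewrite gt_eqF.
exists a, b, t; split => // [|w Fw]; first by rewrite !ltW.
have K0 := @log_kernel_ge0 R c.
(* If [w] is an endpoint of the gap, its kernel value is +oo with a positive weight, so the
   right-hand side is +oo. *)
have [aw|aw] := eqVneq a w.
  rewrite {1}/log_kernel/= aw eqxx gt0_muley ?lte_fin ?subr_gt0// addye ?leey//.
  by rewrite -ltNye (lt_le_trans (ltNyr 0))// mule_ge0// lee_fin ltW.
have [bw|bw] := eqVneq b w.
  rewrite [X in (_ + _ * X)%E]/log_kernel/= bw eqxx gt0_muley ?lte_fin// addey ?leey//.
  by rewrite -ltNye (lt_le_trans (ltNyr 0))// mule_ge0// lee_fin subr_ge0 ltW.
apply: (@le_trans _ _ ((1 - t)%:E * (c - ln `|a - w|)%:E + t%:E * (c - ln `|b - w|)%:E)%E).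
  rewrite -!EFinM -EFinD lee_fin; apply: le_trans (Lle w (ltx w Fw)) _.
  have -> : (1 - t) * (c - ln `|a - w|) + t * (c - ln `|b - w|) =
      c - ((1 - t) * ln `|a - w| + t * ln `|b - w|) by ring.
  rewrite lerD2l lerN2.
  (* No point of [F] lies inside the gap, so [w] is on one side of both endpoints and the distance
     to [w] is affine on the gap. Concavity of [ln] then applies. *)
  have -> : `|x - w| = (1 - t) * `|a - w| + t * `|b - w|.
    have [wx|xw] := leP w x.
      have wa := aP w Fw wx; rewrite !ger0_norm ?subr_ge0//; last first.
        by rewrite (le_trans wx)// ltW.
      by rewrite {1}xE; ring.
    have bw' := bP w Fw (ltW xw); rewrite !ler0_norm ?subr_le0//; last 2 first.
    - by rewrite (le_trans _ (ltW xw))// ltW.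
    - exact: ltW.
    by rewrite {1}xE; ring.
  by rewrite ln_concave ?normr_gt0 ?subr_eq0// !ltW.
apply: leeD; apply: lee_wpmul2l.
- by rewrite lee_fin subr_ge0 ltW.
- exact: log_kernel_ge.
- by rewrite lee_fin ltW.
- exact: log_kernel_ge.
Qed.

End maximum_principle.

Section potential.
Context {R : realType}.
Local Notation T := (measurableTypeR R).
Variables (mu : probability T R) (F : set R).
Hypothesis cF : compact F.
Hypothesis muF : mu F = 1%E.

Let mF : measurable (F : set T).
Proof. by apply: closed_measurable; apply: compact_closed cF; exact: norm_hausdorff. Qed.

Let F0 : F !=set0.
Proof.
apply/set0P/eqP => FE; move: muF; rewrite FE measure0 => /eqP.
by rewrite eq_sym onee_eq0.
Qed.

Let muFoo : (mu F < +oo)%E. Proof. by rewrite muF ltry. Qed.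

Let mean_cst (r : R) : \int[mu]_(w in F) (fun=> r) w = r.
Proof.
rewrite Rintegral_cst// -[RHS]mulr1; congr (_ * _).
exact: (congr1 fine muF).
Qed.

(** Minus the logarithmic potential of [mu], extended to the plane. *)
Definition log_mean (p : R * R) : R :=
  \int[mu]_(w in F) ln (pnorm (p - (w, 0))).

Definition separated (d : R) (p : R * R) :=
  forall w, F w -> d <= pnorm (p - (w, 0)).

Lemma plane_dom_separated p : plane_dom F p ->
  exists2 d, 0 < d & separated d p.
Proof.
move=> dp; have oU := plane_dom_open cF.
have /nbhs_ballP[d /= d0 dP] : nbhs p (plane_dom F) by exact: open_nbhs_nbhs.
exists d => // w Fw; rewrite leNgt; apply/negP => wd.
have /plane_domE : plane_dom F (w, 0).
  apply: dP; split; rewrite -ball_normE /=.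
    exact: le_lt_trans (norm1_le_pnorm (p - (w, 0))) wd.
  exact: le_lt_trans (norm2_le_pnorm (p - (w, 0))) wd.
by apply.
Qed.

Lemma support_bound : exists2 r0 : R, 0 <= r0 & forall w, F w -> pnorm (w, 0) <= r0.
Proof.
have [B [_ eB]] := compact_bounded cF.
have H w : F w -> pnorm (w, 0) <= B + 1.
  move=> Fw; rewrite /pnorm /= expr0n/= addr0 sqrtr_sqr.
  by apply: (eB (B + 1)) => //; rewrite ltrDl.
by exists (B + 1) => //; have [w /H] := F0; apply: le_trans; exact: pnorm_ge0.
Qed.

Let measurable_ln_pnorm (p : R * R) :
  measurable_fun setT (fun w : T => ln (pnorm (p - ((w : R), 0)))).
Proof.
apply: (@measurableT_comp _ _ _ _ _ _ (@ln R)); first exact: measurable_ln.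
apply: continuous_measurable_fun => w.
apply: continuous_comp; last exact: pnorm_continuous.
apply: cvgB; first exact: cvg_cst.
have c1 : y @[y --> w] --> w by exact: cvg_id.
have c2 : (fun=> 0 : R) y @[y --> w] --> (0 : R) by exact: cvg_cst.
exact: cvg_pair c1 c2.
Qed.

Lemma ln_bounded (d A : R) p w : 0 < d -> separated d p -> F w ->
  pnorm (p - (w, 0)) <= A -> `|ln (pnorm (p - (w, 0)))| <= `|ln d| + `|ln A|.
Proof.
move=> d0 sp Fw wA; have dw := sp w Fw.
have w0 := lt_le_trans d0 dw.
have h1 : ln d <= ln (pnorm (p - (w, 0))) by rewrite ler_ln.
have h2 : ln (pnorm (p - (w, 0))) <= ln A.
  by rewrite ler_ln// posrE (lt_le_trans w0).
rewrite ler_norml; apply/andP; split.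
  rewrite (le_trans _ h1)// opprD (le_trans (lerB (lexx _) (normr_ge0 _)))//.
  by rewrite subr0 lerNl -normrN ler_norm.
by rewrite (le_trans h2)// (le_trans (ler_norm _))// lerDr.
Qed.

Lemma ln_pnorm_integrable (d : R) p : 0 < d -> separated d p ->
  mu.-integrable F (EFin \o (fun w => ln (pnorm (p - (w, 0))))).
Proof.
move=> d0 sp; have [r0 r00 r0P] := support_bound.
apply: (measurable_bounded_integrable mF muFoo).
- by apply: measurable_funTS; exact: measurable_ln_pnorm.
- exists (`|ln d| + `|ln (pnorm p + r0)|); split; first exact: num_real.
  move=> M MM w Fw; apply: le_trans (ltW MM).
  apply: ln_bounded => //; apply: le_trans (pnormD _ _) _.
  by rewrite lerD2l pnormN r0P.
Qed.

Lemma log_mean_lipschitz (d : R) p q : 0 < d -> separated d p -> separated d q ->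
  `|log_mean p - log_mean q| <= pnorm (p - q) / d.
Proof.
move=> d0 sp sq.
have ip := ln_pnorm_integrable d0 sp; have iq := ln_pnorm_integrable d0 sq.
have one (a b : R * R) w : separated d a -> separated d b -> F w ->
    ln (pnorm (a - (w, 0))) - ln (pnorm (b - (w, 0))) <= pnorm (a - b) / d.
  move=> sa sb Fw; have da := sa w Fw; have db := sb w Fw.
  have b0 := lt_le_trans d0 db.
  rewrite lerBlDl (le_trans (ln_le_tangent (lt_le_trans d0 da) b0))// lerD2l.
  apply: (@le_trans _ _ (pnorm (a - b) / pnorm (b - (w, 0)))).
    rewrite ler_pM2r ?invr_gt0//; apply: le_trans (pnormB _ _) _.
    by rewrite opprB addrA subrK.
  by rewrite ler_wpM2l ?pnorm_ge0// lef_pV2.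
have cst_int : mu.-integrable F (EFin \o (fun _ : T => pnorm (p - q) / d)).
  exact: finite_measure_integrable_cst.
rewrite -RintegralB//.
have -> : pnorm (p - q) / d = \int[mu]_(w in F) (fun=> pnorm (p - q) / d) w.
  by rewrite mean_cst.
have idiff : mu.-integrable F (EFin \o (fun w : T =>
    ln (pnorm (p - ((w : R), 0))) - ln (pnorm (q - ((w : R), 0))))).
  exact: (integrableB mF ip iq).
apply: le_trans (le_normr_Rintegral _ idiff) _ => //.
apply: le_Rintegral => //.
  exact: (integrable_norm idiff).
move=> w Fw; rewrite ler_norml lerNl opprB; apply/andP; split; last exact: one.
by rewrite -[in leRHS]pnormN opprB; exact: one.
Qed.

Lemma log_mean_continuous p : plane_dom F p -> {for p, continuous log_mean}.
Proof.
move=> /plane_dom_separated[d d0 sp].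
apply/cvgrPdist_le => eps eps0.
have d20 : 0 < d / 2 by rewrite divr_gt0.
have n1 : \forall q \near p, pnorm (q - p) <= Num.min (d / 2) (eps * (d / 2)).
  have cpn : continuous (fun q : (R * R)%type => pnorm (q - p)).
    move=> q; apply: continuous_comp; last exact: pnorm_continuous.
    by apply: cvgB; [exact: cvg_id|exact: cvg_cst].
  have m0 : 0 < Num.min (d / 2) (eps * (d / 2)) by rewrite lt_min d20 mulr_gt0.
  have /cvgrPdist_le /(_ _ m0) := cpn p; apply: filterS => q.
  rewrite [X in `|X - _|](_ : _ = 0); last first.
    by rewrite subrr /pnorm /= expr0n/= addr0 sqrtr0.
  by rewrite sub0r normrN ger0_norm ?pnorm_ge0.
apply: filterS n1 => q; rewrite le_min => /andP[qd qe].
have sp2 : separated (d / 2) p.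
  by move=> w /sp h; rewrite (le_trans _ h)// ler_pdivrMr// ler_peMr ?(ltW d0)// ler1n.
have sq : separated (d / 2) q.
  move=> w /sp h; have := pnormB (p - (w, 0)) (p - q).
  rewrite (_ : p - (w, 0) - (p - q) = q - (w, 0)); last first.
    by rewrite opprB addrC addrA subrK.
  apply: le_trans; rewrite lerBrDr.
  rewrite (le_trans _ h)// [leRHS]splitr lerD2l.
  by rewrite -pnormN opprB.
apply: le_trans (log_mean_lipschitz d20 sp2 sq) _.
by rewrite ler_pdivrMr// -pnormN opprB.
Qed.

(** Integrating [log_kernel_gap] over [w] bounds the shifted potential at [p] by a convex
    combination of its values at two points of [F], where it is at most [C]. *)
Lemma log_mean_ge (c C : R) p :
  (forall x, F x -> (log_potential c mu x <= C%:E)%E) -> plane_dom F p ->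
  c - C <= log_mean p.
Proof.
move=> UC dp; have [d d0 sp] := plane_dom_separated dp.
have ip := ln_pnorm_integrable d0 sp.
have [a [b [t [Fa Fb /andP[t0 t1] gap]]]] := log_kernel_gap c cF F0 dp.
have cst_int : mu.-integrable F (EFin \o (fun _ : T => c)).
  exact: finite_measure_integrable_cst.
pose L (w : T) : R := c - ln (pnorm (p - ((w : R), 0))).
have iL : mu.-integrable F (EFin \o L).
  exact: (integrableB mF cst_int ip).
have E : \int[mu]_(w in F) L w = c - log_mean p.
  by rewrite RintegralB// mean_cst.
rewrite lerBlDr -lerBlDl -E -lee_fin.
have -> : (\int[mu]_(w in F) L w)%:E = (\int[mu]_(w in F) (L w)%:E)%E.
  by rewrite fineK//; exact: integrable_fin_num.
have mK (x : T) := @measurable_log_kernel1 R c x.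
have K0 (x y : T) : (0 <= log_kernel c (x, y))%E by exact: log_kernel_ge0.
have mtK (s : R) (x : T) : measurable_fun setT (fun y : T => (s%:E * log_kernel c (x, y))%E).
  exact: measurable_funeM (mK x).
(* [L] may change sign; its positive part is still below the nonnegative kernels, which allows
   comparison of integrals of nonnegative functions. *)
apply: (@le_trans _ _ (\int[mu]_(w in F) (EFin \o L)^\+ w)%E).
  apply: le_integral => //.
    exact: integrable_funepos.
  by move=> w Fw; rewrite funeposE le_max lexx.
apply: (@le_trans _ _ (\int[mu]_(w in F)
    ((1 - t)%:E * log_kernel c (a, w) + t%:E * log_kernel c (b, w)))%E).
  apply: ge0_le_integral => //.
  - by apply: measurable_funepos; have /measurable_int := iL.
  - by apply: measurable_funTS; apply: emeasurable_funD; exact: mtK.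
  - move=> w Fw; rewrite funeposE ge_max gap//=.
    by rewrite adde_ge0// mule_ge0// lee_fin ?subr_ge0.
apply: (@le_trans _ _ ((1 - t)%:E * log_potential c mu a + t%:E * log_potential c mu b)%E).
  rewrite -!ge0_integralZl_EFin ?subr_ge0//.
  rewrite -ge0_integralD//.
  - apply: ge0_subset_integral => //.
      by apply: emeasurable_funD; exact: mtK.
    by move=> w _; rewrite adde_ge0// mule_ge0// lee_fin ?subr_ge0.
  - by move=> w _; rewrite mule_ge0// lee_fin subr_ge0.
  - by move=> w _; rewrite mule_ge0// lee_fin.
apply: (@le_trans _ _ ((1 - t)%:E * C%:E + t%:E * C%:E)%E).
  by apply: leeD; apply: lee_wpmul2l; rewrite ?lee_fin ?subr_ge0//; exact: UC.
by rewrite -!EFinM -EFinD lee_fin -mulrDl subrK mul1r.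
Qed.

End potential.

(** * Means of potentials over curves, by exchange of integrals *)

Section swap.
Context {R : realType}.
Local Notation T := (measurableTypeR R).
Local Notation leb := (@lebesgue_measure R).

Lemma EFin_Rintegral (d : measure_display) (X : measurableType d)
    (m : {measure set X -> \bar R}) (D : set X) (f : X -> R) : measurable D ->
  m.-integrable D (EFin \o f) ->
  (\int[m]_(x in D) (f x)%:E)%E = (\int[m]_(x in D) f x)%:E.
Proof. by move=> mD intf; rewrite fineK//; exact: integrable_fin_num. Qed.

(** Tonelli is applied to [f + M], cut off by the indicators of both domains, which is nonnegative;
    the contribution [2 * pi * M] then cancels. *)
Lemma Rintegral_swap (mu : probability T R) (F : set T) (f : T -> T -> R) (M : R) :
  measurable F -> mu F = 1%E -> 0 <= M ->
  measurable_fun setT (fun z : T * T => f z.1 z.2) ->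
  (forall t w, F w -> `|f t w| <= M) ->
  continuous (fun t : R => \int[mu]_(w in F) f t w) ->
  mu.-integrable F (EFin \o (fun w => \int[leb]_(t in `[0, 2 * pi]) f t w)) ->
  \int[leb]_(t in `[0, 2 * pi]) \int[mu]_(w in F) f t w =
  \int[mu]_(w in F) \int[leb]_(t in `[0, 2 * pi]) f t w.
Proof.
move=> mF muF M0 mf fM ch iv.
pose I : set T := `[0, 2 * pi]%classic.
have mI : measurable I by exact: measurable_itv.
have lI : (leb I < +oo)%E.
  by rewrite /I lebesgue_measure_itv/=; case: ifP => // _; rewrite -EFinB ltry.
have muFoo : (mu F < +oo)%E by rewrite muF ltry.
have mft t : measurable_fun setT (f t).
  by apply: (measurableT_comp mf (pair1_measurable t)).
have mfw w : measurable_fun setT (f ^~ w).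
  by apply: (measurableT_comp mf (pair2_measurable w)).
have ift t : mu.-integrable F (EFin \o f t).
  apply: (measurable_bounded_integrable mF muFoo).
    exact: measurable_funTS (mft t).
  exists M; split; first exact: num_real.
  by move=> N MN w Fw; exact: le_trans (fM t w Fw) (ltW MN).
have ifw w : F w -> leb.-integrable I (EFin \o f ^~ w).
  move=> Fw; apply: (measurable_bounded_integrable mI lI).
    exact: measurable_funTS (mfw w).
  exists M; split; first exact: num_real.
  by move=> N MN t _; exact: le_trans (fM t w Fw) (ltW MN).
have cM : mu.-integrable F (EFin \o (fun _ : T => M)).
  exact: finite_measure_integrable_cst.
have cMI : leb.-integrable I (EFin \o (fun _ : T => M)).
  by apply: continuous_integrable_itv; exact: cst_continuous.
pose h t := \int[mu]_(w in F) f t w.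
pose v w := \int[leb]_(t in I) f t w.
pose P (z : T * T) : \bar R := ((f z.1 z.2 + M) * \1_F z.2 * \1_I z.1)%:E.
have P0 z : (0 <= P z)%E.
  rewrite lee_fin mulr_ge0 ?indicE//; case: (boolP (z.2 \in F)); rewrite ?mulr0// mulr1 inE.
  by move=> /(fM z.1); rewrite ler_norml -subr_ge0 opprK addrC => /andP[].
have mP : measurable_fun setT P.
  apply/measurable_EFinP; apply: measurable_funM; first apply: measurable_funM.
  - by apply: measurable_funD => //; exact: measurable_cst.
  - by apply: measurableT_comp; [exact: measurable_indic|exact: measurable_snd].
  - by apply: measurableT_comp; [exact: measurable_indic|exact: measurable_fst].
have muM : \int[mu]_(w in F) (fun=> M) w = M.
  by rewrite Rintegral_cst// -[RHS]mulr1; congr (_ * _); exact: (congr1 fine muF).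
have swap := @fubini_tonelli _ _ T T R leb mu P mP P0.
have E1 t : (\int[mu]_w P (t, w))%E = ((h t + M) * \1_I t)%:E.
  rewrite /P /=.
  transitivity (\int[mu]_(w in F) ((f t w + M) * \1_I t)%:E)%E.
    rewrite [RHS]integral_mkcond; apply: eq_integral => w _.
    by rewrite patchE indicE; case: ifP => _; rewrite ?mulr1// mulr0 mul0r.
  have iM : mu.-integrable F (EFin \o (fun w : T => f t w + M)).
    exact: (integrableD mF (ift t) cM).
  rewrite indicE; case: (t \in I) => /=.
    under eq_integral do rewrite mulr1.
    by rewrite EFin_Rintegral// RintegralD// muM mulr1.
  by under eq_integral do rewrite mulr0; rewrite integral0 mulr0.
have E2 w : (\int[leb]_t P (t, w))%E = ((v w + 2 * pi * M) * \1_F w)%:E.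
  rewrite /P /=.
  transitivity (\int[leb]_(t in I) ((f t w + M) * \1_F w)%:E)%E.
    rewrite [RHS]integral_mkcond; apply: eq_integral => t _.
    by rewrite patchE [\1_I t]indicE; case: ifP => _; rewrite ?mulr1// mulr0.
  rewrite indicE; case: (boolP (w \in F)) => [|_] /=; last first.
    by under eq_integral do rewrite mulr0; rewrite integral0 mulr0.
  rewrite inE => Fw.
  have iM : leb.-integrable I (EFin \o (fun t : T => f t w + M)).
    exact: (integrableD mI (ifw w Fw) cMI).
  under eq_integral do rewrite mulr1.
  rewrite EFin_Rintegral// RintegralD//; last exact: ifw.
  by rewrite Rintegral_itv_cst mulr1.
have ihM : leb.-integrable I (EFin \o (fun t : T => h t + M)).
  have ih : leb.-integrable I (EFin \o h) by exact: continuous_integrable_itv.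
  exact: (integrableD mI ih cMI).
have c2M : mu.-integrable F (EFin \o (fun _ : T => 2 * pi * M)).
  exact: finite_measure_integrable_cst.
have ivM : mu.-integrable F (EFin \o (fun w : T => v w + 2 * pi * M)).
  exact: (integrableD mF iv c2M).
have L : (\int[leb]_t \int[mu]_w P (t, w) =
    (\int[leb]_(t in I) h t + 2 * pi * M)%:E)%E.
  transitivity (\int[leb]_(t in I) (h t + M)%:E)%E.
    rewrite [RHS]integral_mkcond; apply: eq_integral => t _; rewrite E1.
    by rewrite patchE indicE; case: ifP => _; rewrite ?mulr1// mulr0.
  rewrite EFin_Rintegral// RintegralD//; last exact: continuous_integrable_itv.
  by rewrite Rintegral_itv_cst.
have Rr : (\int[mu]_w \int[leb]_t P (t, w) =
    (\int[mu]_(w in F) v w + 2 * pi * M)%:E)%E.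
  transitivity (\int[mu]_(w in F) (v w + 2 * pi * M)%:E)%E.
    rewrite [RHS]integral_mkcond; apply: eq_integral => w _; rewrite E2.
    by rewrite patchE indicE; case: ifP => _; rewrite ?mulr1// mulr0.
  rewrite EFin_Rintegral// RintegralD//.
  congr (_ + _)%:E; rewrite Rintegral_cst// -[RHS]mulr1; congr (_ * _).
  exact: (congr1 fine muF).
by move: swap; rewrite L Rr => -[] /addIr.
Qed.

End swap.

Section potential_mean.
Context {R : realType}.
Local Notation T := (measurableTypeR R).
Variables (mu : probability T R) (F : set R).
Hypothesis cF : compact F.
Hypothesis muF : mu F = 1%E.

Let mF : measurable (F : set T).
Proof. by apply: closed_measurable; apply: compact_closed cF; exact: norm_hausdorff. Qed.

(** A curve that stays bounded and away from [F] keeps the logarithm bounded, so the exchange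
    applies. It serves both for small circles and for circles around infinity. *)
Lemma log_mean_curve (g : R -> R * R) (v : R -> R) (d A : R) :
  (forall t, {for t, continuous g}) -> 0 < d ->
  (forall t, separated F d (g t)) -> (forall t w, F w -> pnorm (g t - (w, 0)) <= A) ->
  (forall w, F w ->
    \int[lebesgue_measure]_(t in `[0, 2 * pi]) ln (pnorm (g t - (w, 0))) = v w) ->
  mu.-integrable F (EFin \o v) ->
  continuous (fun t => log_mean mu F (g t)) /\
  \int[lebesgue_measure]_(t in `[0, 2 * pi]) log_mean mu F (g t) =
  \int[mu]_(w in F) v w.
Proof.
move=> cg d0 sg gA gv iv.
have cm : continuous (fun t => log_mean mu F (g t)).
  move=> t; apply: (@continuous_comp _ _ _ g (log_mean mu F)); first exact: cg.
  apply: log_mean_continuous => //; apply/plane_domE => -[Fg g0].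
  have := sg t _ Fg; rewrite leNgt => /negP; apply.
  have -> : g t - ((g t).1, 0) = 0.
    have -> : ((g t).1, 0) = g t by rewrite -g0 -surjective_pairing.
    exact: subrr.
  by rewrite /pnorm /= expr0n/= addr0 sqrtr0.
split => //.
pose f (t w : T) : R := ln (pnorm (g t - ((w : R), 0))) * \1_F w.
have fE t : log_mean mu F (g t) = \int[mu]_(w in F) f t w.
  by apply: eq_Rintegral => w wF; rewrite /f indicE wF mulr1.
have vE : \int[mu]_(w in F) v w =
    \int[mu]_(w in F) \int[lebesgue_measure]_(t in `[0, 2 * pi]) f t w.
  apply: eq_Rintegral => w wF; rewrite -gv; last by rewrite inE in wF.
  by apply: eq_Rintegral => t _; rewrite /f indicE wF mulr1.
rewrite vE; under eq_Rintegral do rewrite fE.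
apply: (@Rintegral_swap R mu F f (`|ln d| + `|ln A|)) => //.
- apply: measurable_funM; last first.
    by apply: measurableT_comp; [exact: measurable_indic|exact: measurable_snd].
  apply: (@measurableT_comp _ _ _ _ _ _ (@ln R)); first exact: measurable_ln.
  apply: (@measurableT_comp _ _ _ _ _ _ (@Num.sqrt R)).
    by apply: continuous_measurable_fun; exact: sqrt_continuous.
  have cg1 : continuous (fun t : R => (g t).1).
    by move=> t; apply: continuous_comp; [exact: cg|exact: cvg_fst].
  have cg2 : continuous (fun t : R => (g t).2).
    by move=> t; apply: continuous_comp; [exact: cg|exact: cvg_snd].
  apply: measurable_funD; apply: measurable_funX; apply: measurable_funB.
  + apply: (@measurableT_comp _ _ _ _ _ _ (fun t : R => (g t).1)); last exact: measurable_fst.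
    exact: continuous_measurable_fun.
  + exact: measurable_snd.
  + apply: (@measurableT_comp _ _ _ _ _ _ (fun t : R => (g t).2)); last exact: measurable_fst.
    exact: continuous_measurable_fun.
  + exact: measurable_cst.
- move=> t w Fw; rewrite /f indicE mem_set// mulr1.
  exact: (ln_bounded d0 (sg t) Fw (gA t w Fw)).
- by under eq_fun do rewrite -fE.
- apply: eq_integrable iv => // w wF /=; congr (_%:E); rewrite -gv; last by rewrite inE in wF.
  by apply: eq_Rintegral => t _; rewrite /f indicE wF mulr1.
Qed.

End potential_mean.

(** * A Green-type function with constant close to - ln C(e) *)

Section equilibrium_green.
Context {R : realType}.
Local Notation T := (measurableTypeR R).

Lemma compact_diameter (e : set R) : compact e -> exists2 c : R, 0 <= c &
  forall x y, e x -> e y -> `|x - y| <= expR c.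
Proof.
move=> ce; have [B [_ eB]] := compact_bounded ce.
have H x : e x -> `|x| <= `|B| + 1.
  by apply: eB; rewrite (le_lt_trans (ler_norm _))// ltrDl.
exists (2 * (`|B| + 1)) => [|x y /H xB /H yB]; first by rewrite mulr_ge0// addr_ge0.
apply: le_trans (_ : 2 * (`|B| + 1) <= _).
  by rewrite (le_trans (ler_normB _ _))// mulr_natl mulr2n lerD.
by rewrite (le_trans _ (expR_ge1Dx _))// lerDr.
Qed.

(** [V0] is the infimum of the energies. It is not +oo because the capacity is positive, and not -oo
    because the diameter bound gives it the lower bound [- c]. *)
Lemma capacity_near_minimizer (e : set R) (c : R) : compact e ->
  (0 < capacity e)%E -> 0 <= c ->
  (forall x y, e x -> e y -> `|x - y| <= expR c) ->
  exists V0 : R, [/\ fine (capacity e) = expR (- V0), 0 <= V0 + c,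
    forall nu : probability T R, nu e = 1%E ->
      ((V0 + c)%:E <= \int[nu]_x log_potential c nu x)%E &
    forall delta : R, 0 < delta -> exists2 mu : probability T R, mu e = 1%E &
      (\int[mu]_x log_potential c mu x <= (V0 + c + delta)%:E)%E].
Proof.
move=> ce; rewrite /capacity; set S := [set log_energy mu | mu in _] => cap c0 ec.
have me : measurable (e : set T).
  by apply: closed_measurable; apply: compact_closed ce; exact: norm_hausdorff.
have SP (mu : probability T R) : compactly_supported_in e mu -> mu e = 1%E.
  move=> [K [cK Ke muK]]; apply/eqP; rewrite eq_le probability_le1//= -muK.
  apply: le_measure; rewrite ?inE//.
  by apply: closed_measurable; apply: compact_closed cK; exact: norm_hausdorff.
have energyE (mu : probability T R) : mu e = 1%E ->
    (log_energy mu = \int[mu]_x log_potential c mu x - c%:E)%E.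
  by move=> mue; apply: (@log_energyE R e c mu).
have Sge : (- c%:E <= ereal_inf S)%E.
  apply: le_ereal_inf_tmp => _ [mu /SP mue <-]; rewrite energyE//.
  rewrite -[leLHS]add0e; apply: leeD2r; apply: integral_ge0 => x _.
  exact: log_potential_ge0.
case SE : (ereal_inf S) => [V0| |]; last 2 first.
- by rewrite SE /= ltxx in cap.
- by rewrite SE in Sge.
have Vc : 0 <= V0 + c by rewrite SE lee_fin in Sge; rewrite -lerBlDr sub0r.
exists V0; split => //.
- move=> nu nue; rewrite EFinD -leeBrDr// -energyE// -SE.
  apply: ereal_inf_lbound; exists nu; last by [].
  by exists e; split; [exact: ce|exact: subset_refl|exact: nue].
- move=> delta d0.
  have Sfin : ereal_inf S \is a fin_num by rewrite SE.
  have [_ [mu /SP mue <-]] := lb_ereal_inf_adherent d0 Sfin.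
  rewrite SE energyE// => h; exists mu => //.
  rewrite -addrA (addrC c) addrA EFinD -leeBlDr//.
  exact: ltW.
Qed.

Lemma equilibrium_green (e : set R) (eps : R) : compact e ->
  (0 < capacity e)%E -> 0 < eps ->
  exists (G : R * R -> R) (V r0 : R),
  [/\ fine (capacity e) = expR (eps - V),
     (forall p, plane_dom e p -> 0 <= G p) /\ mean_value_on (plane_dom e) G,
     0 <= r0,
     forall p, r0 < pnorm p -> ln (pnorm p - r0) + V <= G p &
     exists2 rho, 0 < rho & forall r, 0 < r < rho ->
       continuous (fun t => G (circle_infty r t)) /\
       \int[lebesgue_measure]_(t in `[0, 2 * pi]) G (circle_infty r t) =
         2 * pi * (ln r^-1 + V)].
Proof.
move=> ce cap eps0; have [c c0 ec] := compact_diameter ce.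
have [V0 [capE Vc lowE nearE]] := capacity_near_minimizer ce cap c0 ec.
have e20 : 0 < eps / 2 by rewrite divr_gt0.
have [mu [F [Fe clF muF UF]]] := near_equilibrium ce Vc lowE nearE e20.
have cF : compact F by exact: subclosed_compact clF ce Fe.
have domF p : plane_dom e p -> plane_dom F p.
  by move=> /plane_domE h; apply/plane_domE => -[/Fe ep p2]; apply: h.
(* [near_equilibrium], applied with [eps / 2], bounds the shifted potential by [V0 + c + eps] on
   [F]. Hence [log_mean] is at least [- V] off [F], and [G] is nonnegative. *)
pose V := V0 + eps.
pose G p := log_mean mu F p + V.
have [r0 r00 r0P] := support_bound cF muF.
have mF : measurable (F : set T) by exact: closed_measurable.
have cst_int (r : R) : mu.-integrable F (EFin \o (fun _ : T => r)).
  exact: finite_measure_integrable_cst.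
have cstE (r : R) : \int[mu]_(w in F) (fun=> r) w = r.
  rewrite Rintegral_cst// -[RHS]mulr1; congr (_ * _).
  exact: (congr1 fine muF).
have GV (g : R -> R * R) (m : R) : continuous (fun t => log_mean mu F (g t)) ->
    \int[lebesgue_measure]_(t in `[0, 2 * pi]) log_mean mu F (g t) = 2 * pi * m ->
    continuous (fun t => G (g t)) /\
    \int[lebesgue_measure]_(t in `[0, 2 * pi]) G (g t) = 2 * pi * (m + V).
  move=> cg gm; have cV : continuous (fun _ : R => V) by exact: cst_continuous.
  split; first by move=> t; apply: cvgD; [exact: cg|exact: cV].
  rewrite RintegralD//; try exact: continuous_integrable_itv.
  by rewrite gm Rintegral_itv_cst -mulrDr.
exists G, V, r0; split => //.
- by rewrite capE; congr expR; rewrite /V; ring.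
- split=> [p dp|p dp].
    have := log_mean_ge cF muF UF (domF p dp).
    by rewrite /G /V -subr_ge0 => h; apply: le_trans h _; rewrite le_eqVlt; apply/orP; left; apply/eqP; field.
  split.
    apply: cvgD; last exact: cvg_cst.
    exact: (log_mean_continuous cF muF (domF p dp)).
  have [d d0 sp] := plane_dom_separated cF (domF p dp).
  have d20 : 0 < d / 2 by rewrite divr_gt0.
  exists (d / 2) => // r /andP[rr0 rd].
  have rp w : F w -> 0 <= r < pnorm (p - (w, 0)).
    move=> /sp h; rewrite ltW//= (lt_le_trans rd)// (le_trans _ h)//.
    by rewrite ler_pdivrMr// ler_peMr ?(ltW d0)// ler1n.
  have [|||||c1 c2] := @log_mean_curve R mu F cF muF (circle_at p r)
    (fun w => 2 * pi * ln (pnorm (p - (w, 0)))) (d / 2) (pnorm p + r + r0) _ d20.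
  + by move=> t; exact: circle_at_continuous.
  + move=> t w Fw; have := pnormB (p - (w, 0)) (p - circle_at p r t).
    rewrite (_ : p - (w, 0) - (p - circle_at p r t) = circle_at p r t - (w, 0)); last first.
      by rewrite opprB addrC addrA subrK.
    apply: le_trans; rewrite -(pnormN (p - circle_at p r t)) opprB circle_at_dist.
    rewrite ger0_norm ?(ltW rr0)// lerBrDr (le_trans _ (sp w Fw))//.
    by rewrite [leRHS]splitr lerD2l ltW.
  + move=> t w Fw; apply: le_trans (pnormD _ _) _; rewrite pnormN lerD ?r0P//.
    have := pnormD (circle_at p r t - p) p; rewrite subrK circle_at_dist.
    by rewrite ger0_norm ?(ltW rr0)// addrC.
  + by move=> w Fw; apply: circle_mean_ln_in; exact: rp.
  + have := integrableZl mF (2 * pi) (ln_pnorm_integrable cF muF d0 sp).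
    by [].
  by apply: GV => //; rewrite c2 RintegralZl//; exact: (ln_pnorm_integrable cF muF d0 sp).
- move=> p pr; rewrite /G lerD2r.
  have pr0 : 0 < pnorm p - r0 by rewrite subr_gt0.
  have sp : separated F (pnorm p - r0) p.
    by move=> w /r0P h; apply: le_trans (pnormB _ _); rewrite lerD2l lerN2.
  rewrite -(cstE (ln (pnorm p - r0))); apply: le_Rintegral => //.
    exact: (ln_pnorm_integrable cF muF pr0 sp).
  move=> w /sp h; rewrite ler_ln// posrE; exact: lt_le_trans h.
- have r01 : 0 < r0 + 1 by rewrite ltr_wpDl.
  exists (r0 + 1)^-1; first by rewrite invr_gt0.
  move=> r /andP[rr0 rr].
  have rinv : r0 + 1 < r^-1 by rewrite -(invrK (r0 + 1)) ltf_pV2 ?posrE ?invr_gt0.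
  have rp w : F w -> r * pnorm (w, 0) < 1.
    move=> /r0P h; rewrite -ltr_pdivlMl// mulr1 (le_lt_trans h)//.
    by rewrite (lt_trans _ rinv)// ltrDl.
  have [|||||c1 c2] := @log_mean_curve R mu F cF muF (circle_infty r)
    (fun=> 2 * pi * ln r^-1) 1 (r^-1 + r0) _ ltr01.
  + by move=> t; exact: circle_infty_continuous.
  + move=> t w /r0P h; apply: le_trans (pnormB _ _).
    rewrite pnorm_circle_infty// lerBrDr addrC (le_trans _ (ltW rinv))//.
    by rewrite lerD2r.
  + move=> t w Fw; apply: le_trans (pnormD _ _) _.
    by rewrite pnormN pnorm_circle_infty// lerD2l r0P.
  + by move=> w Fw; apply: circle_mean_ln_out => //; exact: rp.
  + exact: cst_int.
  by apply: GV => //; rewrite c2 cstE.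
Qed.

End equilibrium_green.

(** * Dickson polynomials and the lower bound *)

(** Dickson polynomials of the first kind. Defining them over an arbitrary commutative ring lets the
    same recurrence run on polynomials and on their values. *)
Fixpoint dickson (A : comNzRingType) (x a : A) (n : nat) : A :=
  if n is n1.+1 then
    if n1 is n2.+1 then x * dickson x a n1 - a * dickson x a n2 else x
  else 2.

Section dickson_theory.
Variable A : comNzRingType.

Lemma dicksonSS (x a : A) n :
  dickson x a n.+2 = x * dickson x a n.+1 - a * dickson x a n.
Proof. by []. Qed.

Lemma nat_ind2 (P : nat -> Prop) : P 0%N -> P 1%N ->
  (forall n, P n -> P n.+1 -> P n.+2) -> forall n, P n.
Proof.
move=> P0 P1 PS n; suff [] : P n /\ P n.+1 by [].
by elim: n => [|n [IH1 IH2]]; split => //; exact: PS.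
Qed.

Lemma dickson_roots (l m : A) n : dickson (l + m) (l * m) n = l ^+ n + m ^+ n.
Proof.
elim/nat_ind2: n => [||n IH1 IH2]; rewrite ?expr0 ?expr1//.
by rewrite dicksonSS IH1 IH2 !exprS; ring.
Qed.

Lemma horner_dickson (p a : {poly A}) x n :
  (dickson p a n).[x] = dickson p.[x] a.[x] n.
Proof.
elim/nat_ind2: n => [||n IH1 IH2] //; first by rewrite /= -polyC_natr hornerC.
by rewrite !dicksonSS hornerD hornerN !hornerM IH1 IH2.
Qed.

End dickson_theory.

Lemma size_polyM_bound (R : idomainType) (p q : {poly R}) i j :
  (size p <= i)%N -> (size q <= j.+1)%N -> (size (p * q)%R <= i + j)%N.
Proof.
move=> pi qj; apply: leq_trans (size_polyMleq _ _) _.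
by rewrite -[leqRHS]/((i + j).+1.-1) -!subn1 leq_sub2r// -addnS leq_add.
Qed.

Lemma size_dickson (R : idomainType) (p a : {poly R}) k n :
  (size p <= k.+1)%N -> (size a <= (2 * k).+1)%N ->
  (size (dickson p a n) <= (n * k).+1)%N.
Proof.
move=> sp sa; elim/nat_ind2: n => [||n IH1 IH2].
- by rewrite /= -polyC_natr size_polyC; case: (_ != 0).
- by rewrite mul1n.
rewrite dicksonSS (leq_trans (size_polyD _ _))// geq_max size_polyN.
apply/andP; split.
  by rewrite mulSn -addSn; exact: size_polyM_bound.
by rewrite -addn2 addnC mulnDl -addSn; exact: size_polyM_bound.
Qed.

(** The bound on [size a] means degree below [2 k], so the term with [a] never reaches the top
    degree. The index starts at 1 because [dickson p a 0] is the constant 2. *)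
Lemma lead_coef_dickson (R : idomainType) (p a : {poly R}) k n :
  size p = k.+1 -> (size a <= 2 * k)%N ->
  size (dickson p a n.+1) = (n.+1 * k).+1 /\
  lead_coef (dickson p a n.+1) = lead_coef p ^+ n.+1.
Proof.
move=> sp sa; elim: n => [|n [IH1 IH2]]; first by rewrite /= mul1n expr1.
have p0 : p != 0 by rewrite -size_poly_eq0 sp.
have d0 : dickson p a n.+1 != 0 by rewrite -size_poly_eq0 IH1.
have sz : size (p * dickson p a n.+1) = (n.+2 * k).+1.
  by rewrite size_mul// sp IH1 addSn addnS mulSn.
have lt : (size (- (a * dickson p a n)%R) < size (p * dickson p a n.+1)%R)%N.
  rewrite sz size_polyN ltnS -addn2 addnC mulnDl; apply: size_polyM_bound => //.
  by apply: size_dickson; [rewrite sp|exact: ltnW].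
by rewrite dicksonSS size_polyDl// lead_coefDl// lead_coefM sz IH2 -exprS.
Qed.

(** With [x = 2 tau cos theta] the value is [2 tau^n cos (n theta)], as for Chebyshev
    polynomials. *)
Lemma dickson_bound (R : realType) (x tau : R) n : 0 < tau -> `|x| <= 2 * tau ->
  `|dickson x (tau ^+ 2) n| <= 2 * tau ^+ n.
Proof.
move=> t0 xt; pose y := x / (2 * tau).
have t20 : 0 < 2 * tau by rewrite mulr_gt0.
have y1 : -1 <= y <= 1.
  by rewrite -ler_norml /y normrM normfV (gtr0_norm t20) ler_pdivrMr// mul1r.
have xE : x = 2 * tau * cos (acos y).
  by rewrite acosK ?in_itv//= /y mulrC divfK// gt_eqF.
suff -> : dickson x (tau ^+ 2) n = 2 * tau ^+ n * cos (n%:R * acos y).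
  rewrite normrM ger0_norm; last by rewrite mulr_ge0// exprn_ge0// ltW.
  rewrite ler_piMr//; last by rewrite ler_norml cos_geN1 cos_le1.
  by rewrite mulr_ge0// exprn_ge0// ltW.
elim/nat_ind2: n => [||n IH1 IH2].
- by rewrite /= mul0r cos0 expr0 !mulr1.
- by rewrite /= mul1r expr1.
rewrite dicksonSS IH1 IH2 {1}xE.
have -> : n.+2%:R * acos y = n.+1%:R * acos y + acos y.
  by rewrite -[n.+2]addn1 natrD; ring.
have -> : n%:R * acos y = n.+1%:R * acos y - acos y.
  by rewrite -[n.+1]addn1 natrD; ring.
by rewrite cosB cosD !exprS; ring.
Qed.

(** The factor 2 disappears on taking n-th roots; if [y < x], any [n] above [ln 2 / (ln x - ln y)]
    gives a contradiction. *)
Lemma ler_of_exp (R : realType) (x y : R) : 0 < y ->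
  (forall n, x ^+ n <= 2 * y ^+ n) -> x <= y.
Proof.
move=> y0 H; rewrite leNgt; apply/negP => yx.
have x0 := lt_trans y0 yx.
have d0 : 0 < ln x - ln y by rewrite subr_gt0 ltr_ln.
pose n := (Num.truncn (ln 2 / (ln x - ln y))).+1.
have := H n; rewrite -ler_ln ?posrE ?mulr_gt0 ?exprn_gt0//.
rewrite lnM ?posrE ?exprn_gt0// !lnXn// -lerBlDr -mulrnBl leNgt.
rewrite -[ltRHS]mulr_natl -ltr_pdivrMr// => /negP; apply.
exact: truncnS_gt.
Qed.

(** * The boundary data ln |P| and the Szego factor *)

Section compact_set.
Variables (R : realType) (e : set R).
Hypothesis ce : compact e.

Lemma compact_continuous_bounded (f : R -> R) : {within e, continuous f} ->
  exists M, forall x, e x -> `|f x| <= M.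
Proof.
move=> cf.
have [M [Mr MP]] := compact_bounded (continuous_compact cf ce).
exists (M + 1) => x ex; apply: MP; first by rewrite ltrDl.
by exists x.
Qed.

Lemma compact_continuous_integrable (omega : probability (measurableTypeR R) R)
    (f : R -> R) : {within e, continuous f} ->
  omega.-integrable (e : set (measurableTypeR R)) (EFin \o f).
Proof.
move=> cf; have me : measurable (e : set (measurableTypeR R)).
  by apply: closed_measurable; exact: compact_closed.
have [M MP] := compact_continuous_bounded cf.
apply: measurable_bounded_integrable => //.
- exact: le_lt_trans (probability_le1 omega me) (ltry _).
- exact: subspace_continuous_measurable_fun.
- by exists M; split=> [|y My x ex]; [exact: num_real|
    exact: le_trans (MP _ ex) (ltW My)].
Qed.

Variable P : {poly R}.
Hypothesis P0 : forall x, e x -> P.[x] != 0.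

(** All boundary data are of this form: [ln (2 * tau ^+ N) + N ln |P|] for the Dickson polynomials
    and [0 + 1 * ln |P|] for [P] itself. *)
Lemma continuous_ln_poly (a b : R) :
  {within e, continuous (fun x => a + b * ln `|P.[x]|)}.
Proof.
apply: continuous_in_subspaceT => x /set_mem /P0 Px.
apply: cvgD; first exact: cvg_cst.
apply: cvgM; first exact: cvg_cst.
apply: (@continuous_comp _ _ _ (fun x => `|P.[x]|) (@ln R)).
  apply: (@continuous_comp _ _ _ (horner P) (fun y => `|y|)).
    exact: continuous_horner.
  exact: norm_continuous.
by apply: continuous_ln; rewrite normr_gt0.
Qed.

Lemma integral_ln_poly (omega : probability (measurableTypeR R) R) (a b : R) :
  omega e = 1%E ->
  (\int[omega]_(x in e) (a + b * ln `|P.[x]|)%:E)%E =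
  (a + b * \int[omega]_(x in e) ln `|P.[x]|)%:E.
Proof.
move=> oe; have me : measurable (e : set (measurableTypeR R)).
  by apply: closed_measurable; exact: compact_closed.
have i1 : omega.-integrable (e : set (measurableTypeR R))
    (EFin \o (fun x => ln `|P.[x]|)).
  apply: compact_continuous_integrable.
  by have := @continuous_ln_poly 0 1; under eq_fun do rewrite add0r mul1r.
under eq_integral do rewrite EFinD EFinM.
rewrite integralD//; last 2 first.
- exact: (@compact_continuous_integrable omega (cst a)
    (continuous_subspaceT (@cst_continuous _ _ _))).
- exact: integrableZl.
rewrite integralZl//; have -> := EFin_Rintegral me i1.
by rewrite integral_cst// [X in (_ * X)%E]oe mule1.
Qed.

Lemma szego_factor_inv_poly (omega : probability (measurableTypeR R) R) :
  omega e = 1%E ->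
  szego_factor e (fun x => 1 / `|P.[x]|) omega =
  expR (- \int[omega]_(x in e) ln `|P.[x]|).
Proof.
move=> oe; have me : measurable (e : set (measurableTypeR R)).
  by apply: closed_measurable; exact: compact_closed.
congr expR; rewrite -[RHS]mulN1r -RintegralZl//; last first.
  apply: compact_continuous_integrable.
  by have := @continuous_ln_poly 0 1; under eq_fun do rewrite add0r mul1r.
apply: eq_Rintegral => x /set_mem /P0 Px.
by rewrite div1r lnV ?mulN1r// posrE normr_gt0.
Qed.

End compact_set.

(** Taking real parts of coefficients keeps both normalizations, the value 1 at a real point and
    monicity, and does not increase the modulus on the real line. *)
Definition Re_poly (R : realType) (T : {poly R[i]}) : {poly R} :=
  \poly_(i < size T) complex.Re T`_i.

Section real_part.
Variable R : realType.
Implicit Types T : {poly R[i]}.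

Lemma Re_mul_real (z : R[i]) (x : R) :
  complex.Re (z * real_complex R x) = complex.Re z * x.
Proof. by case: z => a b /=; rewrite mulr0 subr0. Qed.

Lemma horner_Re_poly T x : (Re_poly T).[x] = complex.Re T.[real_complex R x].
Proof.
rewrite horner_poly horner_coef raddf_sum; apply: eq_bigr => i _ /=.
by rewrite -rmorphXn/= Re_mul_real.
Qed.

Lemma size_Re_poly T : (size (Re_poly T) <= size T)%N.
Proof. exact: size_poly. Qed.

Lemma monic_Re_poly T n : T \is monic -> size T = n.+1 ->
  size (Re_poly T) = n.+1 /\ lead_coef (Re_poly T) = 1.
Proof.
move=> /monicP mT sT; have lT : complex.Re T`_(size T).-1 = 1.
  by rewrite -lead_coefE mT.
have sz : size (Re_poly T) = n.+1.
  rewrite -sT; apply: size_poly_eq.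
  by rewrite lT oner_eq0.
by rewrite lead_coefE sz coef_poly sT ltnS leqnn -lT sT.
Qed.

Lemma le_Re_norm (z : R[i]) : `|complex.Re z| <= complex.Re `|z|.
Proof. by have := normc_ge_Re z; rewrite lecE => /andP[]. Qed.

Lemma Re_norm_real_mul (x : R) (z : R[i]) :
  complex.Re `|real_complex R x * z| = `|x| * complex.Re `|z|.
Proof.
have nE : `|real_complex R x| = real_complex R `|x|.
  by rewrite normc_def/= expr0n addr0 sqrtr_sqr.
by rewrite normrM nE mulrC Re_mul_real mulrC.
Qed.

Lemma Re_norm_horner_bound T (B : R) : exists M, forall x, `|x| <= B ->
  complex.Re `|T.[real_complex R x]| <= M.
Proof.
exists (complex.Re (\sum_(i < size T) `|T`_i| * real_complex R B ^+ i)).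
move=> x xB.
suff : `|T.[real_complex R x]| <= \sum_(i < size T) `|T`_i| * real_complex R B ^+ i.
  by rewrite lecE => /andP[].
rewrite horner_coef (le_trans (ler_norm_sum _ _ _))//.
apply: ler_sum => i _; rewrite normrM ler_wpM2l// normrX lerXn2r// ?nnegrE//.
  by rewrite lecR (le_trans _ xB).
by rewrite normc_def/= expr0n addr0 sqrtr_sqr lecR.
Qed.

(** [wnorm] is a real [sup], which bounds its set only if the set is bounded above. Hence [1 / |P|]
    is bounded on [e] by compactness and [T] through its coefficients. *)
Lemma Re_poly_le_wnorm (e : set R) (P : {poly R}) T x : compact e ->
  (forall y, e y -> P.[y] != 0) -> e x ->
  `|(Re_poly T).[x]| <= wnorm e (fun y => 1 / `|P.[y]|) T * `|P.[x]|.
Proof.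
move=> ce P0 ex.
have [M MP] := compact_continuous_bounded ce (@continuous_ln_poly _ e P P0 0 1).
have [B [Br BP]] := compact_bounded ce.
have [N NP] := Re_norm_horner_bound T (B + 1).
rewrite -ler_pdivrMr ?normr_gt0 ?P0//.
apply: le_trans (_ : complex.Re `|real_complex R (1 / `|P.[x]|) *
    T.[real_complex R x]| <= _); last first.
  apply: sup_upper_bound; last by exists x.
  split; first by exists (complex.Re `|real_complex R (1 / `|P.[x]|) *
    T.[real_complex R x]|), x.
  exists (expR M * N) => _ [y ey <-]; rewrite Re_norm_real_mul.
  have Py : 0 < `|P.[y]| by rewrite normr_gt0 P0.
  apply: ler_pM => //.
  - by rewrite (le_trans _ (le_Re_norm _)).
  - rewrite div1r ger0_norm ?invr_ge0// -[leLHS]lnK ?posrE ?invr_gt0//.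
    rewrite ler_expR lnV ?posrE// (le_trans (ler_norm _))// normrN.
    by have := MP _ ey; rewrite add0r mul1r.
  - by apply: NP; apply: BP => //; rewrite ltrDl.
rewrite Re_norm_real_mul horner_Re_poly div1r normfV normr_id mulrC.
by rewrite ler_wpM2l ?invr_ge0// le_Re_norm.
Qed.

End real_part.

(** Applied with [y = tau |P(a)|] and [q = exp (-(n - m) g(a))]. For [y <= 1] the roots of
    [l^2 - 2 l + y^2] are [1 + s] and [1 - s], both nonnegative, so the growth bound yields
    [1 + s <= A]. *)
Lemma dickson_growth (R : realType) (A y q : R) : 0 < A -> 0 <= y ->
  y <= A * q -> (forall N, `|dickson 2 (y ^+ 2) N| <= 2 * A ^+ N) ->
  2 <= A * (1 + q ^+ 2).
Proof.
move=> A0 y0 yAq H.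
have yAq2 : y ^+ 2 <= (A * q) ^+ 2 by rewrite lerXn2r// nnegrE (le_trans y0).
(* For [y > 1] the roots are not real, but then [1 < A * q] already suffices, since
   [2 q <= 1 + q^2]. *)
have [y1|y1] := leP y 1; last first.
  have : 1 < A * q by exact: lt_le_trans yAq.
  have : 0 <= A * (1 - q) ^+ 2 by rewrite mulr_ge0// ?sqr_ge0// ltW.
  by nra.
have y21 : y ^+ 2 <= 1 by rewrite expr_le1.
pose s := Num.sqrt (1 - y ^+ 2).
have s2 : s ^+ 2 = 1 - y ^+ 2 by rewrite sqr_sqrtr// subr_ge0.
have s0 : 0 <= s by exact: sqrtr_ge0.
have s1 : s <= 1.
  by rewrite -(@expr_le1 _ 2)// s2 lerBlDr lerDl sqr_ge0.
have sA : 1 + s <= A.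
  apply: ler_of_exp => // N; apply: le_trans (H N); apply: le_trans (ler_norm _).
  have -> : 2 = (1 + s) + (1 - s) :> R by ring.
  have -> : y ^+ 2 = (1 + s) * (1 - s).
    by rewrite -[LHS](subKr 1) -s2; ring.
  by rewrite dickson_roots lerDl exprn_ge0// subr_ge0.
have A1 : 1 <= A by apply: le_trans sA; rewrite lerDl.
have : s ^+ 2 <= (A - 1) ^+ 2.
  by rewrite lerXn2r// ?nnegrE ?subr_ge0// lerBrDl.
rewrite s2 => sA2.
have : 0 <= A * (A * (1 + q ^+ 2) - 2).
  by move: yAq2 sA2; rewrite exprMn; lra.
by rewrite pmulr_rge0// subr_ge0.
Qed.

(** * The two lower bounds, at a finite point and at infinity *)

Section lower_bounds.
Variables (R : realType) (e : set R).
Variables (omega : probability (measurableTypeR R) R) (P q : {poly R}).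
Variables (m n : nat) (tau : R).
Hypotheses (ce : compact e) (sP : size P = m.+1).
Hypothesis P0 : forall x, e x -> P.[x] != 0.
Hypotheses (sq : (size q <= n.+1)%N) (mn : (m < n)%N).
Hypothesis tau0 : 0 < tau.
Hypothesis qP : forall x, e x -> `|q.[x]| <= tau * `|P.[x]|.

Let s := \int[omega]_(x in e) ln `|P.[x]|.
Let D N := dickson (2 *: q) (tau ^+ 2 *: P ^+ 2) N.

Let D_horner N x : (D N).[x] = dickson (2 * q.[x]) ((tau * `|P.[x]|) ^+ 2) N.
Proof.
by rewrite horner_dickson !hornerZ horner_exp exprMn real_normK// num_real.
Qed.

Let D_bound N x : e x ->
  `|(D N).[x]| <= expR (ln (2 * tau ^+ N) + N%:R * ln `|P.[x]|).
Proof.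
move=> ex; have Px : 0 < `|P.[x]| by rewrite normr_gt0 P0.
rewrite expRD lnK ?posrE ?mulr_gt0 ?exprn_gt0// expRM_natl lnK ?posrE//.
rewrite -mulrA -exprMn D_horner dickson_bound ?mulr_gt0//.
by rewrite normrM ger0_norm// ler_pM2l// qP.
Qed.

Let size_sqP : size (tau ^+ 2 *: P ^+ 2) = (2 * m).+1.
Proof.
have P00 : P != 0 by rewrite -size_poly_eq0 sP.
by rewrite size_scale ?gt_eqF ?exprn_gt0// expr2 size_mul// sP addSn addnS mul2n addnn.
Qed.

(** Collects the Bernstein-Walsh bound for [D N] into [2 * A ^+ N], the shape that [dickson_growth]
    and [ler_of_exp] expect. *)
Let expR_bound N V : expR (ln (2 * tau ^+ N) + N%:R * s + (N * n)%:R * V) =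
  2 * (tau * expR (s + n%:R * V)) ^+ N.
Proof.
rewrite exprMn mulrA -expRM_natl natrM -addrA expRD lnK; last first.
  by rewrite posrE mulr_gt0// exprn_gt0.
by congr (_ * expR _); ring.
Qed.

Lemma finite_lower_bound g a : is_green e g -> ~ e a ->
  is_harmonic_measure e (real_line (Some a)) omega -> q.[a] = 1 ->
  2 * expR (- s) /
    (1 + expR (- (2 * (n%:R - m%:R)) * fine (g (Some (a, 0))))) <=
  tau * expR (n%:R * fine (g (Some (a, 0)))).
Proof.
move=> gg ea hm qa; have oe := hm.1; set G := fine _.
pose A := tau * expR (s + n%:R * G).
have A0 : 0 < A by rewrite mulr_gt0// expR_gt0.
have sD N : (size (D N) <= (N * n).+1)%N.
  apply: size_dickson; first by exact: leq_trans (size_scale_leq _ _) sq.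
  by rewrite size_sqP ltnS leq_mul2l ltnW.
have DA N : `|dickson 2 ((tau * `|P.[a]|) ^+ 2) N| <= 2 * A ^+ N.
  have -> : dickson 2 ((tau * `|P.[a]|) ^+ 2) N = (D N).[a].
    by rewrite D_horner qa mulr1.
  have := bernstein_walsh ce gg ea hm
    (@continuous_ln_poly _ _ _ P0 (ln (2 * tau ^+ N)) N%:R)
    (integral_ln_poly ce P0 _ _ oe) (sD N) (@D_bound N).
  by rewrite expR_bound.
(* Bernstein-Walsh for [P] of degree [m] gives [exp (s + m G)]; measured against [A], which contains
   [n G], this leaves [exp (-(n - m) G)]. *)
have PA : tau * `|P.[a]| <= A * expR (- (n%:R - m%:R) * G).
  rewrite /A -mulrA -expRD ler_pM2l//.
  have PP x : e x -> `|P.[x]| <= expR (0 + 1 * ln `|P.[x]|).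
    by move=> ex; rewrite add0r mul1r lnK// posrE normr_gt0 P0.
  have := bernstein_walsh ce gg ea hm (@continuous_ln_poly _ _ _ P0 0 1)
    (integral_ln_poly ce P0 _ _ oe) (eq_leq sP) PP.
  by rewrite -/s -/G; congr (is_true (_ <= expR _)); ring.
have y0 : 0 <= tau * `|P.[a]| by rewrite mulr_ge0// ltW.
have := dickson_growth A0 y0 PA DA.
have -> : expR (- (n%:R - m%:R) * G) ^+ 2 = expR (- (2 * (n%:R - m%:R)) * G).
  by rewrite -expRM_natl; congr expR; ring.
move=> H; rewrite ler_pdivrMr; last by rewrite ltr_wpDr// ?expR_ge0.
rewrite -ler_pdivlMr ?expR_gt0// -expRN opprK; apply: le_trans H _.
by rewrite /A expRD; set X := expR (- (2 * _) * _); lra.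
Qed.

Lemma infinite_lower_bound : (0 < capacity e)%E ->
  is_harmonic_measure e (real_line None) omega ->
  size q = n.+1 -> lead_coef q = 1 ->
  2 * expR (- s) <= tau / fine (capacity e) ^+ n.
Proof.
move=> cap hm sq1 lq; have oe := hm.1.
have H eps : 0 < eps ->
    2 * expR (- s) <= tau / fine (capacity e) ^+ n * expR (n%:R * eps).
  move=> eps0.
  have [G [V [r0 [capE [G0 mG] r00 growth circ]]]] := equilibrium_green ce cap eps0.
  have A0 : 0 < tau * expR (s + n%:R * V) by rewrite mulr_gt0// expR_gt0.
  have : 2 <= tau * expR (s + n%:R * V).
    (* The exponent 0 is treated apart: [D 0] is the constant 2 and does not follow the formula for
       leading coefficients. *)
    apply: ler_of_exp => // -[|N]; first by rewrite !expr0 mulr1 ler1n.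
    have [sD lD] : size (D N.+1) = (N.+1 * n).+1 /\
        lead_coef (D N.+1) = lead_coef (2 *: q) ^+ N.+1.
      apply: lead_coef_dickson; first by rewrite size_scale// pnatr_eq0.
      by rewrite size_sqP ltn_mul2l.
    have := bernstein_walsh_infty ce hm
      (@continuous_ln_poly _ _ _ P0 (ln (2 * tau ^+ N.+1)) N.+1%:R)
      (integral_ln_poly ce P0 _ _ oe) sD (@D_bound N.+1) G0 mG r00 growth circ.
    rewrite lD lead_coefZ lq mulr1 ger0_norm ?exprn_ge0//.
    by rewrite expR_bound.
  have -> : fine (capacity e) ^+ n = expR (n%:R * eps) / expR (n%:R * V).
    by rewrite capE -expRM_natl -expRN -expRD; congr expR; ring.
  rewrite expRN expRD invf_div => h; rewrite ler_pdivrMr ?expR_gt0//.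
  apply: le_trans h _; rewrite le_eqVlt; apply/orP; left; apply/eqP.
  by field; rewrite !gt_eqF ?expR_gt0.
have C0 : 0 < fine (capacity e).
  have [G [V [r0 [-> _ _ _ _]]]] := equilibrium_green ce cap ltr01.
  exact: expR_gt0.
have X0 : 0 < tau / fine (capacity e) ^+ n by rewrite divr_gt0// exprn_gt0.
have n0 : 0 < n%:R :> R by rewrite ltr0n (leq_ltn_trans _ mn).
have S0 : 0 < 2 * expR (- s) by rewrite mulr_gt0// expR_gt0.
(* After taking logarithms the error of [H] is [n * eps], so [eps = d / n] makes it equal to [d]. *)
rewrite -ler_ln ?posrE//; apply/ler_addgt0Pr => d d0.
have := H (d / n%:R) (divr_gt0 d0 n0).
rewrite -ler_ln ?posrE ?(mulr_gt0 X0) ?expR_gt0//.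
by rewrite [ln (_ / _ * _)]lnM ?posrE ?expR_gt0// expRK mulrCA divff ?gt_eqF// mulr1.
Qed.

End lower_bounds.

(** The norm [t] is only known to be nonnegative, whereas [ln (2 * tau ^+ N)] asks for a positive
    number; the bounds are proved for positive [tau >= t] and passed to the limit. *)
Lemma ler_mul_gt (R : realType) (x t c : R) : 0 <= t -> 0 < c ->
  (forall tau, 0 < tau -> t <= tau -> x <= tau * c) -> x <= t * c.
Proof.
move=> t0 c0 H; apply/ler_addgt0Pr => d d0.
have dc0 : 0 < d / c by rewrite divr_gt0.
have := H (t + d / c); rewrite mulrDl divfK ?gt_eqF//.
by apply; [rewrite ltr_wpDl|rewrite lerDl ltW].
Qed.

Lemma size_admissible (R : realType) (x : option R) n (Q : {poly R[i]}) :
  admissible x n Q -> (size Q <= n.+1)%N.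
Proof. by case: x => [a|] [] // _ ->. Qed.

Theorem theorem2p7 (R : realType) (e : set R) (xs : option R) (m : nat)
    (P : {poly R}) (g : sphere R -> \bar R)
    (omega : probability (measurableTypeR R) R) (T : nat -> {poly R[i]}) :
  let w0 := fun x : R => 1 / `|P.[x]| in
  compact e ->
  (0 < capacity e)%E ->
  ~ [set Some x | x in e] xs ->
  size P = m.+1 ->
  (forall z : R[i], root (map_poly (real_complex R) P) z ->
     ~ [set real_complex R x | x in e] z) ->
  is_green e g ->
  is_harmonic_measure e (real_line xs) omega ->
  (forall n, is_extremal e w0 xs n (T n)) ->
  let n0 := (2 * (m + 1) - (size (T (m + 1)%N)).-1)%N in
  forall n : nat, (n0 <= n)%N ->
    2 * szego_factor e w0 omega /
      (1 + fine (expeR (- (2 * (n%:R - m%:R))%:E * g (real_line xs))%E))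
    <= widom_factor e g xs n (wnorm e w0 (T n)).
Proof.
move=> w0 ce cap exs sP rP gg hm extr n0 n n0n.
have oe := hm.1.
have P0 x : e x -> P.[x] != 0.
  move=> ex; apply/negP => Px; apply: (rP (real_complex R x)); last by exists x.
  by rewrite fmorph_root.
(* The degree of [T (m + 1)] is at most [m + 1], so the truncated subtraction in [n0] is a true one
   and [m + 1 <= n0]. *)
have mn : (m < n)%N.
  apply: leq_trans n0n; rewrite /n0.
  have := size_admissible (extr (m + 1)%N).1.
  rewrite -ltnS => sT; have sT1 : ((size (T (m + 1)%N)).-1 <= m + 1)%N.
    by rewrite -subn1 leq_subLR add1n -ltnS.
  by apply: leq_trans (leq_sub2l _ sT1); rewrite mul2n -addnn addnK addn1.
have aT := (extr n).1.
set t := wnorm e w0 (T n).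
have qt x : e x -> `|(Re_poly (T n)).[x]| <= t * `|P.[x]|.
  exact: Re_poly_le_wnorm.
(* [omega e = 1] makes [e] nonempty; at a point of [e] the bound [qt] forces [t] to be
   nonnegative. *)
have t0 : 0 <= t.
  have [x ex] : e !=set0.
    apply/set0P/negP => /eqP e0; move: oe; rewrite e0 measure0.
    by case=> h; have := oner_eq0 R; rewrite -h eqxx.
  by have := le_trans (normr_ge0 _) (qt x ex); rewrite pmulr_lge0// normr_gt0 P0.
rewrite szego_factor_inv_poly//.
case: xs => [a|] in exs hm aT extr *.
- have ea : ~ e a by move=> ea; apply: exs; exists a.
  have gf : g (Some (a, 0)) \is a fin_num.
    by apply: (green_fin gg) => -[x ex [xa]]; apply: ea; rewrite -xa.
  have [sT Ta] := aT.
  apply: ler_mul_gt => //; first exact: expR_gt0.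
  move=> tau tau0 ttau; rewrite /= -{1}(fineK gf)/=.
  apply: (@finite_lower_bound _ _ _ _ (Re_poly (T n))) => //.
  + exact: leq_trans (size_Re_poly _) sT.
  + by move=> x ex; apply: le_trans (qt x ex) _; rewrite ler_wpM2r.
  + by rewrite horner_Re_poly Ta.
- have [mT sT] := aT.
  have [sq lq] := monic_Re_poly mT sT.
  have c0 : (- (2 * (n%:R - m%:R)) < 0 :> R).
    by rewrite oppr_lt0 mulr_gt0// subr_gt0 ltr_nat.
  (* At infinity [g] is +oo and its coefficient is negative, so the exponential is 0 and the
     denominator is 1. *)
  rewrite /= (green_pole gg) lt0_muley ?lte_fin//= addr0 divr1.
  have C0 : 0 < (fine (capacity e) ^+ n)^-1.
    have [G [V [r0 [-> _ _ _ _]]]] := equilibrium_green ce cap ltr01.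
    by rewrite invr_gt0 exprn_gt0// expR_gt0.
  apply: ler_mul_gt => // tau tau0 ttau.
  apply: (@infinite_lower_bound _ _ _ _ (Re_poly (T n)) m) => //.
  by move=> x ex; apply: le_trans (qt x ex) _; rewrite ler_wpM2r.
Qed.
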